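(* Let $A\subseteq\mathbf R^{n+1}$ be a closed set with $\mathrm{reach}(A)>0$. Let $(a,\eta)\in\widetilde N^\phi_n(A)$, $u\in N(A,a)$ with $\nabla\phi(u)=\eta$, and $\nu\in\mathbf S^n\setminus u^\perp$. Then: (a) there exist $\epsilon(\nu)>0$ and a function $f_\nu:U_{\epsilon(\nu)}(a,\nu)\to\mathbf R$ which is differentiable at $a$ and satisfies $\{b+f_\nu(b)\nu:b\in U_{\epsilon(\nu)}(a,\nu)\}\subseteq\partial A$; (b) for $\nu=u$ (with $f_u$ as in (a)) there exists a map $\tilde\eta:U_{\epsilon(u)}(a,u)\to\partial\mathcal W^\phi$ with $\tilde\eta(b)\in N^\phi(A,b+f_u(b)u)$ for every $b$, $\tilde\eta(a)=\eta$, $\tilde\eta$ differentiable at $a$, and the eigenvalues $\lambda_1\le\dots\le\lambda_n$ of $D\tilde\eta(a)$ satisfy $\lambda_i=\kappa^\phi_{A,i}(a,\eta)$ for $i=1,\dots,n$. Moreover, $\mathbf p(\widetilde N^\phi_n(A))\cap\mathbf p(\widetilde N^\phi(A)\setminus\widetilde N^\phi_n(A))=\varnothing$, where $\mathbf p(a,\eta)=a$.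
   Context: Notation. $n\ge1$; $\mathbf{R}^{n+1}$ with Euclidean inner product $\bullet$, norm $|\cdot|$, unit sphere $\mathbf S^n$; $\mathcal L^{n+1}$ Lebesgue measure. For $a\in\mathbf R^{n+1}$, $\nu\in\mathbf S^n$, $\varepsilon>0$: $U_\varepsilon(a,\nu)=\{x\in a+\nu^\perp:|x-a|<\varepsilon\}$. $\phi$ is a norm on $\mathbf R^{n+1}$ of class $C^2$ on $\mathbf R^{n+1}\setminus\{0\}$, uniformly convex (there is $\gamma>0$ with $u\mapsto\phi(u)-\gamma|u|$ convex). $\phi^*(u)=\sup\{v\bullet u:\phi(v)=1\}$; $\mathcal W^\phi=\{x:\phi^*(x)\le1\}$; $\mathbf n^\phi:\partial\mathcal W^\phi\to\mathbf S^n$ its Euclidean exterior unit normal. For nonempty closed $A$: $\delta^\phi_A(x)=\min\{\phi^*(x-c):c\in A\}$; $\xi^\phi_A(x)=\{c\in A:\phi^*(x-c)=\delta^\phi_A(x)\}$; for $x\notin A$, $\nu^\phi_A(x)=\{\delta^\phi_A(x)^{-1}(x-c):c\in\xi^\phi_A(x)\}$. $\nu^\phi_A$ is differentiable at $x\notin A$ if $\nu^\phi_A(x)$ is a singleton and there is linear $L$ such that for every $\varepsilon>0$ there is $\delta>0$ with $|w-\nu^\phi_A(x)-L(y-x)|\le\varepsilon|y-x|$ for $y\notin A$, $|y-x|<\delta$, $w\in\nu^\phi_A(y)$; $D\nu^\phi_A(x)=L$; $\mathrm{dmn}D\nu^\phi_A$ the set of such $x$. $N^\phi(A)=\{(a,\eta)\in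 A\times\partial\mathcal W^\phi:\delta^\phi_A(a+r\eta)=r$ for some $r>0\}$, $N^\phi(A,a)$ its fibre; $\mathbf r^\phi_A(a,\eta)=\sup\{s>0:\delta^\phi_A(a+s\eta)=s\}$. For $x\notin A$, $a\in\xi^\phi_A(x)$: $\rho^\phi_A(x)=\sup\{s\ge0:\delta^\phi_A(a+s(x-a))=s\delta^\phi_A(x)\}$. $\underline{\mathbf r}^\phi_A(a,\eta)$ is the supremum of $\{0\}$ and all $\sigma r$ with $\sigma>1$, $0<r<\mathbf r^\phi_A(a,\eta)$, such that $\{x\notin A:\rho^\phi_A(x)\ge\sigma\}$ has Lebesgue density $1$ at $a+r\eta$. For $x\in\mathrm{dmn}D\nu^\phi_A$, $D\nu^\phi_A(x)$ maps $\mathbf n^\phi(\nu^\phi_A(x))^\perp$ into itself with real eigenvalues $\chi^\phi_{A,1}(x)\le\dots\le\chi^\phi_{A,n}(x)$. $\widetilde N^\phi(A)$: $(a,\eta)\in N^\phi(A)$ with $a+r\eta\in\mathrm{dmn}D\nu^\phi_A$ for some (then all) $r\in(0,\underline{\mathbf r}^\phi_A(a,\eta))$; $\kappa^\phi_{A,i}(a,\eta)=\chi^\phi_{A,i}(a+r\eta)/(1-r\chi^\phi_{A,i}(a+r\eta))\in(-\infty,+\infty]$ (independent of $r$). $\widetilde N^\phi_n(A)$ is the set of $(a,\eta)\in\widetilde N^\phi(A)$ with all $\kappa^\phi_{A,i}(a,\eta)$ finite. Without superscript everything refers to the Euclidean norm: $N(A,a)\subseteq\mathbf S^n$ is the fibre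 of the Euclidean unit normal bundle; $\mathrm{reach}(A)$ is the supremum of $\rho\ge0$ such that every point at Euclidean distance $<\rho$ from $A$ has a unique nearest point in $A$. *)

(* Defs.v *)
(* R^{n+1} is modelled as 'rV[R]_(n.+1)
   (row vectors) over an arbitrary R : realType; linear maps are matrices
   acting on the right (v |-> v *m L).  The Euclidean structure is defined
   explicitly (dot, enorm); the library's topology on 'rV (max-norm) induces
   the same topology, so "closed", "closure", "interior", derivatives agree. *)
From mathcomp Require Import all_boot all_order all_algebra.
From mathcomp Require Import all_classical all_reals all_analysis.
Import numFieldNormedType.Exports.
Import Order.TTheory GRing.Theory Num.Theory.
Set Implicit Arguments.
Unset Strict Implicit.
Unset Printing Implicit Defensive.
Local Open Scope ring_scope.
Local Open Scope classical_set_scope.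

Section Defs.
Context {R : realType} {n : nat}.
Notation V := 'rV[R]_(n.+1).

Definition dot (u v : V) : R := \sum_(i < n.+1) u 0 i * v 0 i.
Definition enorm (v : V) : R := Num.sqrt (dot v v).
Definition sphere : set V := [set v | enorm v = 1].
Definition ebasis (i : 'I_n.+1) : V := delta_mx 0 i.
Definition Uball (eps : R) (a nu : V) : set V :=
  [set x | dot (x - a) nu = 0 /\ enorm (x - a) < eps].
Definition bdry (A : set V) : set V := closure A `\` interior A.

Definition is_norm (phi : V -> R) : Prop :=
  (forall u, 0 <= phi u) /\ (forall u, phi u = 0 -> u = 0) /\
  (forall (t : R) u, phi (t *: u) = `|t| * phi u) /\
  (forall u v, phi (u + v) <= phi u + phi v).

Definition convex_fun (f : V -> R) : Prop :=
  forall (u v : V) (t : R), 0 <= t <= 1 ->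
    f (t *: u + (1 - t) *: v) <= t * f u + (1 - t) * f v.

Definition unif_convex (phi : V -> R) : Prop :=
  exists gamma : R, 0 < gamma /\ convex_fun (fun u => phi u - gamma * enorm u).

Definition C2_on (U : set V) (f : V -> R) : Prop :=
  {within U, continuous f} /\
  forall i j : 'I_n.+1,
    (forall x, U x -> derivable f x (ebasis i)) /\
    {within U, continuous (fun x => 'D_(ebasis i) f x)} /\
    (forall x, U x -> derivable (fun y => 'D_(ebasis i) f y) x (ebasis j)) /\
    {within U, continuous (fun x => 'D_(ebasis j) (fun y => 'D_(ebasis i) f y) x)}.

Definition admissible_norm (phi : V -> R) : Prop :=
  is_norm phi /\ C2_on [set u | u != 0] phi /\ unif_convex phi.

Definition is_grad (f : V -> R) (x g : V) : Prop :=
  forall v, derivable f x v /\ 'D_v f x = dot g v.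

Definition phistar (phi : V -> R) (u : V) : R :=
  sup [set dot v u | v in [set v | phi v = 1]].

Definition Wphi (phi : V -> R) : set V := [set x | phistar phi x <= 1].
Definition bdWphi (phi : V -> R) : set V := bdry (Wphi phi).

Definition ext_normal (phi : V -> R) (y w : V) : Prop :=
  bdWphi phi y /\ enorm w = 1 /\
  (forall z, Wphi phi z -> dot w (z - y) <= 0).

(* delta_A(x) = min { g (x - c) : c in A } (the min exists for closed A) *)
Definition dist_g (g : V -> R) (A : set V) (x : V) : R :=
  inf [set g (x - c) | c in A].
Definition xi_g (g : V -> R) (A : set V) (x : V) : set V :=
  [set c | A c /\ g (x - c) = dist_g g A x].
Definition nu_g (g : V -> R) (A : set V) (x : V) : set V :=
  [set (dist_g g A x)^-1 *: (x - c) | c in xi_g g A x].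

Definition dphi phi := dist_g (phistar phi).
Definition xiphi phi := xi_g (phistar phi).
Definition nuphi phi := nu_g (phistar phi).

Definition Dnu_is (phi : V -> R) (A : set V) (x : V) (L : 'M[R]_n.+1) : Prop :=
  ~ A x /\ (exists v0, nuphi phi A x = [set v0] /\
    forall eps : R, 0 < eps -> exists del : R, 0 < del /\
      forall y w, ~ A y -> enorm (y - x) < del -> nuphi phi A y w ->
        enorm (w - v0 - (y - x) *m L) <= eps * enorm (y - x)).
Definition dmnDnu phi A x : Prop := exists L, Dnu_is phi A x L.

Definition edist := dist_g enorm.

Definition Nphi (phi : V -> R) (A : set V) (a eta : V) : Prop :=
  A a /\ bdWphi phi eta /\
  exists r : R, 0 < r /\ dphi phi A (a + r *: eta) = r.
Definition Neucl (A : set V) (a u : V) : Prop :=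
  A a /\ sphere u /\ exists r : R, 0 < r /\ edist A (a + r *: u) = r.

Definition rphi (phi : V -> R) (A : set V) (a eta : V) : \bar R :=
  ereal_sup [set s%:E | s in [set s : R | 0 < s /\ dphi phi A (a + s *: eta) = s]].

Definition rho_ge (phi : V -> R) (A : set V) (x : V) (sigma : R) : Prop :=
  ~ A x /\ exists a, xiphi phi A x a /\
    (sigma%:E <= ereal_sup [set s%:E | s in [set s : R | (0 <= s /\
        dphi phi A (a + s *: (x - a)) = s * dphi phi A x)%R]])%E.

Definition box (lh : V * V) : set V :=
  [set x | forall i, lh.1 0 i <= x 0 i <= lh.2 0 i].
Definition boxvol (lh : V * V) : R :=
  \prod_(i < n.+1) Num.max 0 (lh.2 0 i - lh.1 0 i).
Definition leb_outer (E : set V) : \bar R :=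
  ereal_inf [set (\sum_(0 <= k <oo) (boxvol (B k))%:E)%E |
               B in [set B : nat -> V * V | E `<=` \bigcup_k box (B k)]].
Definition eball (x : V) (r : R) : set V := [set y | enorm (y - x) < r].
Definition density_one (E : set V) (x : V) : Prop :=
  forall eps : R, 0 < eps -> exists del : R, 0 < del /\
    forall r : R, 0 < r < del ->
      `| fine (leb_outer (E `&` eball x r)) / fine (leb_outer (eball x r)) - 1 |
        < eps.

Definition urphi (phi : V -> R) (A : set V) (a eta : V) : \bar R :=
  ereal_sup ([set 0%E] `|`
    [set z : \bar R | exists sigma r : R, z = (sigma * r)%:E /\
       1 < sigma /\ 0 < r /\ (r%:E < rphi phi A a eta)%E /\
       density_one [set x | rho_ge phi A x sigma] (a + r *: eta)]).

(* s is the increasing list of the n eigenvalues (with algebraic multiplicity)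
   of the endomorphism v |-> v *m L of w^perp (|w| = 1); the restriction is
   realised as P_w L with P_w the orthogonal projection onto w^perp, whose
   characteristic polynomial is X times that of the restriction. *)
Definition projperp (w : V) : 'M[R]_n.+1 := 1%:M - w^T *m w.
Definition eigs_perp (L : 'M[R]_n.+1) (w : V) (s : seq R) : Prop :=
  size s = n /\ sorted <=%R s /\
  char_poly (projperp w *m L) = 'X * \prod_(t <- s) ('X - t%:P).

Definition chi_list (phi : V -> R) (A : set V) (x : V) (s : seq R) : Prop :=
  exists L v0 w, Dnu_is phi A x L /\ nuphi phi A x = [set v0] /\
    ext_normal phi v0 w /\ eigs_perp L w s.

Definition tNphi (phi : V -> R) (A : set V) (a eta : V) : Prop :=
  Nphi phi A a eta /\ exists r : R, 0 < r /\ (r%:E < urphi phi A a eta)%E /\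
    dmnDnu phi A (a + r *: eta).

(* kappa_i = chi_i / (1 - r chi_i), = +oo iff r chi_i = 1 *)
Definition kappa_of (r : R) (s : seq R) : seq R := [seq t / (1 - r * t) | t <- s].

(* tilde N^phi_n(A): all kappa_i finite *)
Definition tNphin (phi : V -> R) (A : set V) (a eta : V) : Prop :=
  tNphi phi A a eta /\ exists r s, 0 < r /\ (r%:E < urphi phi A a eta)%E /\
    chi_list phi A (a + r *: eta) s /\ all (fun t => r * t != 1) s.

Definition reach (A : set V) : \bar R :=
  ereal_sup [set rho%:E | rho in [set rho : R | 0 <= rho /\
    forall x, edist A x < rho ->
      exists c, A c /\ enorm (x - c) = edist A x /\
        forall c', A c' -> enorm (x - c') = edist A x -> c' = c]].

Definition rdiff_scalar (U : set V) (f : V -> R) (a : V) : Prop :=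
  exists g : V, forall eps : R, 0 < eps -> exists del : R, 0 < del /\
    forall b, U b -> enorm (b - a) < del ->
      `| f b - f a - dot g (b - a) | <= eps * enorm (b - a).
Definition rderiv_is (U : set V) (f : V -> V) (a : V) (L : 'M[R]_n.+1) : Prop :=
  forall eps : R, 0 < eps -> exists del : R, 0 < del /\
    forall b, U b -> enorm (b - a) < del ->
      enorm (f b - f a - (b - a) *m L) <= eps * enorm (b - a).

End Defs.

(* Main.v *)
From mathcomp Require Import all_boot all_order all_algebra.
From mathcomp Require Import all_classical all_reals all_analysis.
From mathcomp Require Import ring lra.
From mathcomp Require Import complex.
(* After the analysis library, whose [edist] would shadow the one of [Defs]. *)
Require Import Defs.
Import numFieldNormedType.Exports.
Import Order.TTheory GRing.Theory Num.Theory.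
Set Implicit Arguments.
Unset Strict Implicit.
Unset Printing Implicit Defensive.
Local Open Scope ring_scope.
Local Open Scope classical_set_scope.

(** Let [g] be the dual norm of [phi], so that the Wulff shape is its unit ball; [p] and [w] are
    dual if [phi p = g w = p . w = 1].  Uniform convexity and regularity of [phi] make [w |-> p]
    Lipschitz and differentiable, with a derivative [Q] that is symmetric and positive definite.

    Positive reach is used through two uniform facts: every normal [w] at [c] in [A], with dual
    [p], satisfies [(q - c) . p <= C |q - c|^2] for all [q] in [A], and the ray from [c] along [w]
    realizes the distance up to a fixed length.  Both come from maximizing the distance to [A] on
    a small ball centred on the ray: the maximum lies on the ray, which prolongs it.

    At [x = a + r eta] the distance function [delta] is semiconcave and its gradient is
    differentiable, so it has a second-order expansion whose Hessian [L Q], [L] being the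
    derivative of the normal direction, is symmetric; hence the eigenvalues of [L] are real, and
    they are at most [1 / r].  Finite curvatures mean that [1 - r L] is invertible: then moving
    [x] in a direction [v (1 - r L)^-1] moves its projection by [v + o(v)], so that the tangent
    cone of [A] at [a] contains a hyperplane.  By the first fact, normals near [a] are
    then close to the two normals of this hyperplane, so the nearest-point argument along a
    transversal segment shows that the segment meets [A]; its topmost point defines [f].

    The normal field [etat] along the graph satisfies [Delta = ((q - a) + t Delta) L_t + o], where
    [Delta = etat - eta] and [L_t] is the derivative transported down the normal to distance [t].
    Hence [D etat = L_t (1 - t L_t)^-1 = L (1 - r L)^-1], whose eigenvalues are the [kappa_i].

    For the disjointness, a second normal at [a] is the opposite one.  If one of its curvatures
    were infinite, [delta] would have second derivative [1 / r] in the eigendirection [v], while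
    [A] contains points [a + s v + O(s^2)] at which the distance from the displaced centre is
    strictly smaller. *)

(** * Euclidean space *)

(** The curvatures are read at a height [r] unrelated to the length up to which the normals at other
    points of [A] can be prolonged. Differentiating the normal field requires all nearby normals to
    reach one common height, hence the passage to a small [t]. It is harmless because
    [1 - t L_t = (1 - (r - t) L)^-1 (1 - r L)], where the inverse exists for every [0 < t < r] by
    the bound [1 / r] on the eigenvalues; finiteness of the curvatures is the limiting case [t = 0].

    Positive reach speaks of Euclidean projections, the normals of those for [g]. Two comparisons
    connect them: uniform convexity of [phi] fits a Euclidean ball of fixed radius inside the Wulff
    shape at each boundary point, and its C2 regularity encloses the Wulff shape in one.

    The normal direction is differentiable at a single point only, and may be multivalued around it.
    Second-order information therefore comes from one-sided semiconcavity near that point together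
    with the derivative at it. Likewise the graph function is a supremum of which only the behaviour
    at [a] is controlled. *)

Section Euclid.
Context {R : realType} {n : nat}.
Notation V := 'rV[R]_(n.+1).
Implicit Types (u v w x y : V) (t : R).

Lemma dotC u v : dot u v = dot v u.
Proof. by apply: eq_bigr => i _; rewrite mulrC. Qed.

Lemma dotDl u v w : dot (u + v) w = dot u w + dot v w.
Proof. by rewrite -big_split; apply: eq_bigr => i _; rewrite mxE mulrDl. Qed.

Lemma dotZl t u v : dot (t *: u) v = t * dot u v.
Proof. by rewrite mulr_sumr; apply: eq_bigr => i _; rewrite mxE mulrA. Qed.

Lemma dotNl u v : dot (- u) v = - dot u v.
Proof. by rewrite -scaleN1r dotZl mulN1r. Qed.

Lemma dotBl u v w : dot (u - v) w = dot u w - dot v w.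
Proof. by rewrite dotDl dotNl. Qed.

Lemma dotDr u v w : dot w (u + v) = dot w u + dot w v.
Proof. by rewrite !(dotC w) dotDl. Qed.

Lemma dotZr t u v : dot u (t *: v) = t * dot u v.
Proof. by rewrite !(dotC u) dotZl. Qed.

Lemma dotNr u v : dot u (- v) = - dot u v.
Proof. by rewrite !(dotC u) dotNl. Qed.

Lemma dotBr u v w : dot w (u - v) = dot w u - dot w v.
Proof. by rewrite !(dotC w) dotBl. Qed.

Lemma dot0l v : dot 0 v = 0.
Proof. by rewrite -(scale0r v) dotZl mul0r. Qed.

Lemma dot0r v : dot v 0 = 0.
Proof. by rewrite dotC dot0l. Qed.

Lemma dotE u v : dot u v = (u *m v^T) 0 0.
Proof. by rewrite mxE; apply: eq_bigr => i _; rewrite mxE. Qed.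

Lemma dot_mulmx u v (M : 'M[R]_n.+1) : dot (u *m M) v = dot u (v *m M^T).
Proof. by rewrite !dotE trmx_mul trmxK mulmxA. Qed.

Lemma dot_ge0 v : 0 <= dot v v.
Proof. by apply: sumr_ge0 => i _; rewrite -expr2 sqr_ge0. Qed.

Lemma dot_eq0 v : dot v v = 0 -> v = 0.
Proof.
move=> /eqP; rewrite psumr_eq0 => [/allP H|i _]; last by rewrite -expr2 sqr_ge0.
apply/rowP => i; rewrite mxE; have := H i (mem_index_enum _).
by rewrite /= -expr2 sqrf_eq0 => /eqP.
Qed.

Lemma enorm_ge0 v : 0 <= enorm v.
Proof. exact: sqrtr_ge0. Qed.

Lemma enorm_sqr v : enorm v ^+ 2 = dot v v.
Proof. by rewrite sqr_sqrtr // dot_ge0. Qed.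

Lemma enorm0 : enorm (0 : V) = 0.
Proof. by rewrite /enorm dot0l sqrtr0. Qed.

Lemma enorm_eq0 v : enorm v = 0 -> v = 0.
Proof. by move=> h; apply: dot_eq0; rewrite -enorm_sqr h expr0n. Qed.

Lemma enorm_gt0 v : v != 0 -> 0 < enorm v.
Proof.
move=> v0; rewrite lt_neqAle enorm_ge0 andbT eq_sym.
by apply: contra v0 => /eqP /enorm_eq0 ->.
Qed.

Lemma enormZ t v : enorm (t *: v) = `|t| * enorm v.
Proof. by rewrite /enorm dotZl dotZr mulrA -expr2 sqrtrM ?sqr_ge0 // sqrtr_sqr. Qed.

Lemma enormN v : enorm (- v) = enorm v.
Proof. by rewrite -scaleN1r enormZ normrN1 mul1r. Qed.

Lemma enormBC u v : enorm (u - v) = enorm (v - u).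
Proof. by rewrite -enormN opprB. Qed.

Lemma cauchy_schwarz_sqr u v : dot u v ^+ 2 <= dot u u * dot v v.
Proof.
have [->|v0] := eqVneq v 0; first by rewrite !dot0r expr0n mulr0.
have vv : 0 < dot v v by rewrite -enorm_sqr exprn_gt0 // enorm_gt0.
have := dot_ge0 (dot v v *: u - dot u v *: v).
rewrite !(dotBl, dotBr, dotZl, dotZr) (dotC v u) => h.
rewrite -subr_ge0 -(pmulr_rge0 _ vv); apply: le_trans h _.
by rewrite le_eqVlt; apply/orP; left; apply/eqP; ring.
Qed.

Lemma cauchy_schwarz u v : `|dot u v| <= enorm u * enorm v.
Proof.
rewrite -(@ler_pXn2r _ 2) ?nnegrE ?mulr_ge0 ?enorm_ge0 //.
by rewrite exprMn !enorm_sqr real_normK ?num_real // cauchy_schwarz_sqr.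
Qed.

Lemma dot_le u v : dot u v <= enorm u * enorm v.
Proof. exact: le_trans (ler_norm _) (cauchy_schwarz u v). Qed.

Lemma enormD u v : enorm (u + v) <= enorm u + enorm v.
Proof.
rewrite -(@ler_pXn2r _ 2) ?nnegrE ?addr_ge0 ?enorm_ge0 //.
rewrite sqrrD !enorm_sqr !(dotDl, dotDr) (dotC v u).
by have := dot_le u v; lra.
Qed.

Lemma enormB u v : enorm (u - v) <= enorm u + enorm v.
Proof. by rewrite -(enormN v) enormD. Qed.

Lemma enorm_dist u v w : enorm (u - w) <= enorm (u - v) + enorm (v - w).
Proof. by rewrite -[u - w](subrKA v) enormD. Qed.

Lemma enorm_rdist u v : enorm u - enorm v <= enorm (u - v).
Proof. by rewrite lerBlDr -{1}(subrK v u) enormD. Qed.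

Lemma coord_le_enorm v i : `|v 0 i| <= enorm v.
Proof.
rewrite -(@ler_pXn2r _ 2) ?nnegrE ?enorm_ge0 // real_normK ?num_real //.
rewrite enorm_sqr /dot (bigD1 i) //= -expr2 lerDl.
by apply: sumr_ge0 => j _; rewrite -expr2 sqr_ge0.
Qed.

Lemma enorm_le_coord v (c : R) : 0 <= c -> (forall i, `|v 0 i| <= c) ->
  enorm v <= n.+1%:R * c.
Proof.
move=> c0 h.
rewrite -(@ler_pXn2r _ 2) ?nnegrE ?mulr_ge0 ?enorm_ge0 //.
rewrite enorm_sqr.
apply: (@le_trans _ _ (\sum_(i < n.+1) c ^+ 2)).
  apply: ler_sum => i _; rewrite -expr2 -(real_normK (num_real (v 0 i))).
  by rewrite ler_pXn2r ?nnegrE.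
rewrite sumr_const card_ord exprMn -[leLHS]mulr_natl ler_wpM2r ?sqr_ge0 //.
by rewrite -natrX ler_nat leq_pmull.
Qed.

Lemma mulmx_bound (M : 'M[R]_n.+1) :
  exists2 K : R, 0 < K & forall v, enorm (v *m M) <= K * enorm v.
Proof.
pose B := \sum_i \sum_j `|M i j|.
have B0 : 0 <= B by apply: sumr_ge0 => i _; apply: sumr_ge0.
exists (n.+1%:R * B + 1).
  by rewrite ltr_wpDl // mulr_ge0.
move=> v; apply: (@le_trans _ _ (n.+1%:R * (B * enorm v))).
  apply: enorm_le_coord => [|j]; first by rewrite mulr_ge0 ?enorm_ge0.
  rewrite mxE (le_trans (ler_norm_sum _ _ _)) // mulr_suml ler_sum // => i _.
  rewrite normrM mulrC ler_pM // ?coord_le_enorm //.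
  by rewrite (bigD1 j) //= lerDl sumr_ge0.
by rewrite mulrDl mulrA lerDl mul1r enorm_ge0.
Qed.

Lemma mxnorm_le_enorm v : `|v| <= enorm v.
Proof.
rewrite [leLHS]/Num.norm /= mx_normrE; apply/bigmax_leP; split.
  exact: enorm_ge0.
by move=> [i j] _ /=; rewrite ord1 coord_le_enorm.
Qed.

Lemma enorm_le_mxnorm v : enorm v <= n.+1%:R * `|v|.
Proof.
apply: enorm_le_coord => // i.
rewrite [leRHS]/Num.norm /= mx_normrE; apply/bigmax_geP; right.
by exists (0, i).
Qed.

(** The topology on row vectors is that of the max norm; it differs from the Euclidean norm by a
    factor of at most [n + 1], so Euclidean balls form a basis of neighbourhoods too. *)
Lemma nbhs_enormP x (U : set V) :
  nbhs x U <-> exists2 e : R, 0 < e & forall y, enorm (y - x) < e -> U y.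
Proof.
split.
  move=> /nbhs_ballP[e /= e0 H]; exists e => // y hy; apply: H.
  rewrite -ball_normE /ball_ /= distrC; exact: le_lt_trans (mxnorm_le_enorm _) hy.
move=> [e e0 H]; apply/nbhs_ballP; exists (e / n.+1%:R) => /=.
  by rewrite divr_gt0.
move=> y; rewrite -ball_normE /ball_ /= distrC => hy; apply: H.
by rewrite (le_lt_trans (enorm_le_mxnorm _)) // mulrC -ltr_pdivlMr.
Qed.

Lemma closed_enorm (A : set V) x : closed A -> ~ A x ->
  exists2 e : R, 0 < e & forall y, enorm (y - x) < e -> ~ A y.
Proof.
move=> /closed_openC oA Ax; apply/nbhs_enormP.
exact: (open_nbhs_nbhs (conj oA Ax)).
Qed.

Lemma enorm_closed (A : set V) :
  (forall x, ~ A x -> exists2 e : R, 0 < e & forall y, enorm (y - x) < e -> ~ A y) ->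
  closed A.
Proof.
move=> H x Ax; apply: contrapT => nAx; have [e e0 he] := H _ nAx.
have /Ax[y [Ay hy]] : nbhs x [set y | enorm (y - x) < e] by apply/nbhs_enormP; exists e.
exact: he hy Ay.
Qed.

Lemma closureP (A : set V) x :
  closure A x <-> forall e : R, 0 < e -> exists2 y, A y & enorm (y - x) < e.
Proof.
split=> [h e e0|h U /nbhs_enormP[e e0 he]].
  have /h[y [Ay hy]] : nbhs x [set y | enorm (y - x) < e] by apply/nbhs_enormP; exists e.
  by exists y.
by have [y Ay hy] := h _ e0; exists y; split=> //; exact: he.
Qed.

Lemma EVT_enorm (K : set V) (f : V -> R) (M : R) :
  closed K -> K !=set0 -> (forall x, K x -> enorm x <= M) ->
  (forall x e, K x -> 0 < e -> exists2 d : R, 0 < d &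
     forall y, K y -> enorm (y - x) < d -> `|f y - f x| < e) ->
  exists2 c, K c & forall y, K y -> f c <= f y.
Proof.
move=> cK K0 bK cf.
have cptK : compact K.
  apply: bounded_closed_compact cK.
  exists M; split; first exact: num_real.
  move=> M' MM' x Kx; apply: le_trans (mxnorm_le_enorm _) _.
  exact: le_trans (bK _ Kx) (ltW MM').
have contf : {within K, continuous f}.
  apply/subspace_continuousP => x Kx; apply/cvgrPdist_lt => e e0.
  have [d d0 hd] := cf _ _ Kx e0.
  rewrite /prop_near1; apply/nbhs_enormP; exists d => // y hy Ky.
  by rewrite distrC hd.
have [c /set_mem Kc H] := compact_EVT_min K0 cptK contf.
by exists c => // y Ky; apply: H; rewrite inE.
Qed.

Lemma addrAKl u v : u + v - u = v.
Proof. by rewrite addrC addKr. Qed.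

End Euclid.

(** * Differentiability from continuous partial derivatives *)

Section Partials.
Context {R : realType} {n : nat}.
Notation V := 'rV[R]_(n.+1).
Implicit Types (f : V -> R) (u v w x y : V).

Definition grad f x : V := \row_i 'D_(ebasis i) f x.

Lemma is_derive_line f x v (s : R) : derivable f (x + s *: v) v ->
  is_derive s 1 (fun r : R => f (x + r *: v)) ('D_v f (x + s *: v)).
Proof.
move=> df.
have E : (fun h : R => h^-1 *: ((fun r : R => f (x + r *: v)) (h *: 1 + s) - f (x + s *: v)))
       = (fun h : R => h^-1 *: (f (h *: v + (x + s *: v)) - f (x + s *: v))).
  apply/funext => h; congr (_ *: (f _ - _)).
  by rewrite [h *: 1]mulr1 scalerDl addrCA.
by apply: DeriveDef; rewrite ?/derivable ?/derive /= E.
Qed.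

Lemma mvt_line f x v (t : R) : (forall s : R, `|s| <= `|t| -> derivable f (x + s *: v) v) ->
  exists2 s : R, `|s| <= `|t| & f (x + t *: v) - f x = t * 'D_v f (x + s *: v).
Proof.
move=> df.
have cont (a b : R) : `|a| <= `|t| -> `|b| <= `|t| ->
    {within `[a, b], continuous (fun r : R => f (x + r *: v))}.
  move=> ha hb; apply: derivable_within_continuous => r; rewrite in_itv /= => /andP[h1 h2].
  have /df/is_derive_line[//] : `|r| <= `|t|.
  by move: ha hb; rewrite !ler_norml => /andP[? ?] /andP[? ?]; apply/andP; split; lra.
have [t0|t0] := leP 0 t.
  have [||s] := @MVT_segment R (fun r => f (x + r *: v)) (fun s => 'D_v f (x + s *: v)) 0 t t0.
  - move=> s; rewrite in_itv /= => /andP[s0 st]; apply: is_derive_line; apply: df.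
    by rewrite !ger0_norm // ltW.
  - by apply: cont; rewrite ?normr0.
  rewrite in_itv /= => /andP[s0 st] e; exists s; first by rewrite !ger0_norm.
  by move: e; rewrite scale0r addr0 subr0 mulrC.
have [||s] := @MVT_segment R (fun r => f (x + r *: v)) (fun s => 'D_v f (x + s *: v)) t 0 (ltW t0).
- move=> s; rewrite in_itv /= => /andP[s0 st]; apply: is_derive_line; apply: df.
  by rewrite !ltr0_norm // lerN2 ltW.
- by apply: cont; rewrite ?normr0.
rewrite in_itv /= => /andP[s0 st] e; exists s.
  by rewrite (ltr0_norm t0) ler0_norm // lerN2.
by move: e; rewrite scale0r addr0 => e; rewrite -opprB e; ring.
Qed.

Definition trunc (v : V) (k : nat) : V := \row_i (if (i < k)%N then v 0 i else 0).

(** Coordinatewise domination by [v]: it traps every mean-value point of the coordinate path in the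
    ball of radius [enorm v]. *)
Lemma trunc_step_norm v (k : nat) (hk : (k < n.+1)%N) (s : R) :
  `|s| <= `|v 0 (Ordinal hk)| ->
  enorm (trunc v k + s *: ebasis (Ordinal hk)) <= enorm v.
Proof.
move=> hs.
rewrite -(@ler_pXn2r _ 2) ?nnegrE ?enorm_ge0 // !enorm_sqr.
apply: ler_sum => i _; rewrite !mxE /= -!expr2 -(real_normK (num_real (v 0 i))).
rewrite -(real_normK (num_real (_ + _))) ler_pXn2r ?nnegrE ?normr_ge0 //.
have [->|ne] := eqVneq i (Ordinal hk); first by rewrite ltnn add0r mulr1.
by rewrite mulr0 addr0; case: ifP => _ //; rewrite normr0.
Qed.

Lemma truncS v (k : nat) (hk : (k < n.+1)%N) :
  trunc v k.+1 = trunc v k + v 0 (Ordinal hk) *: ebasis (Ordinal hk).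
Proof.
apply/rowP => i; rewrite !mxE /= ltnS leq_eqVlt.
have [->|ne] := eqVneq i (Ordinal hk); first by rewrite eqxx /= ltnn add0r mulr1.
rewrite mulr0 addr0; case: eqP => //= e.
by move: ne; rewrite -val_eqE /= e eqxx.
Qed.

(* Moving from x to x + v one coordinate at a time. *)
Lemma mvt_coord f x v :
  (forall y j, enorm (y - x) <= enorm v -> derivable f y (ebasis j)) ->
  exists2 xi : 'I_n.+1 -> V, (forall j, enorm (xi j - x) <= enorm v) &
    f (x + v) - f x = \sum_j v 0 j * 'D_(ebasis j) f (xi j).
Proof.
move=> df.
have /choice[xi hxi] : forall j : 'I_n.+1, exists xi, enorm (xi - x) <= enorm v /\
    f (x + trunc v j.+1) - f (x + trunc v j) = v 0 j * 'D_(ebasis j) f xi.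
  move=> [k hk] /=.
  have [|s hs e] := @mvt_line f (x + trunc v k) (ebasis (Ordinal hk)) (v 0 (Ordinal hk)).
    move=> s hs; apply: df; rewrite addrC !addrA addNr add0r.
    exact: trunc_step_norm.
  exists (x + trunc v k + s *: ebasis (Ordinal hk)); split.
    by rewrite addrC !addrA addNr add0r trunc_step_norm.
  by rewrite truncS addrA.
exists xi => [j|]; first by have [] := hxi j.
have -> : \sum_j v 0 j * 'D_(ebasis j) f (xi j) =
    \sum_(0 <= k < n.+1) (f (x + trunc v k.+1) - f (x + trunc v k)).
  by rewrite big_mkord; apply: eq_bigr => j _; have [_ ->] := hxi j.
rewrite telescope_sumr //.
have -> : trunc v n.+1 = v by apply/rowP => i; rewrite !mxE ltn_ord.
have -> : trunc v 0 = 0 by apply/rowP => i; rewrite !mxE.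
by rewrite addr0.
Qed.

Lemma frechet_of_partials f x (r : R) : 0 < r ->
  (forall y j, enorm (y - x) < r -> derivable f y (ebasis j)) ->
  (forall (e : R) j, 0 < e -> exists2 d : R, 0 < d &
     forall y, enorm (y - x) < d -> `|'D_(ebasis j) f y - 'D_(ebasis j) f x| <= e) ->
  forall e : R, 0 < e -> exists2 d : R, 0 < d & forall y, enorm (y - x) < d ->
     `|f y - f x - dot (grad f x) (y - x)| <= e * enorm (y - x).
Proof.
move=> r0 df cf e e0.
have /choice[d hd] : forall j : 'I_n.+1, exists d : R, 0 < d /\
    forall y, enorm (y - x) < d -> `|'D_(ebasis j) f y - 'D_(ebasis j) f x| <= e / n.+1%:R.
  by move=> j; have [|d d0 hd] := cf (e / n.+1%:R) j; [rewrite divr_gt0|exists d].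
pose d0 := \big[Num.min/r]_j d j.
exists d0; first by apply/bigmin_gtP; split=> // j _; have [] := hd j.
move=> y hy.
have hyr : enorm (y - x) < r by apply: lt_le_trans hy _; exact: bigmin_le_id.
have [|xi hxi E] := @mvt_coord f x (y - x).
  by move=> z j hz; apply: df; apply: le_lt_trans hz hyr.
rewrite subrKC in E; rewrite E /dot -sumrB.
apply: le_trans (ler_norm_sum _ _ _) _.
apply: (@le_trans _ _ (\sum_(j < n.+1) e / n.+1%:R * enorm (y - x))).
  apply: ler_sum => j _; rewrite [grad f x 0 j]mxE (mulrC ('D__ f x)) -mulrBr normrM mulrC.
  apply: ler_pM; rewrite ?normr_ge0 ?coord_le_enorm //.
  have [_] := hd j; apply; apply: le_lt_trans (hxi j) _; apply: lt_le_trans hy _.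
  exact: bigmin_le_cond.
rewrite sumr_const card_ord -[leLHS]mulr_natl mulrA mulrCA mulfV ?mulr1 //.
Qed.

End Partials.

(** * A norm, its dual and its Wulff shape *)

Section NormDuality.
Context {R : realType} {n : nat}.
Notation V := 'rV[R]_(n.+1).
Implicit Types (u v w x y z p : V).

(** Stated for an arbitrary norm so that the lemmas on distance functions serve both the Euclidean
    norm and [phistar phi]. *)
Definition norm_between (N : V -> R) (c C : R) : Prop :=
  [/\ 0 < c, 0 < C, forall x, c * enorm x <= N x, forall x, N x <= C * enorm x &
    is_norm N].

Section AnyNorm.
Context (N : V -> R) (hN : is_norm N).

Lemma norm_ge0 x : 0 <= N x.
Proof. by have [h _] := hN; apply: h. Qed.

Lemma norm_eq0 x : N x = 0 -> x = 0.
Proof. by have [_ [h _]] := hN; apply: h. Qed.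

Lemma normZ (t : R) x : N (t *: x) = `|t| * N x.
Proof. by have [_ [_ [h _]]] := hN; apply: h. Qed.

Lemma normD x y : N (x + y) <= N x + N y.
Proof. by have [_ [_ [_ h]]] := hN; apply: h. Qed.

Lemma norm0 : N 0 = 0.
Proof. by rewrite -(scale0r 0) normZ normr0 mul0r. Qed.

Lemma norm_opp x : N (- x) = N x.
Proof. by rewrite -scaleN1r normZ normrN1 mul1r. Qed.

Lemma norm_subC x y : N (x - y) = N (y - x).
Proof. by rewrite -norm_opp opprB. Qed.

Lemma norm_rdist x y : N x - N y <= N (x - y).
Proof. by rewrite lerBlDr -{1}(subrK y x) normD. Qed.

Lemma norm_rdist_abs x y : `|N x - N y| <= N (x - y).
Proof.
by rewrite ler_norml norm_rdist andbT lerNl opprB norm_subC norm_rdist.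
Qed.

Lemma norm_gt0 x : x != 0 -> 0 < N x.
Proof.
move=> x0; rewrite lt_neqAle norm_ge0 andbT eq_sym.
by apply: contra x0 => /eqP /norm_eq0 ->.
Qed.

Lemma norm_neq0 x : 0 < N x -> x != 0.
Proof. by apply: contraTneq => ->; rewrite norm0 ltxx. Qed.

End AnyNorm.

Lemma enorm_is_norm : is_norm (@enorm R n).
Proof.
by split; [exact: enorm_ge0|split; [exact: enorm_eq0|split; [exact: enormZ|exact: enormD]]].
Qed.

Lemma enorm_between : norm_between (@enorm R n) 1 1.
Proof. by split=> // [x|x|]; rewrite ?mul1r //; exact: enorm_is_norm. Qed.

Lemma norm_between_dist N c C x y : norm_between N c C ->
  `|N x - N y| <= C * enorm (x - y).
Proof. by case=> _ _ _ h hN; apply: le_trans (h _); exact: norm_rdist_abs. Qed.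

Context (phi : V -> R) (hphi : admissible_norm phi).
Notation g := (phistar phi).

Lemma phi_norm : is_norm phi. Proof. by have [] := hphi. Qed.

(** Convexity of [phi - gam |.|] at two midpoints: that of [v] and [- v] for the first bound, that
    of [2 u] and [2 v] for the second, where homogeneity absorbs the factor 2. *)
Lemma unif_convex_add : exists2 gam : R, 0 < gam &
  (forall v, gam * enorm v <= phi v) /\
  (forall u v, phi (u + v) <= phi u + phi v - gam * (enorm u + enorm v - enorm (u + v))).
Proof.
have [_ [_ [gam [gam0 conv]]]] := hphi; exists gam => //; split=> [v|u v].
  have /(_ v (- v) 2^-1) := conv.
  rewrite enormN (norm_opp phi_norm) => /(_ _).
  have -> : 2^-1 *: v + (1 - 2^-1) *: - v = 0.
    by apply/rowP => i; rewrite !mxE; field.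
  by rewrite (norm0 phi_norm) enorm0 => /(_ ltac:(lra)); lra.
have /(_ (2 *: u) (2 *: v) 2^-1) := conv.
have -> : 2^-1 *: (2 *: u) + (1 - 2^-1) *: (2 *: v) = u + v.
  by apply/rowP => i; rewrite !mxE; field.
rewrite !(normZ phi_norm) !enormZ ger0_norm // => /(_ ltac:(lra)); lra.
Qed.

Lemma phi_between : exists c C, norm_between phi c C.
Proof.
have [gam gam0 [h _]] := unif_convex_add.
pose C := \sum_i phi (ebasis i) + 1.
exists gam, C; split=> //; last exact: phi_norm.
  by rewrite /C ltr_wpDl // sumr_ge0 // => i _; exact: (norm_ge0 phi_norm).
move=> x; rewrite {1}(row_sum_delta x).
apply: (@le_trans _ _ (\sum_i phi (x 0 i *: ebasis i))).
  elim/big_ind2: _ => [|a b c d h1 h2|i _] //; first by rewrite (norm0 phi_norm).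
  by apply: le_trans (normD phi_norm _ _) _; apply: lerD.
rewrite mulrDl mulr_suml mul1r; apply: ler_wpDr; first exact: enorm_ge0.
apply: ler_sum => i _; rewrite (normZ phi_norm) mulrC.
by rewrite ler_wpM2l ?(norm_ge0 phi_norm) // coord_le_enorm.
Qed.

Lemma phi_unit_exists : exists p, phi p = 1.
Proof.
pose e : V := ebasis ord0.
have e0 : e != 0.
  by apply/eqP => /rowP /(_ ord0) /eqP; rewrite !mxE !eqxx oner_eq0.
exists ((phi e)^-1 *: e); rewrite (normZ phi_norm) gtr0_norm.
  by rewrite mulVf // gt_eqF // (norm_gt0 phi_norm).
by rewrite invr_gt0 (norm_gt0 phi_norm).
Qed.

Lemma phistar_ub u v : phi v = 1 -> dot v u <= g u.
Proof.
move=> v1; apply: ub_le_sup; last by exists v.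
have [c [C [c0 C0 h1 _ _]]] := phi_between.
exists (c^-1 * enorm u) => _ [w /= w1 <-].
apply: le_trans (dot_le _ _) _; apply: ler_wpM2r; first exact: enorm_ge0.
by rewrite -[c^-1]mulr1 mulrC -ler_pdivrMr ?invr_gt0 // invrK mulrC -w1 h1.
Qed.

Lemma dual_le u v : dot v u <= phi v * g u.
Proof.
have [->|v0] := eqVneq v 0; first by rewrite dot0l (norm0 phi_norm) mul0r.
have pv : 0 < phi v by rewrite (norm_gt0 phi_norm).
have := @phistar_ub u ((phi v)^-1 *: v).
rewrite (normZ phi_norm) gtr0_norm ?invr_gt0 // mulVf ?gt_eqF // => /(_ erefl).
by rewrite dotZl mulrC ler_pdivrMr // mulrC.
Qed.

Lemma phistar_le u (c : R) : (forall v, phi v = 1 -> dot v u <= c) -> g u <= c.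
Proof.
move=> h; apply: ge_sup; last by move=> _ [v /= v1 <-]; exact: h.
by have [p p1] := phi_unit_exists; exists (dot p u), p.
Qed.

Lemma phistar_ge0 u : 0 <= g u.
Proof.
have [p p1] := phi_unit_exists.
have := phistar_ub u p1; have := @phistar_ub u (- p).
by rewrite (norm_opp phi_norm) dotNl => /(_ p1); lra.
Qed.

Lemma phistar_between : exists c C, norm_between g c C.
Proof.
have [c [C [c0 C0 h1 h2 _]]] := phi_between.
have lb x : C^-1 * enorm x <= g x.
  have [->|x0] := eqVneq x 0; first by rewrite enorm0 mulr0 phistar_ge0.
  have e0 := enorm_gt0 x0.
  rewrite mulrC ler_pdivrMr // -(ler_pM2r e0) -expr2 enorm_sqr.
  apply: le_trans (dual_le _ _) _; rewrite -mulrA mulrC.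
  by rewrite ler_wpM2l ?phistar_ge0.
have ub x : g x <= c^-1 * enorm x.
  apply: phistar_le => v v1; apply: le_trans (dot_le _ _) _.
  apply: ler_wpM2r; first exact: enorm_ge0.
  by rewrite -[c^-1]mulr1 mulrC -ler_pdivrMr ?invr_gt0 // invrK mulrC -v1 h1.
exists C^-1, c^-1; split; rewrite ?invr_gt0 //.
have leZ t x : g (t *: x) <= `|t| * g x.
  apply: phistar_le => v v1; rewrite dotZr.
  apply: le_trans (ler_norm _) _; rewrite normrM ler_wpM2l // ler_norml.
  rewrite phistar_ub // andbT lerNl -dotNl.
  by apply: phistar_ub; rewrite (norm_opp phi_norm).
split; first exact: phistar_ge0.
split.
  move=> u gu; apply: enorm_eq0; apply/eqP; rewrite eq_le enorm_ge0 andbT.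
  by have := lb u; rewrite gu pmulr_rle0 ?invr_gt0.
split=> [t u|u v].
  apply/eqP; rewrite eq_le leZ /=.
  have [->|t0] := eqVneq t 0; first by rewrite normr0 mul0r phistar_ge0.
  have := leZ t^-1 (t *: u); rewrite scalerA mulVf // scale1r normrV ?unitfE //.
  by rewrite mulrC ler_pdivlMr ?normr_gt0 // mulrC.
by apply: phistar_le => w w1; rewrite dotDr lerD // phistar_ub.
Qed.

Lemma phistar_norm : is_norm g.
Proof. by have [c [C []]] := phistar_between. Qed.

Lemma phistar_attained u : exists2 p, phi p = 1 & dot p u = g u.
Proof.
have [c [C hb]] := phi_between; have [c0 C0 h1 h2 _] := hb.
have [|||x e hx e0|p /= p1 hp] := @EVT_enorm R n [set p | phi p = 1] (fun p => - dot p u) c^-1.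
- apply: enorm_closed => x /= hx.
  have d0 : 0 < `|phi x - 1| by rewrite normr_gt0 subr_eq0; apply/eqP.
  exists (`|phi x - 1| / C); first by rewrite divr_gt0.
  move=> y hy hy1; have := norm_between_dist y x hb.
  by rewrite hy1 distrC; move: hy; rewrite ltr_pdivlMr // mulrC; lra.
- by have [p p1] := phi_unit_exists; exists p.
- by move=> x /= x1; rewrite -[c^-1]mulr1 mulrC -ler_pdivrMr ?invr_gt0 // invrK mulrC -x1 h1.
- exists (e / (enorm u + 1)); first by rewrite divr_gt0 // ltr_wpDl ?enorm_ge0.
  move=> y _; rewrite ltr_pdivlMr ?ltr_wpDl ?enorm_ge0 // => hy.
  rewrite enormBC in hy; rewrite opprK addrC -dotBl.
  apply: le_lt_trans (cauchy_schwarz _ _) _; apply: le_lt_trans hy.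
  by rewrite mulrDr mulr1 lerDl enorm_ge0.
exists p => //; apply/eqP; rewrite eq_le phistar_ub //=.
by apply: phistar_le => v v1; have := hp v v1; rewrite lerN2.
Qed.

Lemma bdWphiP w : bdWphi phi w <-> g w = 1.
Proof.
have [c [C hb]] := phistar_between; have [c0 C0 h1 h2 hn] := hb.
split.
  move=> [/closureP clw niw]; apply/eqP; rewrite eq_le; apply/andP; split.
    rewrite leNgt; apply/negP => gw.
    have [|y /= yW hy] := clw ((g w - 1) / C); first by rewrite divr_gt0 // subr_gt0.
    have := norm_between_dist y w hb; move: hy; rewrite ltr_pdivlMr // mulrC => hy.
    rewrite distrC ler_norml => /andP[_]; move: yW; rewrite /Wphi /=; lra.
  rewrite leNgt; apply/negP => gw; apply: niw; apply/nbhs_enormP.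
  exists ((1 - g w) / C); first by rewrite divr_gt0 // subr_gt0.
  move=> y; rewrite ltr_pdivlMr // mulrC => hy; rewrite /Wphi /=.
  by have := norm_between_dist y w hb; rewrite ler_norml => /andP[_]; lra.
move=> gw; split; first by apply: subset_closure; rewrite /Wphi /= gw.
move=> /nbhs_enormP[e e0 he].
have w0 : w != 0 by apply: (norm_neq0 hn); rewrite gw.
have ew := enorm_gt0 w0.
pose t := e / (2 * enorm w); have t0 : 0 < t by rewrite divr_gt0 // mulr_gt0.
have := he ((1 + t) *: w).
have -> : (1 + t) *: w - w = t *: w by apply/rowP => i; rewrite !mxE; ring.
rewrite enormZ gtr0_norm // /Wphi /= (normZ hn) gw mulr1 gtr0_norm; last by lra.
have -> : t * enorm w = e / 2 by rewrite /t; field; rewrite gt_eqF.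
by move=> /(_ ltac:(lra)); lra.
Qed.

(** Geometrically [p] is the conormal to the Wulff shape at its boundary point [w], normalized by
    [phi] rather than by the Euclidean norm. With this normalization [w] is the gradient of [phi] at
    [p], and [p] that of [phistar phi] at [w]. *)
Definition dualpair p w : Prop := [/\ phi p = 1, g w = 1 & dot p w = 1].

Lemma dualpair_le p w v : dualpair p w -> dot v w <= phi v.
Proof. by case=> _ gw _; have := dual_le w v; rewrite gw mulr1. Qed.

Lemma dualpair_lestar p w z : dualpair p w -> dot p z <= g z.
Proof. by case=> pp _ _; have := dual_le z p; rewrite pp mul1r. Qed.

Lemma dualpair_exists w : g w = 1 -> exists p, dualpair p w.
Proof. by move=> gw; have [p p1 pw] := phistar_attained w; exists p; split; rewrite ?pw. Qed.

Lemma dualpairN p w : dualpair p w -> dualpair (- p) (- w).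
Proof.
by case=> *; split; rewrite ?(norm_opp phi_norm) ?(norm_opp phistar_norm) // dotNl dotNr opprK.
Qed.

Lemma dualpair_neq0 p w : dualpair p w -> p != 0 /\ w != 0.
Proof.
case=> pp ww _; split; first by apply: (norm_neq0 phi_norm); rewrite pp.
by apply: (norm_neq0 phistar_norm); rewrite ww.
Qed.

(* The gain over duality is the uniform convexity of phi. *)
Lemma dualpair_strong : exists2 gam : R, 0 < gam & forall p w v, dualpair p w ->
  dot v w + gam * (enorm v - dot v p / enorm p) <= phi v.
Proof.
have [gam gam0 [h1 h2]] := unif_convex_add; exists gam => // p w v pw.
have [pp gw dpw] := pw.
have p0 : 0 < enorm p by apply: enorm_gt0; have [] := dualpair_neq0 pw.
rewrite -subr_ge0.
set X := _ - _.
(* Duality at [p + t v] against the strengthened triangle inequality for [p] and [t v]: after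
   division by [t] the gain of first order remains, and the loss is of order [t]. *)
have key (t : R) : 0 < t -> - (gam * t * enorm v ^+ 2 / (2 * enorm p)) <= X.
  move=> t0; have := h2 p (t *: v); have := dualpair_le (p + t *: v) pw.
  rewrite dotDl dotZl dpw (normZ phi_norm) enormZ gtr0_norm // pp => a1 a2.
  (* Taylor bound for the Euclidean norm: the square of the right side minus that of the left is
     again a square. *)
  have a3 : enorm (p + t *: v) <= enorm p + t * (dot v p / enorm p)
      + t ^+ 2 * enorm v ^+ 2 / (2 * enorm p).
    have e0 : 0 <= enorm p + t * (dot v p / enorm p) + t ^+ 2 * enorm v ^+ 2 / (2 * enorm p).
      rewrite -(pmulr_rge0 _ p0).
      have -> : enorm p * (enorm p + t * (dot v p / enorm p) + t ^+ 2 * enorm v ^+ 2 / (2 * enorm p))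
         = (enorm p ^+ 2 + enorm (p + t *: v) ^+ 2) / 2.
        rewrite (enorm_sqr (p + _)) !(dotDl, dotDr, dotZl, dotZr) (dotC p v) -!enorm_sqr.
        by field; rewrite gt_eqF.
      by rewrite divr_ge0 // addr_ge0 // sqr_ge0.
    rewrite -(@ler_pXn2r _ 2) ?nnegrE ?enorm_ge0 // -subr_ge0.
    have -> : (enorm p + t * (dot v p / enorm p) + t ^+ 2 * enorm v ^+ 2 / (2 * enorm p)) ^+ 2
        - enorm (p + t *: v) ^+ 2
      = (t * (dot v p / enorm p) + t ^+ 2 * enorm v ^+ 2 / (2 * enorm p)) ^+ 2.
      rewrite (enorm_sqr (p + _)) !(dotDl, dotDr, dotZl, dotZr) (dotC p v) -!enorm_sqr.
      by field; rewrite gt_eqF.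
    exact: sqr_ge0.
  rewrite -(ler_pM2l t0) /X.
  have a4 : gam * enorm (p + t *: v) <= gam * (enorm p + t * (dot v p / enorm p)
      + t ^+ 2 * enorm v ^+ 2 / (2 * enorm p)) by rewrite ler_wpM2l // ltW.
  have -> : t * - (gam * t * enorm v ^+ 2 / (2 * enorm p)) =
     - (gam * (t ^+ 2 * enorm v ^+ 2 / (2 * enorm p))) by field; rewrite gt_eqF.
  by nra.
rewrite leNgt; apply/negP => X0.
pose B := gam * enorm v ^+ 2 / (2 * enorm p).
have B0 : 0 <= B.
  apply: divr_ge0; first by apply: mulr_ge0; [exact: ltW|exact: sqr_ge0].
  by apply: mulr_ge0 => //; exact: ltW.
have B1 : 0 < B + 1 by apply: ltr_wpDl.
(* Were [X] negative, this [t] would make the loss [t B] at most half of [- X]. *)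
pose t := - X / (2 * (B + 1)).
have t0 : 0 < t by rewrite divr_gt0 ?oppr_gt0 // mulr_gt0.
have := key _ t0.
have -> : gam * t * enorm v ^+ 2 / (2 * enorm p) = t * B.
  by rewrite /B; field; rewrite gt_eqF.
have -> : t * B = - X / 2 * (B / (B + 1)).
  by rewrite /t; field; rewrite gt_eqF.
have h3 : B / (B + 1) <= 1 by rewrite ler_pdivrMr // mul1r lerDl.
have h4 : 0 <= B / (B + 1) by apply: divr_ge0 => //; exact: ltW.
clear t0 t key; move: (B / (B + 1)) (X) h3 h4 X0 => q X' h3 h4 X0 h5.
by nra.
Qed.

End NormDuality.

(** * The gradient of the norm *)

Section Gradient.
Context {R : realType} {n : nat}.
Notation V := 'rV[R]_(n.+1).
Implicit Types (u v w x y z p : V).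
Context (phi : V -> R) (hphi : admissible_norm phi).
Notation g := (phistar phi).
Notation G := (grad phi).
Let pN : is_norm phi := phi_norm hphi.

Lemma enorm_ball_neq0 x y : enorm (y - x) < enorm x -> y != 0.
Proof. by apply: contraTneq => ->; rewrite sub0r enormN ltxx. Qed.

Lemma within_neq0 (h : V -> R) x : {within [set u : V | u != 0], continuous h} -> x != 0 ->
  forall e : R, 0 < e -> exists2 d : R, 0 < d &
    forall y, enorm (y - x) < d -> `|h y - h x| <= e.
Proof.
move=> /subspace_continuousP ch x0 e e0.
have /cvgrPdist_le /(_ e e0) := ch x x0.
move=> /nbhs_enormP[d d0 hd].
exists (Num.min d (enorm x)); first by rewrite lt_min d0 enorm_gt0.
move=> y; rewrite lt_min => /andP[h1 h2]; rewrite distrC; apply: hd => //=.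
exact: enorm_ball_neq0 h2.
Qed.

Lemma phi_C2 : C2_on [set u | u != 0] phi. Proof. by have [_ []] := hphi. Qed.

Lemma grad_frechet x : x != 0 ->
  forall e : R, 0 < e -> exists2 d : R, 0 < d & forall y, enorm (y - x) < d ->
     `|phi y - phi x - dot (G x) (y - x)| <= e * enorm (y - x).
Proof.
have [_ C] := phi_C2 => x0.
apply: (@frechet_of_partials R n phi x (enorm x)); first exact: enorm_gt0.
  by move=> y j hy; have [h _] := C j j; apply: h; exact: enorm_ball_neq0 hy.
by move=> e j e0; have [_ [h _]] := C j j; exact: within_neq0.
Qed.

Lemma grad_dir p v e : p != 0 -> 0 < e -> exists2 t : R, 0 < t &
  `|phi (p + t *: v) - phi p - t * dot (G p) v| <= t * e.
Proof.
move=> p0 e0.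
have k0 : 0 < enorm v + 1 by rewrite ltr_wpDl // enorm_ge0.
have [|d d0 hd] := @grad_frechet p p0 (e / (enorm v + 1)); first by rewrite divr_gt0.
exists (d / (2 * (enorm v + 1))); first by rewrite divr_gt0 // mulr_gt0.
set t := d / _.
have t0 : 0 < t by rewrite divr_gt0 // mulr_gt0.
have := hd (p + t *: v); rewrite addrC addKr enormZ dotZr gtr0_norm // => H.
apply: le_trans (H _) _.
  rewrite /t mulrAC ltr_pdivrMr ?mulr_gt0 // ltr_pM2l //.
  by have := enorm_ge0 v; lra.
rewrite mulrCA ler_pM2l // mulrAC ler_pdivrMr // ler_pM2l //; lra.
Qed.

Lemma grad_le p v : p != 0 -> dot v (G p) <= phi v.
Proof.
move=> p0; rewrite dotC leNgt; apply/negP => lt.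
have [|t t0] := @grad_dir p v ((dot (G p) v - phi v) / 2) p0.
  by rewrite divr_gt0 // subr_gt0.
rewrite ler_norml => /andP[h _].
have := normD pN p (t *: v); rewrite (normZ pN) gtr0_norm // => h2.
have : t * (dot (G p) v - phi v) <= t * ((dot (G p) v - phi v) / 2) by lra.
by rewrite ler_pM2l //; lra.
Qed.

Lemma grad_eq p : p != 0 -> dot p (G p) = phi p.
Proof.
move=> p0; apply/eqP; rewrite eq_le grad_le //=.
have := @grad_le p (- p) p0; rewrite dotNl (norm_opp pN) => h.
rewrite leNgt; apply/negP => lt.
have [|t t0] := @grad_dir p p ((phi p - dot p (G p)) / 2) p0.
  by rewrite divr_gt0 // subr_gt0.
rewrite ler_norml (dotC (G p)) => /andP[_].
have -> : p + t *: p = (1 + t) *: p by rewrite scalerDl scale1r.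
rewrite (normZ pN) gtr0_norm ?addr_gt0 // => h2.
have : t * (phi p - dot p (G p)) <= t * ((phi p - dot p (G p)) / 2) by lra.
by rewrite ler_pM2l //; lra.
Qed.

(** A linear functional below [phi] that touches it at [p] has directional slopes at most those of
    the gradient; the direction [w - G p] then forces equality. *)
Lemma grad_uniq p w : p != 0 -> (forall v, dot v w <= phi v) -> dot p w = phi p ->
  w = G p.
Proof.
move=> p0 hw pw.
have key v : dot v w <= dot v (G p).
  rewrite leNgt; apply/negP => lt.
  have [|t t0] := @grad_dir p v ((dot v w - dot v (G p)) / 2) p0.
    by rewrite divr_gt0 // subr_gt0.
  rewrite ler_norml (dotC (G p)) => /andP[_ h].
  have := hw (p + t *: v); rewrite dotDl dotZl pw => h2.
  have : t * (dot v w - dot v (G p)) <= t * ((dot v w - dot v (G p)) / 2) by lra.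
  by rewrite ler_pM2l //; lra.
apply/eqP; rewrite -subr_eq0; apply/eqP; apply: dot_eq0.
apply/eqP; rewrite eq_le dot_ge0 andbT.
by have := key (w - G p); rewrite -subr_le0 -dotBr.
Qed.

Lemma dualpair_grad p w : dualpair phi p w -> w = G p.
Proof.
move=> pw; have [p0 _] := dualpair_neq0 hphi pw; apply: grad_uniq => // [v|].
  exact: (dualpair_le hphi v pw).
by case: pw => -> _ ->.
Qed.

Lemma grad_dualpair p : phi p = 1 -> dualpair phi p (G p).
Proof.
move=> p1; have p0 : p != 0 by apply: (norm_neq0 pN); rewrite p1.
have e := grad_eq p0; rewrite p1 in e.
split=> //; apply/eqP; rewrite eq_le; apply/andP; split.
  by apply: (phistar_le hphi) => v v1; rewrite -v1; exact: grad_le.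
by have := dual_le hphi (G p) p; rewrite p1 mul1r e.
Qed.

Lemma dualpair_sym_uniq p w w' : dualpair phi p w -> dualpair phi p w' -> w = w'.
Proof. by move=> /dualpair_grad -> /dualpair_grad ->. Qed.

(* Continuity of the second derivatives on a compact annulus around {phi = 1}. *)
Lemma grad_lipschitz : exists K d : R, [/\ 0 < K, 0 < d & forall p v, phi p = 1 ->
  enorm v <= d -> enorm (G (p + v) - G p) <= K * enorm v].
Proof.
have [c [C [c0 C0 h1 h2 _]]] := phi_between hphi.
(* On [phi p = 1] the Euclidean norm is at least [1 / C]; balls of half this radius stay away from
   the origin, where [phi] is not smooth. *)
pose r := (2 * C)^-1; have r0 : 0 < r by rewrite invr_gt0 mulr_gt0.
pose Ann := [set y : V | r <= enorm y <= c^-1 + r].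
have annc : closed Ann.
  apply: enorm_closed => x /= /negP; rewrite negb_and -!ltNge => /orP[lt|lt].
    exists (r - enorm x); first by rewrite subr_gt0.
    move=> y hy /andP[h _]; have := enorm_rdist y x; lra.
  exists (enorm x - (c^-1 + r)); first by rewrite subr_gt0.
  move=> y hy /andP[_ h]; have := enorm_rdist x y; rewrite enormBC; lra.
have annp p v : phi p = 1 -> enorm v <= r -> forall y, enorm (y - p) <= enorm v -> Ann y.
  move=> p1 hv y hy.
  have b1 : 2 * r <= enorm p.
    have -> : 2 * r = C^-1 by rewrite /r; field; rewrite gt_eqF.
    by rewrite -[leLHS]mul1r ler_pdivrMr // mulrC -p1.
  have b2 : enorm p <= c^-1.
    by rewrite -[c^-1]mulr1 mulrC -ler_pdivrMr ?invr_gt0 // invrK mulrC -p1.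
  have := enorm_rdist p y; have := enorm_rdist y p; rewrite (enormBC p y) /Ann /=.
  move=> *; apply/andP; split; lra.
have annn y : Ann y -> y != 0.
  by move=> /andP[h _]; apply: contraTneq h => ->; rewrite enorm0 -ltNge.
have [p1 pp1] := phi_unit_exists hphi.
have ann0 : Ann !=set0.
  by exists p1; apply: (@annp p1 0); rewrite ?subrr ?enorm0 ?lexx // ltW.
have [_ C2] := phi_C2.
have /choice[M hM] : forall i : 'I_n.+1 * 'I_n.+1, exists M : R, forall y, Ann y ->
   `|'D_(ebasis i.2) (fun y => 'D_(ebasis i.1) phi y) y| <= M.
  move=> [i j] /=; have [_ [_ [_ hc]]] := C2 i j.
  have [|x e Ax e0|y Ay hy] := @EVT_enorm R n Ann
    (fun y => - `|'D_(ebasis j) (fun y => 'D_(ebasis i) phi y) y|) (c^-1 + r) annc ann0.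
  - by move=> x /andP[].
  - have [|d d0 hd] := within_neq0 hc (annn _ Ax) (e := e / 2); first by rewrite divr_gt0.
    exists d => // y _ hy; rewrite opprK addrC.
    apply: le_lt_trans (ler_dist_dist _ _) _; rewrite distrC.
    by apply: le_lt_trans (hd _ hy) _; lra.
  exists `|'D_(ebasis j) (fun y => 'D_(ebasis i) phi y) y| => z Az.
  by have := hy z Az; rewrite lerN2.
pose K := \sum_i \sum_j `|M (i, j)| + 1.
have K0 : 0 < K.
  by rewrite /K ltr_wpDl // sumr_ge0 // => i _; rewrite sumr_ge0.
exists (n.+1%:R * K), r; split=> //; first by rewrite mulr_gt0.
move=> p v pp hv; rewrite -mulrA; apply: enorm_le_coord => [|i].
  by rewrite mulr_ge0 ?enorm_ge0 // ltW.
rewrite !mxE.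
have [y j hy|xi hxi ->] := @mvt_coord R n (fun y => 'D_(ebasis i) phi y) p v.
  by have [_ [_ [h _]]] := C2 i j; apply: h; apply: annn; exact: annp hy.
apply: le_trans (ler_norm_sum _ _ _) _.
rewrite /K mulrDl mul1r; apply: ler_wpDr; first exact: enorm_ge0.
rewrite [X in _ <= X * _](bigD1 i) //= [leRHS]mulrDl; apply: ler_wpDr.
  by rewrite mulr_ge0 ?enorm_ge0 // sumr_ge0 // => k _; rewrite sumr_ge0.
rewrite mulr_suml; apply: ler_sum => j _; rewrite normrM mulrC.
apply: ler_pM; rewrite ?normr_ge0 ?coord_le_enorm //.
apply: le_trans (ler_norm _).
by apply: (hM (i, j)); apply: annp (hxi j).
Qed.

Lemma grad_diff p : p != 0 -> exists Phi : 'M[R]_n.+1,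
  forall e : R, 0 < e -> exists2 d : R, 0 < d & forall y, enorm (y - p) < d ->
    enorm (G y - G p - (y - p) *m Phi) <= e * enorm (y - p).
Proof.
move=> p0; have [_ C] := phi_C2.
pose D i := fun y => 'D_(ebasis i) phi y.
have H i (e : R) : 0 < e -> exists2 d : R, 0 < d & forall y, enorm (y - p) < d ->
     `|D i y - D i p - dot (grad (D i) p) (y - p)| <= e * enorm (y - p).
  apply: (@frechet_of_partials R n (D i) p (enorm p)); first exact: enorm_gt0.
    by move=> y j hy; have [_ [_ [h _]]] := C i j; apply: h; exact: enorm_ball_neq0 hy.
  by move=> e' j e0; have [_ [_ [_ h]]] := C i j; exact: within_neq0.
exists (\matrix_(j, i) grad (D i) p 0 j) => e e0.
have e1 : 0 < e / n.+1%:R by rewrite divr_gt0.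
have /choice[d hd] : forall i : 'I_n.+1, exists d : R, 0 < d /\ forall y, enorm (y - p) < d ->
     `|D i y - D i p - dot (grad (D i) p) (y - p)| <= e / n.+1%:R * enorm (y - p).
  by move=> i; have [d d0 hd] := H i _ e1; exists d.
exists (\big[Num.min/1]_i d i).
  by apply/bigmin_gtP; split=> // j _; have [] := hd j.
move=> y hy.
have -> : e * enorm (y - p) = n.+1%:R * (e / n.+1%:R * enorm (y - p)).
  by rewrite mulrA mulrCA mulfV ?mulr1.
apply: enorm_le_coord => [|i]; first by rewrite mulr_ge0 ?enorm_ge0 // ltW.
have [_ /(_ y)] := hd i; rewrite /dot => H1.
move: H1; rewrite !mxE => H1.
have -> : \sum_j (y - p) 0 j * (\matrix_(j, i) grad (D i) p 0 j) j i =
   \sum_j grad (D i) p 0 j * (y - p) 0 j.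
  by apply: eq_bigr => j _; rewrite [X in _ * X]mxE mulrC.
by apply: H1; apply: lt_le_trans hy _; exact: bigmin_le_cond.
Qed.

End Gradient.

(** * Second-order expansion of semiconcave functions *)

Section SecondOrder.
Context {R : realType} {n : nat}.
Notation V := 'rV[R]_(n.+1).
Implicit Types (u v w x y z k : V).

Lemma le0_eps (a c : R) : (forall e : R, 0 < e -> a <= e * c) -> a <= 0.
Proof.
move=> h; have c0 : 0 < `|c| + 1 by rewrite ltr_wpDl.
rewrite leNgt; apply/negP => a0.
have := h (a / (2 * (`|c| + 1))); rewrite divr_gt0 ?mulr_gt0 // => /(_ isT).
have -> : a / (2 * (`|c| + 1)) * c = a * (c / (2 * (`|c| + 1))) by rewrite mulrAC mulrA.
have : c / (2 * (`|c| + 1)) <= 2^-1.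
  rewrite ler_pdivrMr ?mulr_gt0 // mulrA mulVf ?mul1r //.
  by have := ler_norm c; lra.
by move=> h1 h2; nra.
Qed.

Lemma linear_small (M : 'M[R]_n.+1) (v : V) :
  (forall e : R, 0 < e -> exists2 t : R, 0 < t & enorm ((t *: v) *m M) <= e * enorm (t *: v)) ->
  v *m M = 0.
Proof.
move=> h; apply: enorm_eq0; apply/eqP; rewrite eq_le enorm_ge0 andbT.
apply: (@le0_eps _ (enorm v)) => e /h[t t0].
by rewrite -scalemxAl !enormZ gtr0_norm // mulrCA ler_pM2l.
Qed.

Section Expansion.
(** [P] selects supergradients of [h] near [x0] and is differentiable at the single point [x0]. The
    results are applied to the dual norm with [P] its gradient, and to the distance function with
    [P] the conormal at a chosen foot point. *)
Context (h : V -> R) (P : V -> V) (x0 P0 : V) (S : 'M[R]_n.+1) (C rho : R).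
Hypothesis rho0 : 0 < rho.
Hypothesis semiconcave : forall y y', enorm (y - x0) < rho -> enorm (y' - x0) < rho ->
  h y' - h y <= dot (P y) (y' - y) + C * enorm (y' - y) ^+ 2.
Hypothesis diffP : forall e : R, 0 < e -> exists2 d : R, 0 < d &
  forall y, enorm (y - x0) < d -> enorm (P y - P0 - (y - x0) *m S) <= e * enorm (y - x0).

(* Cutting the segment from x0 + k to x0 + k + v into N pieces makes the quadratic
   error terms negligible, the sum of the linear ones being a Riemann sum. *)
Let upper_expansion (e : R) : 0 < e -> exists2 d : R, 0 < d &
  forall k v, enorm k < d -> enorm v < d ->
   h (x0 + k + v) - h (x0 + k) <= dot P0 v + dot (k *m S) v + dot (v *m S) v / 2
      + e * (enorm k + enorm v) ^+ 2.
Proof.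
move=> e0; have e2 : 0 < e / 2 by rewrite divr_gt0.
have [d d0 hd] := diffP e2; have [Ks Ks0 hKs] := mulmx_bound S.
exists (Num.min d rho / 2); first by rewrite divr_gt0 // lt_min d0.
move=> k v hk hv.
have hkv : enorm k + enorm v < d /\ enorm k + enorm v < rho.
  suff : enorm k + enorm v < Num.min d rho by rewrite lt_min => /andP[].
  by lra.
have [hkv1 hkv2] := hkv.
pose A := dot P0 v + dot (k *m S) v.
pose B := dot (v *m S) v.
have hB : `|B| <= Ks * enorm v ^+ 2.
  apply: le_trans (cauchy_schwarz _ _) _.
  by rewrite expr2 mulrA ler_wpM2r ?enorm_ge0.
(* State after [j] of [N] pieces. The two terms with [1 / N] are the semiconcavity errors and the
   gap between the Riemann sum of [s B] and its integral. *)
have key (N j : nat) : (0 < N)%N -> (j <= N)%N ->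
   h (x0 + k + (j%:R / N%:R) *: v) - h (x0 + k) <=
   j%:R / N%:R * A + (j%:R / N%:R) ^+ 2 / 2 * B +
   j%:R / N%:R * (e / 2 * (enorm k + enorm v) * enorm v + (C + Ks / 2) * enorm v ^+ 2 / N%:R).
  move=> N0; have N0' : 0 < N%:R :> R by rewrite ltr0n.
  elim: j => [_|j IH jN].
    by rewrite mul0r scale0r addr0 subrr !mul0r expr0n /= !mul0r !addr0.
  have {IH} := IH (ltnW jN).
  pose s : R := j%:R / N%:R; pose t : R := N%:R^-1.
  have t0 : 0 < t by rewrite invr_gt0.
  have s0 : 0 <= s by rewrite divr_ge0.
  have s1 : s <= 1 by rewrite ler_pdivrMr // mul1r ler_nat ltnW.
  have st1 : s + t <= 1.
    by rewrite /s /t -[X in _ + X]mul1r -mulrDl ler_pdivrMr // mul1r natr1 ler_nat.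
  have -> : j.+1%:R / N%:R = s + t :> R by rewrite /s /t -natr1 mulrDl mul1r.
  rewrite -/s -/t.
  have -> : forall X, X / N%:R = X * t by [].
  have nb (r : R) : 0 <= r -> r <= 1 -> enorm (k + r *: v) <= enorm k + enorm v.
    move=> r0 r1; apply: le_trans (enormD _ _) _; rewrite lerD2l enormZ ger0_norm //.
    by rewrite -[leRHS]mul1r ler_wpM2r ?enorm_ge0.
  have sub_x0 (r : R) : x0 + k + r *: v - x0 = k + r *: v.
    by rewrite addrC !addrA addNr add0r.
  have nbx (r : R) : 0 <= r -> r <= 1 -> enorm (x0 + k + r *: v - x0) <= enorm k + enorm v.
    by move=> r0 r1; rewrite sub_x0 nb.
  have := semiconcave (le_lt_trans (nbx s s0 s1) hkv2)
     (le_lt_trans (nbx (s + t) (addr_ge0 s0 (ltW t0)) st1) hkv2).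
  have -> : x0 + k + (s + t) *: v - (x0 + k + s *: v) = t *: v.
    by apply/rowP => i; rewrite !mxE; ring.
  rewrite dotZr enormZ gtr0_norm //.
  have := hd _ (le_lt_trans (nbx s s0 s1) hkv1).
  set q := P _; rewrite sub_x0 => hq.
  have hq2 : enorm (q - P0 - (k + s *: v) *m S) <= e / 2 * (enorm k + enorm v).
    apply: le_trans hq _; rewrite ler_pM2l //; exact: nb.
  have qv : dot q v <= A + s * B + e / 2 * (enorm k + enorm v) * enorm v.
    have := le_trans (dot_le _ v) (ler_wpM2r (enorm_ge0 v) hq2).
    by rewrite mulmxDl -scalemxAl !(dotNl, dotDl, dotZl) -/B /A; lra.
  have BB : - B <= Ks * enorm v ^+ 2 by move: hB; rewrite ler_norml => /andP[]; lra.
  have t2 : 0 < t ^+ 2 by rewrite exprn_gt0.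
  have tq := ler_wpM2l (ltW t0) qv.
  have tB := ler_wpM2l (ltW t2) BB.
  clear -tq tB => h1 h2.
  rewrite -(subrKA (h (x0 + k + s *: v))); apply: le_trans (lerD h1 h2) _.
  clear h1 h2; rewrite [(t * _) ^+ 2]exprMn.
  by move: tq tB; set E := e / 2 * _ * _; set W := enorm v ^+ 2; lra.
(* Enough pieces for the terms with [1 / N] to be at most [e / 2] times [|v|^2]; the number depends
   neither on [k] nor on [v]. *)
pose N := (Num.truncn ((C + Ks / 2) / (e / 2))).+1.
have hN : (C + Ks / 2) / (e / 2) < N%:R by exact: truncnS_gt.
have := key N N isT (leqnn _); rewrite mulfV ?pnatr_eq0 // scale1r expr1n !mul1r.
move=> H; apply: le_trans H _.
rewrite -/A -/B [2^-1 * B]mulrC lerD2l.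
have N0 : 0 < N%:R :> R by rewrite ltr0n.
have h1 : (C + Ks / 2) * enorm v ^+ 2 / N%:R <= e / 2 * enorm v ^+ 2.
  rewrite mulrAC ler_wpM2r ?sqr_ge0 // ler_pdivrMr // [e / 2 * _]mulrC -ler_pdivrMr //; exact: ltW hN.
apply: le_trans (lerD (lexx _) h1) _.
have := enorm_ge0 k; have := enorm_ge0 v; move: (enorm k) (enorm v) => a b b0 a0.
have q1 : 0 <= e * a ^+ 2 by rewrite mulr_ge0 ?sqr_ge0 // ltW.
have q2 : 0 <= e * (a * b) by rewrite !mulr_ge0 // ltW.
by lra.
Qed.

(** The lower bound is the upper one read backwards, from [x0 + k + v] with increment [- v]; for
    this the base point must be allowed to move by [k]. The exchange costs a factor 4, whence
    [e / 4]. *)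
Lemma second_order_expansion (e : R) : 0 < e -> exists2 d : R, 0 < d &
  forall k v, enorm k < d -> enorm v < d ->
   `|h (x0 + k + v) - h (x0 + k) - (dot P0 v + dot (k *m S) v + dot (v *m S) v / 2)|
      <= e * (enorm k + enorm v) ^+ 2.
Proof.
move=> e0; have e4 : 0 < e / 4 by rewrite divr_gt0.
have [d d0 hd] := upper_expansion e4.
exists (d / 2); first by rewrite divr_gt0.
move=> k v hk hv.
have ek := enorm_ge0 k; have ev := enorm_ge0 v.
have h1 := hd k v ltac:(lra) ltac:(lra).
have hkv := enormD k v.
have := hd (k + v) (- v); rewrite enormN => /(_ ltac:(lra) ltac:(lra)).
have -> : x0 + (k + v) - v = x0 + k by rewrite addrA addrK.
rewrite addrA mulmxDl mulNmx !(dotDl, dotNr, dotNl) => h2.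
have h3 : (enorm (k + v) + enorm v) ^+ 2 <= 4 * (enorm k + enorm v) ^+ 2.
  have -> : 4 * (enorm k + enorm v) ^+ 2 = (2 * (enorm k + enorm v)) ^+ 2 by ring.
  by rewrite ler_pXn2r ?nnegrE ?addr_ge0 ?enorm_ge0 ?mulr_ge0 ?addr_ge0 //; lra.
have h4 := ler_wpM2l (ltW e4) h3.
by rewrite ler_norml; apply/andP; split; lra.
Qed.

(** The two ways around the parallelogram from [x0] to [x0 + t a + t b] give the same total
    increment, while their terms of order [t^2] differ by the antisymmetric part of [S]. *)
Lemma second_order_sym u v : dot (u *m S) v = dot (v *m S) u.
Proof.
suff key a b : dot (a *m S) b <= dot (b *m S) a by apply/eqP; rewrite eq_le !key.
rewrite -subr_le0; apply: (@le0_eps _ (4 * (enorm a + enorm b) ^+ 2)) => e e0.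
have [d d0 hd] := second_order_expansion e0.
have ea := enorm_ge0 a; have eb := enorm_ge0 b.
have m0 : 0 < enorm a + enorm b + 1 by lra.
pose t := d / (2 * (enorm a + enorm b + 1)).
have t0 : 0 < t by rewrite divr_gt0 // mulr_gt0.
have small (c : V) : enorm c <= enorm a + enorm b -> enorm (t *: c) < d.
  move=> hc; rewrite enormZ gtr0_norm // /t mulrAC ltr_pdivrMr ?mulr_gt0 // ltr_pM2l //; lra.
have ta := small a ltac:(lra); have tb := small b ltac:(lra).
have z0 : enorm (0 : V) < d by rewrite enorm0.
have := hd 0 (t *: a) z0 ta; have := hd 0 (t *: b) z0 tb.
have := hd (t *: a) (t *: b) ta tb; have := hd (t *: b) (t *: a) tb ta.
rewrite !addr0 mul0mx !dot0l enorm0 !enormZ (gtr0_norm t0) (addrAC x0 (t *: b)).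
rewrite -!scalemxAl !(dotZl, dotZr).
rewrite !ler_norml => /andP[h1 h1'] /andP[h2 h2'] /andP[h3 h3'] /andP[h4 h4'].
have tt : 0 < t ^+ 2 by rewrite exprn_gt0.
have l1 : (0 + t * enorm a) ^+ 2 <= t ^+ 2 * (enorm a + enorm b) ^+ 2.
  rewrite add0r exprMn ler_pM2l // ler_pXn2r ?nnegrE ?addr_ge0 //; lra.
have l2 : (0 + t * enorm b) ^+ 2 <= t ^+ 2 * (enorm a + enorm b) ^+ 2.
  rewrite add0r exprMn ler_pM2l // ler_pXn2r ?nnegrE ?addr_ge0 //; lra.
have l1' := ler_wpM2l (ltW e0) l1; have l2' := ler_wpM2l (ltW e0) l2.
rewrite -(ler_pM2l tt).
by lra.
Qed.

End Expansion.
End SecondOrder.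

(** * Quantitative duality between the two unit spheres *)

Section NormGeometry.
Context {R : realType} {n : nat}.
Notation V := 'rV[R]_(n.+1).
Implicit Types (u v w x y z p : V).
Context (phi : V -> R) (hphi : admissible_norm phi).
Notation g := (phistar phi).
Notation G := (grad phi).
Notation dual := (dualpair phi).
Let pN : is_norm phi := phi_norm hphi.
Let gN : is_norm g := phistar_norm hphi.

(** Adding the strong duality inequalities of both pairs bounds the angular defect
    [Y = |p| |p'| - p . p'] by a multiple of [(p - p') . (w - w')]. As [phi] equals 1 at both
    points, the angle controls [p - p'], so that [D^2] is at most a multiple of [D W]. *)
Lemma dual_lipschitz : exists2 K : R, 0 < K & forall p w p' w', dual p w -> dual p' w' ->
  enorm (p - p') <= K * enorm (w - w').
Proof.
have [c [C hb]] := phi_between hphi; have [c0 C0 h1 h2 _] := hb.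
have [gam gam0 hs] := dualpair_strong hphi.
exists (4 * C ^+ 2 / (c ^+ 3 * gam)).
  by rewrite divr_gt0 ?mulr_gt0 ?exprn_gt0.
move=> p w p' w' pw pw'.
have [[pp _ dpw] [pp' _ dpw']] := (pw, pw').
have s1 := hs _ _ p' pw; have s2 := hs _ _ p pw'.
rewrite pp' in s1; rewrite pp (dotC p p') in s2.
have := dot_le (p - p') (w - w'); rewrite !(dotBl, dotBr) dpw dpw'.
set D := enorm (p - p'); set W := enorm (w - w') => s3.
have P0 : 0 < enorm p by apply: enorm_gt0; have [] := dualpair_neq0 hphi pw.
have P0' : 0 < enorm p' by apply: enorm_gt0; have [] := dualpair_neq0 hphi pw'.
pose Y := enorm p * enorm p' - dot p' p.
have Y0 : 0 <= Y by rewrite subr_ge0 mulrC dot_le.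
have b1 q : phi q = 1 -> 0 < enorm q -> c <= (enorm q)^-1 <= C.
  move=> q1 q0; apply/andP; split.
    by rewrite -[(enorm q)^-1]mul1r ler_pdivlMr // -q1.
  by rewrite -[(enorm q)^-1]mul1r ler_pdivrMr // -q1.
have /andP[i1 i2] := b1 p pp P0; have /andP[i1' i2'] := b1 p' pp' P0'.
have t1 : enorm p' - dot p' p / enorm p = Y * (enorm p)^-1.
  by rewrite /Y; field; rewrite gt_eqF.
have t2 : enorm p - dot p' p / enorm p' = Y * (enorm p')^-1.
  by rewrite /Y; field; rewrite gt_eqF.
rewrite t1 in s1; rewrite t2 in s2.
have u1 : gam * Y * (2 * c) <= D * W.
  have q1 := ler_wpM2l (mulr_ge0 (ltW gam0) Y0) i1.
  have q2 := ler_wpM2l (mulr_ge0 (ltW gam0) Y0) i1'.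
  lra.
pose X := enorm (enorm p *: p' - enorm p' *: p).
have X2 : X ^+ 2 = 2 * (enorm p * enorm p') * Y.
  rewrite enorm_sqr !(dotBl, dotBr, dotZl, dotZr) -!enorm_sqr (dotC p p') /Y.
  by ring.
have DX : D <= 2 * C * X.
  have a1 : `|enorm p - enorm p'| <= C * X.
    have := norm_between_dist (enorm p *: p') (enorm p' *: p) hb.
    by rewrite !(normZ pN) pp pp' !mulr1 !(ger0_norm (enorm_ge0 _)).
  have a2 : enorm p' * D <= X + enorm p' * (C * X).
    have -> : enorm p' * D = enorm ((enorm p - enorm p') *: p' - (enorm p *: p' - enorm p' *: p)).
      have -> : (enorm p - enorm p') *: p' - (enorm p *: p' - enorm p' *: p) = enorm p' *: (p - p').
        by apply/rowP => i; rewrite !mxE; ring.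
      by rewrite enormZ gtr0_norm.
    apply: le_trans (enormB _ _) _; rewrite -/X addrC lerD2l enormZ mulrC.
    by rewrite ler_pM2l.
  have X0 : 0 <= X by exact: enorm_ge0.
  have : D <= X * (enorm p')^-1 + C * X.
    rewrite -(ler_pM2l P0'); apply: le_trans a2 _.
    by rewrite mulrDr [Z in _ <= Z + _]mulrCA mulfV ?gt_eqF // mulr1.
  by have := ler_wpM2l X0 i2'; lra.
have DD : D ^+ 2 <= 4 * C ^+ 2 * (2 * (enorm p * enorm p') * Y).
  rewrite -X2; have -> : 4 * C ^+ 2 * X ^+ 2 = (2 * C * X) ^+ 2 by ring.
  by rewrite ler_pXn2r ?nnegrE ?mulr_ge0 ?enorm_ge0 // ltW.
have pc q : 0 < enorm q -> c <= (enorm q)^-1 -> enorm q <= c^-1.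
  by move=> q0 hq; rewrite -[enorm q]invrK lef_pV2 ?posrE ?invr_gt0.
have e1 : enorm p * enorm p' <= c^-1 * c^-1.
  by rewrite ler_pM ?enorm_ge0 ?pc.
have DD2 : D ^+ 2 <= 8 * C ^+ 2 * (c^-1 * c^-1) * Y.
  apply: le_trans DD _.
  have -> : 4 * C ^+ 2 * (2 * (enorm p * enorm p') * Y) = 8 * C ^+ 2 * Y * (enorm p * enorm p') by ring.
  have -> : 8 * C ^+ 2 * (c^-1 * c^-1) * Y = 8 * C ^+ 2 * Y * (c^-1 * c^-1) by ring.
  apply: ler_wpM2l e1; apply: mulr_ge0 => //; apply: mulr_ge0 => //; exact: sqr_ge0.
have [D0|D0] := eqVneq D 0.
  by rewrite D0 mulr_ge0 ?enorm_ge0 // divr_ge0 ?mulr_ge0 ?exprn_ge0 // ltW.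
have Dp : 0 < D by rewrite lt_neqAle eq_sym D0 enorm_ge0.
rewrite -(ler_pM2l Dp) -expr2; apply: le_trans DD2 _.
have -> : D * (4 * C ^+ 2 / (c ^+ 3 * gam) * W) = (4 * C ^+ 2 / (c ^+ 3 * gam)) * (D * W) by ring.
have -> : 8 * C ^+ 2 * (c^-1 * c^-1) * Y = (4 * C ^+ 2 / (c ^+ 3 * gam)) * (gam * Y * (2 * c)).
  by field; rewrite !gt_eqF.
by rewrite ler_pM2l // divr_gt0 ?mulr_gt0 ?exprn_gt0.
Qed.

(** Euler's relation [phi (p + v) = (p + v) . G (p + v)]: here [p . G (p + v) <= phi p = 1], and in
    [v . G (p + v)] the Lipschitz bound replaces the gradient by [w]. *)
Lemma phi_quad_upper : exists K d : R, [/\ 0 < K, 0 < d & forall p w v, dual p w ->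
  enorm v <= d -> phi (p + v) <= 1 + dot v w + K * enorm v ^+ 2].
Proof.
have [K [d [K0 d0 hK]]] := grad_lipschitz hphi.
exists K, d; split=> // p w v pw hv; have [pp _ dpw] := pw.
have KK : 0 <= K * enorm v ^+ 2 by rewrite mulr_ge0 ?sqr_ge0 // ltW.
have [e|ne] := eqVneq (p + v) 0.
  have := dot0l w; rewrite -e dotDl dpw e (norm0 pN); lra.
rewrite -(grad_eq hphi ne) dotDl.
have := grad_le hphi p ne; rewrite pp.
have -> : dot v (G (p + v)) = dot v (G (p + v) - G p) + dot v w.
  by rewrite -(dualpair_grad hphi pw) dotBr subrK.
have := le_trans (dot_le v _) (ler_wpM2l (enorm_ge0 v) (hK p v pp hv)).
by rewrite -(dualpair_grad hphi pw); lra.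
Qed.

(* Dual form of the previous upper bound: the Wulff shape is uniformly round. *)
Lemma wulff_round : exists2 c : R, 0 < c & forall p w z, dual p w -> g z <= 1 ->
  c * enorm (w - z) ^+ 2 <= dot (w - z) p.
Proof.
have [K [d [K0 d0 hK]]] := phi_quad_upper.
have [c [C [c0 C0 h1 h2 _]]] := phistar_between hphi.
have m0 : 0 < d * c / 2 by rewrite divr_gt0 ?mulr_gt0.
(* Duality is tested with [p + th (z - w)]. The bound [d c / 2] keeps the increment shorter than
   [d], as both points have norm at most [1 / c]; [1 / (2 K)] lets the gain [th |w - z|^2] exceed
   twice the quadratic error. *)
pose th := Num.min (2 * K)^-1 (d * c / 2).
have th0 : 0 < th by rewrite lt_min m0 invr_gt0 mulr_gt0.
exists (th / 2) => [|p w z pw gz]; first by rewrite divr_gt0.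
have [pp gw dpw] := pw.
have hv : enorm (th *: (z - w)) <= d.
  have e1 : c * enorm z <= 1 by apply: le_trans (h1 _) _.
  have e2 : c * enorm w <= 1 by apply: le_trans (h1 _) _; rewrite gw.
  have e3 : c * enorm (z - w) <= 2.
    by have := ler_wpM2l (ltW c0) (enormB z w); lra.
  rewrite enormZ gtr0_norm //.
  have : th <= d * c / 2 by rewrite ge_min lexx orbT.
  move=> /(ler_wpM2r (enorm_ge0 (z - w))); have := ler_wpM2l (ltW d0) e3; lra.
have := hK p w _ pw hv.
have := dual_le hphi z (p + th *: (z - w)).
have e4 : phi (p + th *: (z - w)) * g z <= phi (p + th *: (z - w)).
  by rewrite -[leRHS]mulr1 ler_wpM2l ?(norm_ge0 pN).
rewrite dotDl !dotZl enormZ (gtr0_norm th0) (enormBC z w).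
have e5 : K * (th * enorm (w - z)) ^+ 2 <= th / 2 * enorm (w - z) ^+ 2.
  have : th <= (2 * K)^-1 by rewrite ge_min lexx.
  rewrite -[_^-1]mul1r ler_pdivlMr ?mulr_gt0 // => e5.
  rewrite exprMn mulrA ler_wpM2r ?sqr_ge0 //.
  have := ler_wpM2l (ltW th0) e5; lra.
have e6 : th * dot (z - w) z - th * dot (z - w) w = th * enorm (w - z) ^+ 2.
  by rewrite -mulrBr -dotBr -enorm_sqr enormBC.
have -> : dot (w - z) p = 1 - dot p z by rewrite dotBl dotC dpw (dotC z).
lra.
Qed.

(** The gradient of [phistar phi], homogeneous of degree 0. The choice becomes canonical for
    [z != 0] once [dual_uniq] is available. *)
Definition nor z : V := xget 0 [set p | dual p ((g z)^-1 *: z)].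

Lemma nor_dual z : z != 0 -> dual (nor z) ((g z)^-1 *: z).
Proof.
move=> z0; have gz := norm_gt0 gN z0.
have [|p hp] := @dualpair_exists _ _ _ hphi ((g z)^-1 *: z).
  by rewrite (normZ gN) gtr0_norm ?invr_gt0 // mulVf // gt_eqF.
rewrite /nor; case: xgetP => [y _ //|/(_ p)].
by move=> /(_ hp).
Qed.

Lemma dual_uniq p p' w : dual p w -> dual p' w -> p = p'.
Proof.
have [K K0 hK] := dual_lipschitz => h1 h2.
apply/eqP; rewrite -subr_eq0; apply/eqP; apply: enorm_eq0; apply/eqP.
by rewrite eq_le enorm_ge0 andbT; have := hK _ _ _ _ h1 h2; rewrite subrr enorm0 mulr0.
Qed.

Lemma nor_eq p w (r : R) : 0 < r -> dual p w -> nor (r *: w) = p.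
Proof.
move=> r0 pw; have [pp gw dpw] := pw; have [_ w0] := dualpair_neq0 hphi pw.
have : r *: w != 0 by rewrite scaler_eq0 negb_or gt_eqF.
move/nor_dual; rewrite (normZ gN) gtr0_norm // gw mulr1 scalerA mulVf ?gt_eqF // scale1r.
by move=> h; exact: dual_uniq h pw.
Qed.

Lemma nor_phi z : z != 0 -> phi (nor z) = 1.
Proof. by move=> /nor_dual[]. Qed.

Lemma nor_dot z : z != 0 -> dot (nor z) z = g z.
Proof.
move=> z0; have [_ _] := nor_dual z0; rewrite dotZr => h.
have gz := norm_gt0 gN z0.
by rewrite -[LHS](mulVKf (lt0r_neq0 gz)) h mulr1.
Qed.

Lemma nor_le z z' : z != 0 -> dot (nor z) z' <= g z'.
Proof. by move=> z0; have := dual_le hphi z' (nor z); rewrite nor_phi // mul1r. Qed.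

Lemma nor_lipschitz : exists2 K : R, 0 < K & forall z z', z != 0 -> z' != 0 ->
  enorm (nor z - nor z') <= K * enorm (z - z') / g z.
Proof.
have [K K0 hK] := dual_lipschitz.
have [c [C hb]] := phistar_between hphi; have [c0 C0 h1 h2 _] := hb.
exists (K * (2 * C / c)) => [|z z' z0 z0']; first by rewrite !mulr_gt0 ?invr_gt0.
have gz := norm_gt0 gN z0; have gz' := norm_gt0 gN z0'.
apply: le_trans (hK _ _ _ _ (nor_dual z0) (nor_dual z0')) _.
rewrite -!mulrA ler_pM2l // mulrA mulrCA -ler_pdivrMl ?invr_gt0 // invrK.
apply: le_trans (h1 _) _.
have -> : (g z)^-1 *: z - (g z')^-1 *: z' =
    (g z)^-1 *: (z - z') + ((g z' - g z) * (g z)^-1 * (g z')^-1) *: z'.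
  by apply/rowP => i; rewrite !mxE; field; rewrite !gt_eqF.
apply: le_trans (normD gN _ _) _; rewrite !(normZ gN) !normrM.
rewrite (gtr0_norm (_ : 0 < (g z)^-1)) ?invr_gt0 // (gtr0_norm (_ : 0 < (g z')^-1)) ?invr_gt0 //.
rewrite -[_ * _ * g z']mulrA mulVf ?gt_eqF // mulr1.
have a1 := h2 (z - z').
have := norm_between_dist z' z hb; rewrite enormBC => a2.
have i0 : 0 <= (g z)^-1 by rewrite invr_ge0 ltW.
by have := ler_wpM2l i0 a1; have := ler_wpM2l i0 a2; lra.
Qed.

(** Since [nor z' . z <= g z], the increment is at most [nor z' . (z' - z)]; replacing [nor z'] by
    [nor z] costs the Lipschitz bound. At [z' = 0], where [nor] means nothing, the linear term is
    already exact. *)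
Lemma star_semiconcave : exists2 K : R, 0 < K & forall z z', z != 0 ->
  g z' - g z <= dot (nor z) (z' - z) + K * enorm (z' - z) ^+ 2 / g z.
Proof.
have [K K0 hK] := nor_lipschitz; exists K => // z z' z0.
have gz := norm_gt0 gN z0.
have [->|z0'] := eqVneq z' 0.
  rewrite (norm0 gN) !sub0r dotNr nor_dot // lerDl; apply: divr_ge0; last exact: ltW.
  by apply: mulr_ge0; [exact: ltW|exact: sqr_ge0].
rewrite -{1}(nor_dot z0').
have h1 := nor_le z z0'.
have := le_trans (dot_le (nor z' - nor z) (z' - z)) (ler_wpM2r (enorm_ge0 _) _).
move=> /(_ (K * enorm (z' - z) / g z)); rewrite enormBC (enormBC z' z) => /(_ (hK _ _ z0 z0')).
rewrite !(dotBl, dotBr).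
have -> : K * enorm (z - z') / g z * enorm (z - z') = K * enorm (z - z') ^+ 2 / g z by ring.
by lra.
Qed.

Lemma gradient_scale y : y != 0 -> dual ((phi y)^-1 *: y) (G y).
Proof.
move=> y0; have py := norm_gt0 pN y0.
have e1 : phi ((phi y)^-1 *: y) = 1.
  by rewrite (normZ pN) gtr0_norm ?invr_gt0 // mulVf // gt_eqF.
have h := grad_dualpair hphi e1; have [_ _ h3] := h.
suff <- : G ((phi y)^-1 *: y) = G y by [].
apply: (grad_uniq hphi) => // [v|]; first exact: (dualpair_le hphi v h).
by move: h3; rewrite dotZl => h3; rewrite -[LHS](mulVKf (lt0r_neq0 py)) h3 mulr1.
Qed.

Lemma inj_unitmx (B : 'M[R]_n.+1) : (forall x, x *m B = 0 -> x = 0) -> B \in unitmx.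
Proof.
move=> h; rewrite -row_free_unit -kermx_eq0; apply/eqP/row_matrixP => i.
by rewrite row0; apply: h; rewrite -row_mul mulmx_ker row0.
Qed.

Section AtPoint.
Context (p0 eta : V) (dp0 : dual p0 eta).

Let pp0 : phi p0 = 1. Proof. by case: dp0. Qed.
Let p0n : p0 != 0. Proof. by have [] := dualpair_neq0 hphi dp0. Qed.
Let ge : g eta = 1. Proof. by case: dp0. Qed.
Let pe : dot p0 eta = 1. Proof. by case: dp0. Qed.
Let ep0 : 0 < enorm p0. Proof. exact: enorm_gt0. Qed.
Let gp0 : eta = G p0. Proof. exact: dualpair_grad. Qed.

(** The Gram determinant of [p0] and [z], which is [|p0|^2] times the squared length of the part of
    [z] orthogonal to [p0]. The Hessian of a norm, degenerate along [p0], can only be bounded below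
    by such a quantity. *)
Definition gram z := enorm p0 ^+ 2 * enorm z ^+ 2 - dot p0 z ^+ 2.

Lemma gram_ge0 z : 0 <= gram z.
Proof. by rewrite subr_ge0 !enorm_sqr cauchy_schwarz_sqr. Qed.

(** Strong duality at [p0] and at [y = p0 + t z] bounds [(y - p0) . (G y - G p0)] below by a
    multiple of the defect [Y], hence of [t^2 gram z]; differentiability of [G] turns this product
    into [t^2 (z Phi) . z] up to a small error. *)
Lemma hessian_lower (Phi : 'M[R]_n.+1) :
  (forall e : R, 0 < e -> exists2 d : R, 0 < d & forall y, enorm (y - p0) < d ->
    enorm (G y - G p0 - (y - p0) *m Phi) <= e * enorm (y - p0)) ->
  exists2 c : R, 0 < c & forall z, c * gram z <= dot (z *m Phi) z.
Proof.
move=> hPhi; have [gam gam0 hs] := dualpair_strong hphi.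
exists (gam / (4 * enorm p0 ^+ 3)) => [|z].
  by rewrite divr_gt0 ?mulr_gt0 ?exprn_gt0.
rewrite -subr_le0; apply: (@le0_eps R _ (enorm z ^+ 2)) => e e0.
have [d d0 hd] := hPhi e e0.
have k0 : 0 < enorm z + 1 by rewrite ltr_wpDl ?enorm_ge0.
pose m := Num.min d (enorm p0).
have m0 : 0 < m by rewrite lt_min d0.
pose t := m / (2 * (enorm z + 1)).
have t0 : 0 < t by rewrite divr_gt0 ?mulr_gt0.
have tz : enorm (t *: z) < m.
  rewrite enormZ gtr0_norm // /t mulrAC ltr_pdivrMr ?mulr_gt0 // ltr_pM2l //.
  by have := enorm_ge0 z; lra.
pose y := p0 + t *: z.
have yp : y - p0 = t *: z by rewrite /y addrC addKr.
have hz : enorm (t *: z) < d /\ enorm (t *: z) < enorm p0.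
  by move: tz; rewrite lt_min => /andP[].
have [hz1 hz2] := hz.
have y0 : y != 0.
  by apply: contraTneq hz2 => e1; rewrite -yp e1 sub0r enormN ltxx.
have ey := enorm_gt0 y0; have fy := norm_gt0 pN y0.
have H1 := hd y; rewrite yp in H1; have {}H1 := H1 hz1.
have s1 := hs _ _ y dp0.
have s2 := hs _ _ p0 (gradient_scale y0).
rewrite dotZr enormZ gtr0_norm ?invr_gt0 // pp0 in s2.
have e2 : (phi y)^-1 * dot p0 y / ((phi y)^-1 * enorm y) = dot p0 y / enorm y.
  by field; rewrite !gt_eqF.
rewrite e2 {e2} in s2.
have e3 := grad_eq hphi y0.
pose Y := enorm p0 * enorm y - dot p0 y.
have Y0 : 0 <= Y by rewrite subr_ge0 dot_le.
have g1 : t ^+ 2 * gram z = Y * (enorm p0 * enorm y + dot p0 y).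
  rewrite /Y mulrC -[RHS]mulrC; rewrite [RHS]mulrC.
  have -> : (enorm p0 * enorm y - dot p0 y) * (enorm p0 * enorm y + dot p0 y)
    = enorm p0 ^+ 2 * enorm y ^+ 2 - dot p0 y ^+ 2 by ring.
  rewrite /gram /y !enorm_sqr !(dotDl, dotDr, dotZl, dotZr) (dotC z p0).
  by ring.
have g2 : t ^+ 2 * gram z <= Y * (2 * (enorm p0 * enorm y)).
  by rewrite g1 ler_wpM2l //; have := dot_le p0 y; lra.
have ey2 : enorm y <= 2 * enorm p0.
  by apply: le_trans (enormD _ _) _; lra.
have s3 : gam * (Y / enorm p0) <= dot (t *: z) (G y - eta).
  have q1 : 0 <= gam * (Y / enorm y).
    by rewrite mulr_ge0 ?divr_ge0 ?enorm_ge0 // ltW.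
  have e4 : enorm y - dot y p0 / enorm p0 = Y / enorm p0.
    by rewrite /Y (dotC y); field; rewrite gt_eqF.
  have e5 : enorm p0 - dot p0 y / enorm y = Y / enorm y.
    by rewrite /Y; field; rewrite gt_eqF.
  rewrite e4 in s1; rewrite e5 in s2.
  by rewrite -yp !(dotBl, dotBr) e3 pe; lra.
have s4 : dot (t *: z) (G y - eta) <= t ^+ 2 * dot (z *m Phi) z + e * (t ^+ 2 * enorm z ^+ 2).
  have -> : dot (t *: z) (G y - eta) =
     dot (G y - G p0 - (t *: z) *m Phi) (t *: z) + t ^+ 2 * dot (z *m Phi) z.
    by rewrite -gp0 dotBl -scalemxAl !dotZl !dotZr (dotC z); ring.
  rewrite addrC lerD2l; apply: le_trans (dot_le _ _) _.
  apply: le_trans (ler_wpM2r (enorm_ge0 _) H1) _.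
  by rewrite enormZ gtr0_norm // le_eqVlt; apply/orP; left; apply/eqP; ring.
have tt : 0 < t ^+ 2 by rewrite exprn_gt0.
rewrite -(ler_pM2l tt).
have s5 : t ^+ 2 * (gam / (4 * enorm p0 ^+ 3) * gram z) <= gam * (Y / enorm p0).
  have -> : t ^+ 2 * (gam / (4 * enorm p0 ^+ 3) * gram z) =
     gam / (4 * enorm p0 ^+ 3) * (t ^+ 2 * gram z) by ring.
  have -> : gam * (Y / enorm p0) = gam / (4 * enorm p0 ^+ 3) * (Y * (2 * (enorm p0 * (2 * enorm p0)))).
    by field; rewrite gt_eqF.
  rewrite ler_pM2l ?divr_gt0 ?mulr_gt0 ?exprn_gt0 //.
  apply: le_trans g2 _; rewrite ler_wpM2l // ler_pM2l // ler_pM2l //.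
by lra.
Qed.

(** The Hessian [Phi] of [phi] at [p0] annihilates [p0] by homogeneity. Adding [eta^T *m eta] makes
    it positive definite and sends [p0] to [eta], while on actual increments it contributes only
    [(p - p0) . eta], a quantity of second order. [Q] is the inverse of the sum, that is, the
    Hessian of half the square of [phistar phi] at [eta]. *)
Lemma dual_diff : exists Q : 'M[R]_n.+1,
  [/\ forall x, x != 0 -> 0 < dot (x *m Q) x, eta *m Q = p0 &
   forall e : R, 0 < e -> exists2 d : R, 0 < d & forall p w, dual p w ->
     enorm (w - eta) < d -> enorm (p - p0 - (w - eta) *m Q) <= e * enorm (w - eta)].
Proof.
have [Phi hPhi] := grad_diff hphi p0n.
have [c c0 hc] := hessian_lower hPhi.
have [K K0 hK] := dual_lipschitz.
pose B := Phi + eta^T *m eta.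
have mulB x : x *m B = x *m Phi + dot x eta *: eta.
  rewrite mulmxDr mulmxA; congr (_ + _).
  have -> : x *m eta^T = (dot x eta)%:M by rewrite dotE [LHS]mx11_scalar.
  by rewrite mul_scalar_mx.
have posB x : x != 0 -> 0 < dot (x *m B) x.
  move=> x0; rewrite mulB dotDl dotZl (dotC eta) -expr2.
  have [h|h] := ltP 0 (gram x).
    have := hc x; have : 0 < c * gram x by rewrite mulr_gt0.
    by have := sqr_ge0 (dot x eta); lra.
  have g0 : gram x = 0 by apply/eqP; rewrite eq_le h gram_ge0.
  have e1 : enorm p0 ^+ 2 *: x = dot p0 x *: p0.
    apply/eqP; rewrite -subr_eq0; apply/eqP; apply: dot_eq0.
    rewrite !(dotBl, dotBr, dotZl, dotZr) (dotC x p0) -!enorm_sqr.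
    by transitivity (enorm p0 ^+ 2 * gram x); [rewrite /gram; ring|rewrite g0 mulr0].
  have e2 : enorm p0 ^+ 2 * dot x eta = dot p0 x by rewrite -dotZl e1 dotZl pe mulr1.
  have e3 : dot x eta != 0.
    apply: contra_neq x0 => e3; move: e2; rewrite e3 mulr0 => e2.
    move: e1; rewrite -e2 scale0r => /eqP; rewrite scaler_eq0 => /orP[|/eqP//].
    by rewrite sqrf_eq0 gt_eqF.
  have := hc x; rewrite g0 mulr0 => h1.
  by rewrite ltr_wpDl // lt_neqAle sqr_ge0 eq_sym sqrf_eq0 e3.
have uB : B \in unitmx.
  apply: inj_unitmx => x xB; apply: contrapT => /eqP x0.
  by have := posB x x0; rewrite xB dot0l ltxx.
have p0B : p0 *m B = eta.
  rewrite mulB pe scale1r.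
  suff -> : p0 *m Phi = 0 by rewrite add0r.
  apply: linear_small => e e0; have [d d0 hd] := hPhi e e0.
  exists (d / (2 * enorm p0)); first by rewrite divr_gt0 ?mulr_gt0.
  set t := d / _; have t0 : 0 < t by rewrite divr_gt0 ?mulr_gt0.
  have := hd ((1 + t) *: p0).
  have -> : (1 + t) *: p0 - p0 = t *: p0 by apply/rowP => i; rewrite !mxE; ring.
  have -> : G ((1 + t) *: p0) = G p0.
    have t1 : 0 < 1 + t by rewrite addr_gt0.
    have nz : (1 + t) *: p0 != 0 by rewrite scaler_eq0 negb_or gt_eqF.
    have := gradient_scale nz; rewrite (normZ pN) gtr0_norm // pp0 mulr1 scalerA mulVf ?gt_eqF //.
    by rewrite scale1r => /(dualpair_grad hphi).
  rewrite subrr sub0r enormN; apply.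
  rewrite enormZ gtr0_norm // /t.
  have -> : d / (2 * enorm p0) * enorm p0 = d / 2 by field; rewrite gt_eqF.
  lra.
exists (invmx B); split.
- move=> x x0; rewrite -{2}(mulmxKV uB x) dotC; apply: posB.
  by apply: contra x0 => /eqP h; rewrite -(mulmxKV uB x) h mul0mx.
- by rewrite -p0B mulmxK.
move=> e e0; have [M M0 hM] := mulmx_bound (invmx B).
have e1 : 0 < e / (2 * M * K) by rewrite divr_gt0 ?mulr_gt0.
have [d d0 hd] := hPhi _ e1.
have eb : 0 < enorm eta by apply: enorm_gt0; have [] := dualpair_neq0 hphi dp0.
exists (Num.min (d / K) (e / (2 * M * K * enorm eta))).
  by rewrite lt_min !divr_gt0 ?mulr_gt0.
move=> p w pw; rewrite lt_min => /andP[].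
rewrite ltr_pdivlMr // mulrC => hw1 /ltW; rewrite ler_pdivlMr ?mulr_gt0 // => hw2.
have hp := hK _ _ _ _ pw dp0.
have H := hd p (le_lt_trans hp hw1).
rewrite -gp0 -(dualpair_grad hphi pw) in H.
have tang : `|dot (p - p0) eta| <= K * enorm (w - eta) ^+ 2.
  have [pp gw pw1] := pw.
  have b1 : dot p eta <= 1 by rewrite -ge; exact: dualpair_lestar pw.
  have b2 : dot p0 w <= 1 by rewrite -gw; exact: dualpair_lestar dp0.
  have := le_trans (dot_le (p - p0) (w - eta)) (ler_wpM2r (enorm_ge0 _) hp).
  rewrite !(dotBl, dotBr) pw1 pe expr2 mulrA => b3.
  rewrite ler_norml; apply/andP; split; first by lra.
  have : 0 <= K * enorm (w - eta) * enorm (w - eta) by rewrite !mulr_ge0 ?enorm_ge0 // ltW.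
  by lra.
have -> : p - p0 - (w - eta) *m invmx B = ((p - p0) *m B - (w - eta)) *m invmx B.
  by rewrite [RHS]mulmxBl mulmxK.
apply: le_trans (hM _) _.
have : enorm ((p - p0) *m B - (w - eta)) <=
   e / (2 * M * K) * (K * enorm (w - eta)) + K * enorm (w - eta) ^+ 2 * enorm eta.
  have -> : (p - p0) *m B - (w - eta) =
    dot (p - p0) eta *: eta - (w - eta - (p - p0) *m Phi).
    by rewrite mulB; apply/rowP => i; rewrite !mxE; ring.
  apply: le_trans (enormB _ _) _; rewrite addrC lerD //.
    apply: le_trans H _; rewrite ler_wpM2l // divr_ge0 ?mulr_ge0 //; exact: ltW.
  by rewrite enormZ ler_wpM2r // enorm_ge0.
move=> /(ler_wpM2l (ltW M0)) h; apply: le_trans h _.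
have -> : M * (e / (2 * M * K) * (K * enorm (w - eta)) + K * enorm (w - eta) ^+ 2 * enorm eta)
  = e * enorm (w - eta) / 2 + (enorm (w - eta) * (2 * M * K * enorm eta)) * enorm (w - eta) / 2.
  by field; rewrite !gt_eqF.
by have := ler_wpM2r (enorm_ge0 (w - eta)) hw2; lra.
Qed.

End AtPoint.
End NormGeometry.

(** * Second-order expansion of the dual norm *)

Section StarHessian.
Context {R : realType} {n : nat}.
Notation V := 'rV[R]_(n.+1).
Implicit Types (u v w x y z p k : V).
Context (phi : V -> R) (hphi : admissible_norm phi).
Notation g := (phistar phi).
Notation dual := (dualpair phi).
Let gN : is_norm g := phistar_norm hphi.
Context (p0 eta : V) (dp0 : dual p0 eta) (Q : 'M[R]_n.+1).
Hypothesis etaQ : eta *m Q = p0.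
Hypothesis diffQ : forall e : R, 0 < e -> exists2 d : R, 0 < d & forall p w, dual p w ->
  enorm (w - eta) < d -> enorm (p - p0 - (w - eta) *m Q) <= e * enorm (w - eta).

(** The Hessian of [phistar phi] at [eta]; removing the rank-one term gives [eta *m N = 0], as
    homogeneity of degree one demands. *)
Let N := Q - p0^T *m p0.

Lemma hess_mulE k : k *m N = k *m Q - dot k p0 *: p0.
Proof.
rewrite mulmxBr mulmxA; congr (_ - _).
have -> : k *m p0^T = (dot k p0)%:M by rewrite dotE [LHS]mx11_scalar.
by rewrite mul_scalar_mx.
Qed.

Lemma nor_diff (r : R) : 0 < r -> forall e : R, 0 < e -> exists2 d : R, 0 < d &
  forall y, enorm (y - r *: eta) < d ->
    enorm (nor phi y - p0 - (y - r *: eta) *m (r^-1 *: N)) <= e * enorm (y - r *: eta).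
Proof.
move=> r0 e e0.
have [pp ge pe] := dp0; have [_ eta0] := dualpair_neq0 hphi dp0.
have [c [C hb]] := phistar_between hphi; have [c0 C0 h1 h2 _] := hb.
have [K K0 hK] := star_semiconcave hphi.
have [MQ MQ0 hMQ] := mulmx_bound Q.
pose A1 := 1 + enorm p0 * enorm eta.
have A10 : 0 < A1 by rewrite /A1 ltr_pwDl // mulr_ge0 ?enorm_ge0.
pose M2 := A1 * (2 * C / r ^+ 2) + 2 * K * enorm eta / r ^+ 2.
have M20 : 0 < M2.
  rewrite /M2 ltr_pwDl // ?mulr_gt0 ?invr_gt0 ?exprn_gt0 //.
  by apply: mulr_ge0; [rewrite mulr_ge0 ?enorm_ge0 // mulr_ge0 // ltW|rewrite invr_ge0 sqr_ge0].
pose M1 := A1 / r + M2; have M10 : 0 < M1 by rewrite addr_gt0 // divr_gt0.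
have [|d1 d10 hd1] := @diffQ (e / (2 * M1)); first by rewrite divr_gt0 ?mulr_gt0.
pose d := Num.min (Num.min 1 (r / (2 * C))) (Num.min (d1 / M1) (e / (2 * MQ * M2))).
exists d; first by rewrite !lt_min ltr01 !divr_gt0 ?mulr_gt0.
move=> z; rewrite !lt_min => /andP[/andP[k1 k2] /andP[k3 k4]].
pose k := z - r *: eta.
have zE : z = r *: eta + k by rewrite /k addrC subrK.
rewrite -/k in k1 k2 k3 k4 *.
have ek := enorm_ge0 k.
have re0 : r *: eta != 0 by rewrite scaler_eq0 negb_or gt_eqF.
have gr : g (r *: eta) = r by rewrite (normZ gN) ge mulr1 gtr0_norm.
have norr : nor phi (r *: eta) = p0 by apply: nor_eq.
have a1 : `|g z - r| <= C * enorm k by have := norm_between_dist z (r *: eta) hb; rewrite gr.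
have a2 : C * enorm k < r / 2.
  by move: k2; rewrite ltr_pdivlMr ?mulr_gt0 //; lra.
have a3 : r / 2 < g z by move: a1; rewrite ler_norml => /andP[]; lra.
have gz : 0 < g z by lra.
have z0 : z != 0 by apply: (norm_neq0 gN).
pose w := (g z)^-1 *: z.
have dw : dual (nor phi z) w := nor_dual hphi z0.
(* The defect of the linear approximation of [g]: nonnegative by duality, quadratically small by
   semiconcavity. *)
pose b := g z - r - dot k p0.
have b0 : 0 <= b.
  have := nor_le hphi z re0; rewrite norr zE dotDr dotZr pe mulr1 /b (dotC k) -zE; lra.
have b1 : b <= K * enorm k ^+ 2 / r.
  by have := hK (r *: eta) z re0; rewrite norr gr -/k (dotC p0) /b; lra.
(* [q / r] is the first-order displacement of the normalized point [w]: the part of [k] along [eta]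
   changes only the length. *)
pose q := k - dot k p0 *: eta.
have eq : enorm q <= A1 * enorm k.
  apply: le_trans (enormB _ _) _; rewrite enormZ /A1 mulrDl mul1r lerD2l.
  by rewrite mulrAC ler_wpM2r ?enorm_ge0 // mulrC cauchy_schwarz.
have wE : w - eta - r^-1 *: q = ((r - g z) / (g z * r)) *: q - (b / g z) *: eta.
  by rewrite /w /q /b zE; apply/rowP => i; rewrite !mxE -zE; field; rewrite !gt_eqF.
have gi : (g z)^-1 <= 2 / r.
  by rewrite -[2 / r]invrK lef_pV2 ?posrE ?invr_gt0 ?divr_gt0 // invf_div; lra.
have gi0 : 0 <= (g z)^-1 by rewrite invr_ge0 ltW.
have ri0 : 0 <= r^-1 by rewrite invr_ge0 ltW.
have w2 : enorm (w - eta - r^-1 *: q) <= M2 * enorm k ^+ 2.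
  rewrite wE; apply: le_trans (enormB _ _) _; rewrite !enormZ /M2 [leRHS]mulrDl.
  apply: lerD.
    have t1 : `|(r - g z) / (g z * r)| <= C * enorm k * (2 / r * r^-1).
      rewrite normrM distrC invfM (ger0_norm (mulr_ge0 gi0 ri0)).
      by apply: ler_pM => //; [exact: mulr_ge0|apply: ler_wpM2r].
    apply: le_trans (ler_pM (normr_ge0 _) (enorm_ge0 _) t1 eq) _.
    by rewrite le_eqVlt; apply/orP; left; apply/eqP; field; rewrite gt_eqF.
  rewrite ger0_norm ?divr_ge0 ?(ltW gz) //.
  have t2 : b / g z <= K * enorm k ^+ 2 / r * (2 / r) by apply: ler_pM.
  apply: le_trans (ler_wpM2r (enorm_ge0 _) t2) _.
  by rewrite le_eqVlt; apply/orP; left; apply/eqP; field; rewrite gt_eqF.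
have w1 : enorm (w - eta) <= M1 * enorm k.
  rewrite -[w - eta](subrK (r^-1 *: q)); apply: le_trans (enormD _ _) _.
  rewrite enormZ (ger0_norm ri0) /M1 mulrDl addrC; apply: lerD.
    by rewrite [A1 / r]mulrC -mulrA ler_wpM2l.
  by apply: le_trans w2 _; rewrite ler_wpM2l ?(ltW M20) // expr2 ler_piMl // ltW.
have H := hd1 _ _ dw _.
have {}H := H (le_lt_trans w1 _).
have {}H : enorm (nor phi z - p0 - (w - eta) *m Q) <= e / (2 * M1) * enorm (w - eta).
  by apply: H; rewrite mulrC -ltr_pdivlMr.
have -> : nor phi z - p0 - k *m (r^-1 *: N) =
   (nor phi z - p0 - (w - eta) *m Q) + (w - eta - r^-1 *: q) *m Q.
  have qQ : q *m Q = k *m N by rewrite hess_mulE /q mulmxBl -scalemxAl etaQ.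
  move: (w - eta) => W.
  by rewrite (mulmxBl W) -(scalemxAl _ q) -(scalemxAr _ k) qQ [RHS]addrA subrK.
apply: le_trans (enormD _ _) _.
have h3 : enorm ((w - eta - r^-1 *: q) *m Q) <= MQ * (M2 * enorm k ^+ 2).
  by apply: le_trans (hMQ _) _; rewrite ler_wpM2l // ltW.
have h4 : enorm (nor phi z - p0 - (w - eta) *m Q) <= e / 2 * enorm k.
  apply: le_trans H _.
  have := ler_wpM2l (_ : 0 <= e / (2 * M1)) w1.
  move=> /(_ _) h; apply: le_trans (h _) _.
    by apply: divr_ge0; [exact: ltW|apply: mulr_ge0 => //; exact: ltW].
  by rewrite le_eqVlt; apply/orP; left; apply/eqP; field; rewrite gt_eqF.
have h5 : MQ * (M2 * enorm k ^+ 2) <= e / 2 * enorm k.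
  move: k4 => /ltW; rewrite ler_pdivlMr ?mulr_gt0 // => k4.
  have := ler_wpM2r ek k4; lra.
by lra.
Qed.

Let star_semiconcave_near (r : R) : 0 < r -> exists C rho : R, 0 < rho /\ (
  forall y y', enorm (y - r *: eta) < rho -> enorm (y' - r *: eta) < rho ->
    g y' - g y <= dot (nor phi y) (y' - y) + C * enorm (y' - y) ^+ 2).
Proof.
move=> r0; have [pp ge pe] := dp0.
have [c [C hb]] := phistar_between hphi; have [c0 C0 h1 h2 _] := hb.
have [K K0 hK] := star_semiconcave hphi.
exists (K * (2 / r)), (r / (2 * C)); split.
  by rewrite divr_gt0 ?mulr_gt0.
move=> y y' hy _.
have gr : g (r *: eta) = r by rewrite (normZ gN) ge mulr1 gtr0_norm.
have a1 : `|g y - r| <= C * enorm (y - r *: eta).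
  by have := norm_between_dist y (r *: eta) hb; rewrite gr.
have a2 : C * enorm (y - r *: eta) < r / 2.
  by move: hy; rewrite ltr_pdivlMr ?mulr_gt0 //; lra.
have a3 : r / 2 < g y by move: a1; rewrite ler_norml => /andP[]; lra.
have gy : 0 < g y by lra.
apply: le_trans (hK y y' (norm_neq0 gN gy)) _; rewrite lerD2l mulrAC.
apply: ler_wpM2r; first exact: sqr_ge0.
rewrite ler_pM2l // -[2 / r]invrK lef_pV2 ?posrE ?invr_gt0 ?divr_gt0 // invf_div; lra.
Qed.

(** [Q - p0^T *m p0] is a second derivative of a semiconcave function, hence symmetric by
    [second_order_sym]; the rank-one term is symmetric by its form. *)
Lemma hess_sym u v : dot (u *m Q) v = dot (v *m Q) u.
Proof.
have [C [rho [rho0 hsc]]] := star_semiconcave_near (@ltr01 R).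
have := second_order_sym rho0 hsc (nor_diff ltr01) u v.
rewrite invr1 scale1r !hess_mulE !dotBl !dotZl (dotC p0 v) (dotC p0 u).
lra.
Qed.

Lemma star_expansion (r : R) : 0 < r -> forall e : R, 0 < e -> exists2 d : R, 0 < d &
  forall k, enorm k < d ->
    `|g (r *: eta + k) - r - dot k p0 - (dot (k *m Q) k - dot k p0 ^+ 2) / (2 * r)|
       <= e * enorm k ^+ 2.
Proof.
move=> r0 e e0; have [pp ge pe] := dp0.
have [C [rho [rho0 hsc]]] := star_semiconcave_near r0.
have [d d0 hd] := second_order_expansion rho0 hsc (nor_diff r0) e0.
exists d => // k hk; have := hd 0 k; rewrite enorm0 => /(_ d0 hk).
rewrite addr0 add0r mul0mx dot0l addr0 (normZ gN) ge mulr1 (gtr0_norm r0).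
rewrite -scalemxAr dotZl hess_mulE dotBl dotZl (dotC p0 k) -expr2 => H.
have E : r^-1 * (dot (k *m Q) k - dot k p0 ^+ 2) / 2 =
   (dot (k *m Q) k - dot k p0 ^+ 2) / (2 * r) by field; rewrite gt_eqF.
by move: H; rewrite E opprD addrA.
Qed.

End StarHessian.

(** * The distance function and positive reach *)

Section Distance.
Context {R : realType} {n : nat}.
Notation V := 'rV[R]_(n.+1).
Implicit Types (u v w x y z : V) (A : set V).
Context (N : V -> R) (c C : R) (hb : norm_between N c C).
Let c0 : 0 < c. Proof. by case: hb. Qed.
Let C0 : 0 < C. Proof. by case: hb. Qed.
Let hlow x : c * enorm x <= N x. Proof. by case: hb. Qed.
Let hup x : N x <= C * enorm x. Proof. by case: hb. Qed.
Let hN : is_norm N. Proof. by case: hb. Qed.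

Lemma dist_le A x a : A a -> dist_g N A x <= N (x - a).
Proof.
move=> Aa; apply: ge_inf; last by exists a.
by exists 0 => _ [b _ <-]; exact: norm_ge0.
Qed.

Lemma dist_ge A x (r : R) : A !=set0 -> (forall a, A a -> r <= N (x - a)) ->
  r <= dist_g N A x.
Proof.
move=> [a Aa] h; apply: lb_le_inf; first by exists (N (x - a)), a.
by move=> _ [b Ab <-]; exact: h.
Qed.

Lemma dist_attained A x : closed A -> A !=set0 -> exists a, xi_g N A x a.
Proof.
move=> cA [a0 Aa0].
have b0 y : N (x - y) <= N (x - a0) -> enorm y <= enorm x + c^-1 * N (x - a0).
  move=> h; have := enorm_rdist y x; rewrite enormBC.
  have := hlow (x - y); rewrite -ler_pdivlMl // => h2.
  have ci : 0 <= c^-1 by rewrite invr_ge0 ltW.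
  have := ler_wpM2l ci h; lra.
have lipN y z : `|N (x - y) - N (x - z)| <= C * enorm (y - z).
  have := norm_between_dist (x - y) (x - z) hb.
  have -> : x - y - (x - z) = z - y by apply/rowP => i; rewrite !mxE; ring.
  by rewrite (enormBC z).
have [||||a [Aa ha] hmin] := @EVT_enorm R n (A `&` [set y | N (x - y) <= N (x - a0)])
   (fun y => N (x - y)) (enorm x + c^-1 * N (x - a0)).
- apply: closedI => //; apply: enorm_closed => y /= /negP; rewrite -ltNge => hy.
  exists ((N (x - y) - N (x - a0)) / C); first by rewrite divr_gt0 // subr_gt0.
  move=> z; rewrite ltr_pdivlMr // mulrC => hz; apply/negP; rewrite -ltNge.
  by have := lipN z y; rewrite ler_norml => /andP[]; lra.
- by exists a0; split=> /=.
- by move=> y [_] /b0.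
- move=> y e _ e0; exists (e / C); first by rewrite divr_gt0.
  move=> z _; rewrite ltr_pdivlMr // mulrC => hz.
  exact: le_lt_trans (lipN z y) hz.
exists a; split=> //; apply/eqP; rewrite eq_le dist_le // andbT.
apply: dist_ge; first by exists a0.
move=> b Ab; have [h|h] := leP (N (x - b)) (N (x - a0)); first exact: hmin.
by apply: le_trans (ltW h); exact: ha.
Qed.

Lemma dist_ge0 A x : A !=set0 -> 0 <= dist_g N A x.
Proof. by move=> A0; apply: dist_ge => // a _; exact: norm_ge0. Qed.

Lemma dist_mem A x : A x -> dist_g N A x = 0.
Proof.
move=> Ax; apply/eqP; rewrite eq_le dist_ge0 ?andbT; last by exists x.
by have := dist_le x Ax; rewrite subrr norm0.
Qed.

Lemma dist_gt0 A x : closed A -> A !=set0 -> ~ A x -> 0 < dist_g N A x.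
Proof.
move=> cA A0 nAx; have [a [Aa <-]] := dist_attained x cA A0.
rewrite (norm_gt0 hN) // subr_eq0; apply/eqP => e; apply: nAx; by rewrite e.
Qed.

Lemma dist_lip A x y : A !=set0 -> dist_g N A x <= dist_g N A y + N (x - y).
Proof.
move=> A0; rewrite -lerBlDr; apply: dist_ge => // a Aa.
rewrite lerBlDr addrC; apply: le_trans (dist_le x Aa) _.
by rewrite -[x - a](subrKA y) normD.
Qed.

Lemma dist_lip_abs A x y : A !=set0 -> `|dist_g N A x - dist_g N A y| <= N (x - y).
Proof.
move=> A0; rewrite ler_norml; apply/andP; split.
  by have := dist_lip y x A0; rewrite (norm_subC hN y); lra.
by have := dist_lip x y A0; lra.
Qed.

(** The part of [A] at distance at least [e] from [a] is closed and misses the only nearest point,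
    so it is strictly farther from [x] than [A] is; a small displacement of [x] does not close this
    gap. *)
Lemma proj_continuous A x a : closed A -> xi_g N A x a ->
  (forall b, xi_g N A x b -> b = a) ->
  forall e : R, 0 < e -> exists2 d : R, 0 < d &
    forall y b, enorm (y - x) < d -> xi_g N A y b -> enorm (b - a) < e.
Proof.
move=> cA [Aa xa] uniq e e0.
have A0 : A !=set0 by exists a.
pose A' := A `&` [set b | e <= enorm (b - a)].
have cA' : closed A'.
  apply: closedI => //; apply: enorm_closed => y /= /negP; rewrite -ltNge => hy.
  exists (e - enorm (y - a)); first by rewrite subr_gt0.
  move=> z hz; apply/negP; rewrite -ltNge.
  by have := enorm_dist z y a; lra.
have [A'0|/set0P/negP/negPn/eqP A'0] := pselect (A' !=set0); last first.
  exists 1 => // y b _ [Ab _]; rewrite ltNge; apply/negP => h.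
  have : A' b by split.
  by rewrite A'0.
have [a1 [[Aa1 ha1] hx1]] := dist_attained x cA' A'0.
have lt1 : dist_g N A x < N (x - a1).
  rewrite lt_neqAle dist_le // andbT; apply/eqP => h.
  have e1 : a1 = a by apply: uniq.
  by move: ha1; rewrite /= e1 subrr enorm0 leNgt e0.
exists ((N (x - a1) - dist_g N A x) / (2 * C)).
  by rewrite divr_gt0 ?mulr_gt0 // subr_gt0.
move=> y b; rewrite ltr_pdivlMr ?mulr_gt0 // => hy [Ab yb].
rewrite ltNge; apply/negP => h.
have A'b : A' b by split.
have := dist_le x A'b; rewrite -hx1.
have := normD hN (x - y) (y - b); rewrite subrKA yb.
have := dist_lip y x A0; rewrite (norm_subC hN y x).
have := hup (x - y); rewrite enormBC; lra.
Qed.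

Lemma dist_ray A a w (r s : R) : A a -> N w = 1 -> dist_g N A (a + r *: w) = r ->
  0 <= s -> s <= r -> dist_g N A (a + s *: w) = s.
Proof.
move=> Aa w1 hr s0 sr; apply/eqP; rewrite eq_le; apply/andP; split.
  by have := dist_le (a + s *: w) Aa; rewrite addrAKl normZ // w1 mulr1 ger0_norm.
have A0 : A !=set0 by exists a.
have := dist_lip (a + r *: w) (a + s *: w) A0.
have -> : a + r *: w - (a + s *: w) = (r - s) *: w by apply/rowP => i; rewrite !mxE; ring.
by rewrite hr normZ // w1 mulr1 ger0_norm ?subr_ge0 //; lra.
Qed.

End Distance.

(** * Prolonging Euclidean normals *)

Section Reach.
Context {R : realType} {n : nat}.
Notation V := 'rV[R]_(n.+1).
Implicit Types (u v w x y z a b p q : V).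
Context (A : set V) (cA : closed A).
Let eb := @enorm_between R n.

Lemma reach_unique : (0 < reach A)%E -> exists2 rho : R, 0 < rho &
  forall x a b, edist A x < rho -> xi_g enorm A x a -> xi_g enorm A x b -> a = b.
Proof.
move=> /ereal_sup_gt[_ [rho /= [rho0 H] <-]]; rewrite lte_fin => rp.
exists rho => // x a b hx [Aa ha] [Ab hb].
by have [c [_ [_ h]]] := H x hx; rewrite (h a) // (h b).
Qed.

Context (rho : R) (uniq : forall x a b, edist A x < rho ->
  xi_g enorm A x a -> xi_g enorm A x b -> a = b).

(* The farthest point from A in the ball of radius s around c + tau w lies on the ray,
   because there the distance increases exactly in the direction away from its
   nearest point. *)
Lemma ray_extend c w (tau s : R) : A c -> enorm w = 1 -> edist A (c + tau *: w) = tau ->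
  0 < s -> s < tau -> tau + s < rho -> edist A (c + (tau + s) *: w) = tau + s.
Proof.
move=> Ac w1 hx s0 st tr.
have A0 : A !=set0 by exists c.
set x := c + tau *: w in hx.
have lipd y z := dist_lip_abs eb y z A0.
have [||||y /= ys ymax] := @EVT_enorm R n [set y | enorm (y - x) <= s]
    (fun y => - edist A y) (enorm x + s).
- apply: enorm_closed => y /= /negP; rewrite -ltNge => hy.
  exists (enorm (y - x) - s); first by rewrite subr_gt0.
  move=> z hz; apply/negP; rewrite -ltNge.
  by have := enorm_dist y z x; rewrite (enormBC y z); lra.
- by exists x; rewrite /= subrr enorm0 ltW.
- by move=> y /= hy; have := enorm_rdist y x; lra.
- move=> y e _ e0; exists e => // z _ hz.
  rewrite (_ : _ - _ = - (edist A z - edist A y)); last by ring.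
  by rewrite normrN; exact: le_lt_trans (lipd z y) hz.
have dyx : tau <= edist A y.
  by rewrite -hx -lerN2; apply: ymax; rewrite /= subrr enorm0 ltW.
have dy2 : edist A y <= tau + s.
  by have := dist_lip eb y x A0; rewrite -/(edist A x) hx -/(edist A y); lra.
have yrho : edist A y < rho by lra.
have [b yb] := dist_attained eb y cA A0.
have yuniq b' : xi_g enorm A y b' -> b' = b by move=> h; exact: (uniq yrho).
have bcont := proj_continuous eb cA yb yuniq.
have [Ab dyb] := yb.
have [D Dd] : exists D, D = y - b by exists (y - b).
have [E Ed] : exists E, E = y - x by exists (y - x).
have nD : enorm D = edist A y by rewrite Dd.
(* First-order condition at the maximum. The nearest point [b'] of [y + t h] satisfies
   [h . (y - b') <= 0], as otherwise the distance would grow; uniqueness at [y] makes [b'] tend to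
   [b]. *)
have key h : (exists2 t0 : R, 0 < t0 & forall t, 0 < t -> t < t0 -> enorm (E + t *: h) <= s) ->
   dot h D <= 0.
  move=> [t0 t00 ht0]; apply: (@le0_eps _ _ (enorm h)) => e e0.
  have [d d0 hd] := bcont _ e0.
  have k0 : 0 < enorm h + 1 by rewrite ltr_wpDl ?enorm_ge0.
  pose t := Num.min (t0 / 2) (d / (2 * (enorm h + 1))).
  have tp : 0 < t by rewrite lt_min !divr_gt0 ?mulr_gt0.
  have tt0 : t < t0 by rewrite gt_min; apply/orP; left; lra.
  have td : t * enorm h < d.
    have : t <= d / (2 * (enorm h + 1)) by rewrite ge_min lexx orbT.
    move=> /(ler_wpM2r (enorm_ge0 h)) hh; apply: le_lt_trans hh _.
    rewrite mulrAC ltr_pdivrMr ?mulr_gt0 // ltr_pM2l //.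
    by have := enorm_ge0 h; lra.
  have inB := ht0 t tp tt0.
  have [b' [Ab' yb']] := dist_attained eb (y + t *: h) cA A0.
  have hb' : enorm (b' - b) < e.
    apply: (hd (y + t *: h)) => //.
    by rewrite addrAKl enormZ gtr0_norm.
  have m1 : edist A (y + t *: h) <= edist A y.
    rewrite -lerN2; apply: ymax; rewrite /= addrAC -Ed; exact: inB.
  have m2 : enorm (y + t *: h - b') ^+ 2 <= enorm (y - b') ^+ 2.
    rewrite ler_pXn2r ?nnegrE ?enorm_ge0 //.
    by apply: le_trans _ (le_trans m1 (dist_le eb y Ab')); rewrite yb'.
  have [D' eD] : exists D', D' = y - b' by exists (y - b').
  rewrite (addrAC y) -eD !enorm_sqr !(dotDl, dotDr, dotZl, dotZr) (dotC D' h) in m2.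
  have m3 : 2 * (t * dot h D') <= 0.
    have tth : 0 <= t * (t * dot h h).
      by apply: mulr_ge0; [exact: ltW|apply: mulr_ge0; [exact: ltW|exact: dot_ge0]].
    lra.
  have m4 : dot h D' <= 0 by move: m3; rewrite pmulr_rle0 // pmulr_rle0.
  have -> : dot h D = dot h D' + dot h (b' - b) by rewrite -dotDr eD Dd subrKA.
  have := dot_le h (b' - b).
  have := ler_wpM2l (enorm_ge0 h) (ltW hb'); lra.
have tau0 : 0 < tau by lra.
have Dp : 0 < enorm D by rewrite nD; lra.
have Es : enorm E = s.
  rewrite -Ed in ys; apply/eqP; rewrite eq_le ys /= leNgt; apply/negP => lt.
  have : dot D D <= 0.
    apply: key; exists ((s - enorm E) / enorm D); first by rewrite divr_gt0 ?subr_gt0.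
    move=> t tp; rewrite ltr_pdivlMr // => ht.
    by apply: le_trans (enormD _ _) _; rewrite enormZ gtr0_norm //; lra.
  by rewrite -enorm_sqr leNgt exprn_gt0.
have [e ed] : exists e, e = s^-1 *: E by exists (s^-1 *: E).
have Ee : E = s *: e by rewrite ed scalerA mulfV ?gt_eqF // scale1r.
have e1 : dot e e = 1.
  by rewrite -enorm_sqr ed enormZ Es gtr0_norm ?invr_gt0 // mulVf ?gt_eqF // expr1n.
have key2 h : dot h e < 0 -> dot h D <= 0.
  move=> he; apply: key.
  have hh : 0 < dot h h + 1 by rewrite ltr_wpDl ?dot_ge0.
  exists (- (2 * s * dot h e) / (dot h h + 1)).
    rewrite divr_gt0 // -mulrN pmulr_rgt0 ?oppr_gt0 //; lra.
  move=> t tp; rewrite ltr_pdivlMr // => ht.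
  rewrite -(@ler_pXn2r _ 2) ?nnegrE ?enorm_ge0 ?(ltW s0) // enorm_sqr Ee.
  rewrite !(dotDl, dotDr, dotZl, dotZr) e1 (dotC e h).
  have : t * (t * dot h h + t) < t * - (2 * s * dot h e) by rewrite ltr_pM2l //; lra.
  by have := mulr_gt0 tp tp; lra.
have De0 : 0 <= dot D e.
  have := key2 (- e); rewrite !dotNl e1 => /(_ ltac:(lra)); rewrite (dotC e); lra.
(* The part of [D] tangent to the sphere, pushed inwards by [k], is an admissible direction; letting
   [k] vanish shows that [D] is a multiple of [e]. *)
have DD : enorm D ^+ 2 <= dot D e ^+ 2.
  rewrite -subr_le0; apply: (@le0_eps _ _ (dot D e)) => k kp.
  have := key2 (D - dot D e *: e - k *: e).
  rewrite !(dotBl, dotZl) e1 => /(_ ltac:(lra)); rewrite (dotC e D) -enorm_sqr expr2; lra.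
have De : dot D e = enorm D.
  apply/eqP; rewrite eq_le; apply/andP; split.
    have := dot_le D e; have -> : enorm e = 1 by rewrite /enorm e1 sqrtr1.
    by rewrite mulr1.
  by rewrite -(@ler_pXn2r _ 2) ?nnegrE ?enorm_ge0.
have DE : D = enorm D *: e.
  apply/eqP; rewrite -subr_eq0; apply/eqP; apply: dot_eq0.
  rewrite !(dotBl, dotBr, dotZl, dotZr) e1 (dotC e D) De -enorm_sqr; ring.
have xb : x - b = (enorm D - s) *: e.
  rewrite scalerBl -DE -Ee Dd Ed; apply/rowP => i; rewrite !mxE; ring.
have nxb : enorm (x - b) = enorm D - s.
  rewrite xb enormZ; have -> : enorm e = 1 by rewrite /enorm e1 sqrtr1.
  by rewrite mulr1 ger0_norm //; lra.
have dD : enorm D = tau + s.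
  apply/eqP; rewrite eq_le nD dy2 /= -nD.
  by have := dist_le eb x Ab; rewrite -/(edist A x) hx nxb; lra.
(* Both lie at distance [tau] from [x], which has one nearest point; with [b = c] the direction [e]
   has to be [w]. *)
have bc : b = c.
  apply: (@uniq x); first by rewrite hx; lra.
    by split=> //; rewrite nxb dD -/(edist A x) hx; lra.
  split=> //; rewrite -/(edist A x) hx /x addrAKl enormZ w1 gtr0_norm //; lra.
have ew : e = w.
  move: xb; rewrite bc /x addrAKl dD addrK => /(congr1 (fun v => tau^-1 *: v)).
  by rewrite !scalerA mulVf ?gt_eqF // !scale1r.
have -> : c + (tau + s) *: w = y.
  by rewrite -ew -bc -dD -DE Dd addrC subrK.
by rewrite -nD.
Qed.

(** Each prolongation adds at most [r / 2], less than the length already attained, as [ray_extend]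
    requires; truncation at [t] ends the iteration exactly at the target. *)
Lemma ray_to_reach c w (r t : R) : A c -> enorm w = 1 -> 0 < r ->
  edist A (c + r *: w) = r -> 0 <= t -> t < rho -> edist A (c + t *: w) = t.
Proof.
move=> Ac w1 r0 hr t0 trho.
have step (k : nat) : edist A (c + Num.min (r + k%:R * (r / 2)) t *: w)
     = Num.min (r + k%:R * (r / 2)) t.
  elim: k => [|k IH].
    rewrite mul0r addr0; have [rt|tr] := leP r t; first exact: hr.
    exact: (dist_ray eb Ac w1 hr t0 (ltW tr)).
  set m := Num.min _ _ in IH; set m' := Num.min _ _.
  have m0 : 0 <= m.
    rewrite le_min t0 andbT; apply: addr_ge0; first exact: ltW.
    by apply: mulr_ge0 => //; apply: divr_ge0 => //; exact: ltW.
  have m'0 : 0 <= m'.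
    rewrite le_min t0 andbT; apply: addr_ge0; first exact: ltW.
    by apply: mulr_ge0 => //; apply: divr_ge0 => //; exact: ltW.
  have mt : m' < rho by apply: le_lt_trans trho; rewrite ge_min lexx orbT.
  have [le|lt] := leP m' m; first exact: (dist_ray eb Ac w1 IH m'0 le).
  have mE : m = r + k%:R * (r / 2).
    rewrite /m; case: leP => // ht; move: lt; rewrite /m (min_idPr (ltW ht)) /m'.
    by rewrite lt_min ltxx andbF.
  have kr : 0 <= k%:R * (r / 2).
    by apply: mulr_ge0 => //; apply: divr_ge0 => //; exact: ltW.
  have m'le : m' <= m + r / 2.
    by rewrite mE /m' ge_min -natr1 mulrDl mul1r addrA lexx.
  have := @ray_extend c w m (m' - m) Ac w1 IH.
  rewrite (addrC m) subrK; apply=> //; rewrite ?subr_gt0 //.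
  by move: mE m'le r0 kr; lra.
have k0 : 0 < r / 2 by rewrite divr_gt0.
have := step (Num.truncn (t / (r / 2))).+1.
suff -> : Num.min (r + (Num.truncn (t / (r / 2))).+1%:R * (r / 2)) t = t by [].
apply/min_idPr; apply: ler_wpDl; first exact: ltW.
by rewrite -ler_pdivrMr // ltW // truncnS_gt.
Qed.

End Reach.

(** * Anisotropic normals of a set of positive reach *)

Section PhiNormals.
Context {R : realType} {n : nat}.
Notation V := 'rV[R]_(n.+1).
Implicit Types (u v w x y z a b c p q : V).
Context (phi : V -> R) (hphi : admissible_norm phi).
Context (A : set V) (cA : closed A) (reachA : (0 < reach A)%E).
Notation g := (phistar phi).
Notation dual := (dualpair phi).
Notation delta := (dphi phi A).
Let gN : is_norm g := phistar_norm hphi.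

(** By strong duality the Wulff shape of radius [r] touching [A] at [c] contains a Euclidean ball of
    radius [r gam] touching there as well. So [p / |p|] is a Euclidean normal, positive reach
    prolongs it to length [rho / 2], and the empty ball of that radius is the quadratic
    inequality. *)
Lemma Nphi_prox : exists2 C : R, 0 < C & forall c w p q, Nphi phi A c w -> dual p w ->
  A q -> dot (q - c) p <= C * enorm (q - c) ^+ 2.
Proof.
have [rho rho0 uniq] := reach_unique reachA.
have [gam gam0 hs] := dualpair_strong hphi.
have [c' [C' [c0 C0 h1 h2 _]]] := phi_between hphi.
have [cg [Cg hb]] := phistar_between hphi.
exists (c'^-1 / rho); first by rewrite divr_gt0 ?invr_gt0.
move=> c w p q [Ac [/(bdWphiP hphi) gw [r [r0 hr]]]] pw Aq.
have [pp _ _] := pw.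
have p0 : 0 < enorm p by apply: enorm_gt0; have [] := dualpair_neq0 hphi pw.
have [e ed] : exists e, e = (enorm p)^-1 *: p by exists ((enorm p)^-1 *: p).
have e1 : enorm e = 1 by rewrite ed enormZ gtr0_norm ?invr_gt0 // mulVf // gt_eqF.
have A0 : A !=set0 by exists c.
have rg : 0 < r * gam by rewrite mulr_gt0.
have ball : edist A (c + (r * gam) *: e) = r * gam.
  apply/eqP; rewrite eq_le; apply/andP; split.
    have := dist_le (@enorm_between R n) (c + (r * gam) *: e) Ac.
    by rewrite addrAKl enormZ e1 mulr1 gtr0_norm.
  apply: dist_ge => // b Ab; rewrite leNgt; apply/negP => lt.
  have [z zd] : exists z, z = r^-1 *: (b - c) by exists (r^-1 *: (b - c)).
  have hz : enorm (gam *: e - z) < gam.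
    rewrite -(ltr_pM2l r0); apply: le_lt_trans lt.
    rewrite -{1}(gtr0_norm r0) -enormZ le_eqVlt; apply/orP; left; apply/eqP.
    by congr enorm; rewrite zd; apply/rowP => i; rewrite !mxE; field; rewrite gt_eqF.
  have gz : g (w - z) <= 1 - (gam - enorm (gam *: e - z)) / C'.
    apply: (phistar_le hphi) => v v1.
    have -> : dot v (w - z) = dot v w - gam * dot v e + dot v (gam *: e - z).
      by rewrite !dotBr dotZr; ring.
    have b1 := hs p w v pw; rewrite v1 in b1.
    have -> : dot v e = dot v p / enorm p by rewrite ed dotZr mulrC.
    have b2 := dot_le v (gam *: e - z).
    have b3 : C'^-1 <= enorm v.
      by rewrite -[leLHS]mul1r ler_pdivrMr // mulrC -v1.
    have b4 : 0 <= gam - enorm (gam *: e - z) by rewrite subr_ge0 ltW.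
    have b5 := ler_wpM2l b4 b3.
    lra.
  have : g (c + r *: w - b) < r.
    have -> : c + r *: w - b = r *: (w - z).
      by rewrite zd; apply/rowP => i; rewrite !mxE; field; rewrite gt_eqF.
    rewrite (normZ gN) gtr0_norm // -[ltRHS]mulr1 ltr_pM2l //.
    apply: le_lt_trans gz _; rewrite ltrBlDr ltrDl divr_gt0 // subr_gt0 //.
  have := dist_le hb (c + r *: w) Ab; rewrite -/(dphi phi A _) hr; lra.
have rho2 : 0 < rho / 2 by rewrite divr_gt0.
have far : edist A (c + (rho / 2) *: e) = rho / 2.
  by apply: (ray_to_reach cA uniq Ac e1 rg ball); lra.
have := dist_le (@enorm_between R n) (c + (rho / 2) *: e) Aq.
rewrite -/(edist A _) far.
have -> : c + (rho / 2) *: e - q = (rho / 2) *: e - (q - c).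
  by apply/rowP => i; rewrite !mxE; ring.
move: (q - c) => k.
rewrite -(@ler_pXn2r _ 2) ?nnegrE ?enorm_ge0 ?(ltW rho2) // [leRHS]enorm_sqr.
rewrite !(dotBl, dotBr, dotZl, dotZr) -!enorm_sqr e1 (dotC e k) => H.
have H2 : rho * dot k e <= enorm k ^+ 2 by lra.
have -> : dot k p = enorm p * dot k e by rewrite ed dotZr mulrA mulfV ?mul1r // gt_eqF.
have pc : enorm p <= c'^-1.
  by rewrite -[leRHS]mul1r ler_pdivlMr // mulrC -pp.
have H3 : dot k e <= enorm k ^+ 2 / rho by rewrite ler_pdivlMr // mulrC.
apply: le_trans (ler_wpM2l (ltW p0) H3) _.
have -> : c'^-1 / rho * enorm k ^+ 2 = c'^-1 * (enorm k ^+ 2 / rho) by ring.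
by apply: ler_wpM2r pc; apply: divr_ge0; [exact: sqr_ge0|exact: ltW].
Qed.

(** For a point [q] of [A] closer than [t], roundness of the Wulff shape gives
    [k |q - c|^2 <= t (q - c) . p], and the proximal inequality bounds the right side by
    [t C |q - c|^2]. With [t <= k / (2 C)] only [q = c] remains. *)
Lemma Nphi_extend : exists2 rho : R, 0 < rho & forall c w (t : R), Nphi phi A c w ->
  0 <= t -> t <= rho -> delta (c + t *: w) = t.
Proof.
have [C C0 hC] := Nphi_prox; have [k k0 hk] := wulff_round hphi.
have [cg [Cg hb]] := phistar_between hphi.
exists (k / (2 * C)) => [|c w t ncw]; first by rewrite divr_gt0 ?mulr_gt0.
rewrite le_eqVlt => /orP[/eqP <- _|t0 ht]; have [Ac [/(bdWphiP hphi) gw _]] := ncw.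
  by rewrite scale0r addr0; exact: (dist_mem hb).
apply/eqP; rewrite eq_le; apply/andP; split.
  by have := dist_le hb (c + t *: w) Ac; rewrite addrAKl (normZ gN) gw mulr1 gtr0_norm.
apply: dist_ge => [|q Aq]; first by exists c.
rewrite leNgt; apply/negP => lt.
pose z := t^-1 *: (c + t *: w - q).
have gz : g z <= 1.
  rewrite (normZ gN) gtr0_norm ?invr_gt0 // mulrC ler_pdivrMr // mul1r; exact: ltW.
have wz : w - z = t^-1 *: (q - c).
  by rewrite /z; apply/rowP => i; rewrite !mxE; field; rewrite gt_eqF.
have [p pw] := dualpair_exists hphi gw.
have h1 := hk p w z pw gz; have h2 := hC c w p q ncw pw Aq.
rewrite wz enormZ dotZl gtr0_norm ?invr_gt0 // in h1.
have h3 : k * enorm (q - c) ^+ 2 <= t * (C * enorm (q - c) ^+ 2).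
  have : k * (t^-1 * enorm (q - c)) ^+ 2 <= t^-1 * (C * enorm (q - c) ^+ 2).
    by apply: le_trans h1 _; rewrite ler_wpM2l // invr_ge0 ltW.
  move=> /(ler_wpM2l (sqr_ge0 t)).
  have -> : t ^+ 2 * (k * (t^-1 * enorm (q - c)) ^+ 2) = k * enorm (q - c) ^+ 2.
    by field; rewrite gt_eqF.
  have -> : t ^+ 2 * (t^-1 * (C * enorm (q - c) ^+ 2)) = t * (C * enorm (q - c) ^+ 2).
    by field; rewrite gt_eqF.
  by [].
have h4 : t * C <= k / 2.
  by move: ht; rewrite ler_pdivlMr ?mulr_gt0 //; lra.
have h5 : k / 2 * enorm (q - c) ^+ 2 <= 0.
  by have := ler_wpM2r (sqr_ge0 (enorm (q - c))) h4; lra.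
have e0 : q - c = 0.
  apply: enorm_eq0; apply/eqP; rewrite -sqrf_eq0 eq_le sqr_ge0 andbT.
  by move: h5; rewrite pmulr_rle0 // divr_gt0.
have qc : q = c by apply/eqP; rewrite -subr_eq0 e0.
by move: lt; rewrite qc addrAKl (normZ gN) gw mulr1 gtr0_norm // ltxx.
Qed.

End PhiNormals.

(** * Foot points and directions in a tube around the set *)

Section Tube.
Context {R : realType} {n : nat}.
Notation V := 'rV[R]_(n.+1).
Implicit Types (u v w x y z a b c p q : V).
Context (phi : V -> R) (hphi : admissible_norm phi).
Context (A : set V) (cA : closed A).
Notation g := (phistar phi).
Notation dual := (dualpair phi).
Notation delta := (dphi phi A).
Let gN : is_norm g := phistar_norm hphi.

(** Strict convexity of the Wulff shape: equality makes [nor (x + y)] a conormal at both normalized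
    points, and differentiability of [phi] allows one point per conormal. *)
Lemma star_strict x y : x != 0 -> y != 0 -> g (x + y) = g x + g y ->
  (g x)^-1 *: x = (g y)^-1 *: y.
Proof.
move=> x0 y0 e.
have gx := norm_gt0 gN x0; have gy := norm_gt0 gN y0.
have xy0 : x + y != 0 by apply: (norm_neq0 gN); rewrite e addr_gt0.
have := nor_dot hphi xy0; rewrite e dotDr => e2.
have hx := nor_le hphi x xy0; have hy := nor_le hphi y xy0.
have pp := nor_phi hphi xy0.
have d1 z : 0 < g z -> dot (nor phi (x + y)) z = g z -> dual (nor phi (x + y)) ((g z)^-1 *: z).
  move=> gz ez; split=> //; last by rewrite dotZr ez mulVf // gt_eqF.
  by rewrite (normZ gN) gtr0_norm ?invr_gt0 // mulVf // gt_eqF.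
by apply: (dualpair_sym_uniq hphi (d1 x gx _) (d1 y gy _)); lra.
Qed.

Lemma delta_le x c : A c -> delta x <= g (x - c).
Proof. by have [cg [Cg hb]] := phistar_between hphi; exact: dist_le hb _ _ _. Qed.

Lemma delta_lip x y : A !=set0 -> `|delta x - delta y| <= g (x - y).
Proof. by have [cg [Cg hb]] := phistar_between hphi; exact: dist_lip_abs hb _ _ _. Qed.

Lemma delta_gt0 x : A !=set0 -> ~ A x -> 0 < delta x.
Proof. by have [cg [Cg hb]] := phistar_between hphi => A0; exact: dist_gt0 hb _ _ cA A0. Qed.

Lemma delta_gt0_notin x : 0 < delta x -> ~ A x.
Proof.
have [cg [Cg hb]] := phistar_between hphi => h /(dist_mem hb) e.
by move: h; rewrite /dphi e ltxx.
Qed.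

Lemma nuphi_exists x : A !=set0 -> exists w, nuphi phi A x w.
Proof.
have [cg [Cg hb]] := phistar_between hphi => A0.
have [c hc] := dist_attained hb x cA A0.
by exists ((delta x)^-1 *: (x - c)), c.
Qed.

Lemma nuphiP x w : 0 < delta x -> nuphi phi A x w ->
  [/\ A (x - delta x *: w), g w = 1 & Nphi phi A (x - delta x *: w) w].
Proof.
move=> d0 [c [Ac hc] <-]; rewrite -/(delta x) in hc *.
have e : x - delta x *: ((delta x)^-1 *: (x - c)) = c.
  by rewrite scalerA mulfV ?gt_eqF // scale1r subKr.
have g1 : g ((delta x)^-1 *: (x - c)) = 1.
  by rewrite (normZ gN) gtr0_norm ?invr_gt0 // hc mulVf // gt_eqF.
rewrite e; split=> //; split=> //; split; first exact/(bdWphiP hphi).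
exists (delta x); split=> //.
by rewrite -{1}e subrK.
Qed.

Lemma nuphi_mem c w (r : R) : 0 < r -> A c -> g w = 1 -> delta (c + r *: w) = r ->
  nuphi phi A (c + r *: w) w.
Proof.
move=> r0 Ac gw h; exists c; last by rewrite -/(delta _) h addrAKl scalerA mulVf ?gt_eqF // scale1r.
by split=> //; rewrite -/(delta _) h addrAKl (normZ gN) gw mulr1 gtr0_norm.
Qed.

(** A second foot [b] of an interior point of the ray would turn the triangle inequality at the end
    of the ray into an equality, so both directions agree by [star_strict]. *)
Lemma ray_proj_unique c w b (r s : R) : A c -> g w = 1 -> delta (c + r *: w) = r ->
  0 < s -> s < r -> xiphi phi A (c + s *: w) b -> b = c.
Proof.
move=> Ac gw hr s0 sr [Ab]; rewrite -/(delta _).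
have [cg [Cg hb]] := phistar_between hphi.
rewrite /dphi (dist_ray hb Ac gw hr (ltW s0) (ltW sr)) => hs.
pose z := c + s *: w - b; rewrite -/z in hs.
have w0 : (r - s) *: w != 0.
  by rewrite scaler_eq0 negb_or gt_eqF ?subr_gt0 //=; apply: (norm_neq0 gN); rewrite gw.
have z0 : z != 0 by apply: (norm_neq0 gN); rewrite hs.
have gr : g ((r - s) *: w) = r - s by rewrite (normZ gN) gw mulr1 gtr0_norm // subr_gt0.
have zr : c + r *: w - b = (r - s) *: w + z.
  by rewrite /z; apply/rowP => i; rewrite !mxE; ring.
have e : g ((r - s) *: w + z) = g ((r - s) *: w) + g z.
  apply/eqP; rewrite eq_le (normD gN) /= gr hs subrK -zr -{1}hr; exact: delta_le.
have := star_strict w0 z0 e; rewrite gr hs scalerA mulVf ?gt_eqF ?subr_gt0 // scale1r.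
move=> /(congr1 (fun v => s *: v)); rewrite scalerA mulfV ?gt_eqF // scale1r /z => e2.
apply/eqP; rewrite -subr_eq0; apply/eqP.
have -> : b - c = s *: w - (c + s *: w - b) by apply/rowP => i; rewrite !mxE; ring.
by rewrite -e2 subrr.
Qed.

Lemma ray_nu_unique c w w' (r s : R) : A c -> g w = 1 -> delta (c + r *: w) = r ->
  0 < s -> s < r -> nuphi phi A (c + s *: w) w' -> w' = w.
Proof.
move=> Ac gw hr s0 sr [b hb' <-]; rewrite (ray_proj_unique Ac gw hr s0 sr hb') -/(delta _).
have [cg [Cg hb]] := phistar_between hphi.
rewrite /dphi (dist_ray hb Ac gw hr (ltW s0) (ltW sr)).
by rewrite addrAKl scalerA mulVf ?gt_eqF // scale1r.
Qed.

Context (reachA : (0 < reach A)%E).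

(** The displacement [Zv] is tested against [p - p']. Roundness contributes at least [2 k s W^2],
    the foot points at least [- 2 C S^2], where [S <= B Z + s W]. For [t <= k / (8 C)] the resulting
    term in [s^2 W^2] is absorbed and [W] is bounded by a multiple of [Z]; [t <= rho / 2] keeps
    heights up to [2 t] within the range of [Nphi_extend]. *)
Lemma nu_lipschitz : exists2 t0 : R, 0 < t0 & forall t : R, 0 < t -> t <= t0 ->
  exists2 K : R, 0 < K & forall c w c' w' (s s' : R), Nphi phi A c w -> Nphi phi A c' w' ->
    t / 2 <= s -> s <= 2 * t -> t / 2 <= s' -> s' <= 2 * t ->
    enorm (w - w') <= K * enorm (c + s *: w - (c' + s' *: w')).
Proof.
have [C C0 hC] := Nphi_prox hphi cA reachA.
have [rho rho0 hrho] := Nphi_extend hphi cA reachA.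
have [k k0 hk] := wulff_round hphi.
have [K4 K40 hK4] := dual_lipschitz hphi.
have [cg [Cg hb]] := phistar_between hphi; have [cg0 Cg0 h1 h2 _] := hb.
exists (Num.min (rho / 2) (k / (8 * C))); first by rewrite lt_min !divr_gt0 ?mulr_gt0.
move=> t tp; rewrite le_min => /andP[t1 t2].
have tC : 8 * C * t <= k by move: t2; rewrite ler_pdivlMr ?mulr_gt0 //; lra.
pose M := cg^-1; have M0 : 0 < M by rewrite invr_gt0.
have CM0 : 0 < Cg * M by rewrite mulr_gt0.
pose B := 1 + Cg * M; have B0 : 0 < B by rewrite addr_gt0.
pose E := K4 * B + 4 * C * B ^+ 2.
have E0 : 0 < E by rewrite addr_gt0 ?mulr_gt0 ?exprn_gt0.
have EK : 0 < 2 * E / (k * t) by rewrite divr_gt0 ?mulr_gt0.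
exists (1 + 2 * E / (k * t)); first by rewrite addr_gt0.
move=> c w c' w' s s' Ncw Ncw' s1 s2 s1' s2'.
have [Ac [/(bdWphiP hphi) gw _]] := Ncw; have [Ac' [/(bdWphiP hphi) gw' _]] := Ncw'.
have [p pw] := dualpair_exists hphi gw; have [p' pw'] := dualpair_exists hphi gw'.
have sp : 0 < s by lra.
have ds : delta (c + s *: w) = s by apply: hrho => //; lra.
have ds' : delta (c' + s' *: w') = s' by apply: hrho => //; lra.
set Zv := c + s *: w - (c' + s' *: w').
have eq_le1 v : g v = 1 -> g v <= 1 by move=> ->.
pose Z := enorm Zv; pose W := enorm (w - w').
have Z0 : 0 <= Z := enorm_ge0 _; have W0 : 0 <= W := enorm_ge0 _.
have ss : `|s - s'| <= Cg * Z.
  rewrite -{1}ds -{1}ds'; apply: le_trans (delta_lip _ _ _) (h2 _).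
  by exists c.
have wM : enorm w' <= M.
  by rewrite /M -[leRHS]mulr1 mulrC ler_pdivlMr // mulrC -gw'.
have r1 := hk _ _ _ pw (eq_le1 _ gw'); have r2 := hk _ _ _ pw' (eq_le1 _ gw).
have x1 := hC _ _ _ _ Ncw pw Ac'; have x2 := hC _ _ _ _ Ncw' pw' Ac.
rewrite (enormBC w') -/W in r2; rewrite -/W in r1; rewrite (enormBC c') in x1.
have pp := hK4 _ _ _ _ pw pw'; rewrite -/W in pp.
pose S := enorm (c - c'); rewrite -/S in x1 x2.
have S0 : 0 <= S := enorm_ge0 _.
have SB : S <= B * Z + s * W.
  have -> : S = enorm (Zv - s *: (w - w') - (s - s') *: w').
    by congr enorm; rewrite /Zv; apply/rowP => i; rewrite !mxE; ring.
  apply: le_trans (enormB _ _) _; apply: le_trans (lerD (enormB _ _) (lexx _)) _.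
  rewrite !enormZ (gtr0_norm sp) -/Z -/W /B.
  have := ler_pM (normr_ge0 _) (enorm_ge0 _) ss wM; lra.
have SS : S ^+ 2 <= 2 * B ^+ 2 * Z ^+ 2 + 2 * s ^+ 2 * W ^+ 2.
  have : S ^+ 2 <= (B * Z + s * W) ^+ 2.
    by rewrite ler_pXn2r ?nnegrE // addr_ge0 ?mulr_ge0 ?(ltW B0) ?(ltW sp).
  have := sqr_ge0 (B * Z - s * W).
  rewrite (_ : (B * Z - s * W) ^+ 2 = B ^+ 2 * Z ^+ 2 - 2 * B * Z * s * W + s ^+ 2 * W ^+ 2); last by ring.
  rewrite (_ : (B * Z + s * W) ^+ 2 = B ^+ 2 * Z ^+ 2 + 2 * B * Z * s * W + s ^+ 2 * W ^+ 2); last by ring.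
  lra.
have dotZ : dot Zv (p - p') <= Z * (K4 * W).
  by apply: le_trans (dot_le _ _) _; rewrite ler_wpM2l.
have dotw : - (Cg * Z * M * (K4 * W)) <= (s - s') * dot w' (p - p').
  have : `|(s - s') * dot w' (p - p')| <= Cg * Z * M * (K4 * W).
    rewrite normrM -mulrA; apply: ler_pM => //.
    apply: le_trans (cauchy_schwarz _ _) _; apply: ler_pM => //; exact: enorm_ge0.
  by rewrite ler_norml => /andP[].
have Zexp : dot Zv (p - p') = dot (c - c') (p - p') + s * dot (w - w') (p - p')
     + (s - s') * dot w' (p - p').
  rewrite -!dotZl -!dotDl; congr dot.
  by rewrite /Zv; apply/rowP => i; rewrite !mxE; ring.
have y1 : dot (c - c') (p - p') >= - (2 * C * S ^+ 2).
  by move: x1 x2; rewrite !(dotBl, dotBr); lra.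
have y2 : 2 * k * W ^+ 2 <= dot (w - w') (p - p').
  by move: r1 r2; rewrite !(dotBl, dotBr); lra.
have y3 := ler_wpM2l (ltW sp) y2.
have main : k * s * W ^+ 2 <= K4 * B * Z * W + 4 * C * B ^+ 2 * Z ^+ 2.
  have q1 : 2 * C * S ^+ 2 <= 2 * C * (2 * B ^+ 2 * Z ^+ 2 + 2 * s ^+ 2 * W ^+ 2).
    by rewrite ler_wpM2l // mulr_ge0 // ltW.
  have q2 : 4 * C * s * (s * W ^+ 2) <= k * (s * W ^+ 2).
    rewrite ler_wpM2r ?mulr_ge0 ?sqr_ge0 ?(ltW sp) //.
    have q3 : 4 * C * s <= 4 * C * (2 * t).
      by apply: ler_wpM2l s2; apply: mulr_ge0 => //; exact: ltW.
    lra.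
  have BE : K4 * B * Z * W = Z * (K4 * W) + Cg * Z * M * (K4 * W) by rewrite /B; ring.
  by rewrite BE; move: dotZ; rewrite Zexp; lra.
have main2 : k * t / 2 * W ^+ 2 <= K4 * B * Z * W + 4 * C * B ^+ 2 * Z ^+ 2.
  apply: le_trans main; rewrite ler_wpM2r ?sqr_ge0 // -mulrA ler_pM2l //.
rewrite -/W -/Z leNgt; apply/negP => lt.
have kt : 0 < k * t by rewrite mulr_gt0.
have l1 : 2 * E * Z < k * t * W.
  have EZ : 0 <= k * t * Z by rewrite mulr_ge0 // ltW.
  move: lt; rewrite -(ltr_pM2l kt).
  have -> : k * t * ((1 + 2 * E / (k * t)) * Z) = k * t * Z + 2 * E * Z.
    by field; rewrite !gt_eqF.
  lra.
have ZW : Z <= W.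
  have q0 : 0 <= 2 * E / (k * t) * Z by rewrite mulr_ge0 // ltW.
  by move: lt; lra.
have Wp : 0 < W.
  have q0 : 0 <= 2 * E / (k * t) * Z by rewrite mulr_ge0 // ltW.
  by move: lt; lra.
have l2 : K4 * B * Z * W + 4 * C * B ^+ 2 * Z ^+ 2 <= E * Z * W.
  rewrite /E.
  have : 4 * C * B ^+ 2 * Z * Z <= 4 * C * B ^+ 2 * Z * W.
    by rewrite ler_wpM2l // !mulr_ge0 // ?sqr_ge0 // ltW.
  by lra.
have l3 : 2 * E * Z * W < k * t * W * W by rewrite ltr_pM2r.
by lra.
Qed.

End Tube.

(** * The derivative of the normal direction *)

Section NormalDerivative.
Context {R : realType} {n : nat}.
Notation V := 'rV[R]_(n.+1).
Implicit Types (u v w x y z b c p q k : V).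
Context (phi : V -> R) (hphi : admissible_norm phi).
Context (A : set V) (cA : closed A).
Notation g := (phistar phi).
Notation dual := (dualpair phi).
Notation delta := (dphi phi A).
Let gN : is_norm g := phistar_norm hphi.

(** Nearest points may fail to be unique arbitrarily close to a point of differentiability, so a
    single-valued supergradient field needs a selection. *)
Definition nu_choice y : V := xget 0 (nuphi phi A y).

Lemma nu_choiceP y : A !=set0 -> nuphi phi A y (nu_choice y).
Proof.
move=> A0; rewrite /nu_choice; case: xgetP => // h.
by have [w hw] := nuphi_exists hphi cA y A0; have := h w hw.
Qed.

(** [delta] lies below the translate of [g] centred at the foot of [y] and meets it at [y], so it
    inherits the semiconcavity of [g]; the constant is uniform while [delta] stays above half of
    [delta x]. *)
Lemma delta_semiconcave x : A !=set0 -> 0 < delta x -> exists2 C : R, 0 <= C &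
  exists2 rho : R, 0 < rho & forall y y', enorm (y - x) < rho -> enorm (y' - x) < rho ->
    delta y' - delta y <= dot (nor phi (nu_choice y)) (y' - y) + C * enorm (y' - y) ^+ 2.
Proof.
move=> A0 dx; have [K K0 hK] := star_semiconcave hphi.
have [cg [Cg hb]] := phistar_between hphi; have [cg0 Cg0 h1 h2 _] := hb.
exists (K * (2 / delta x)); first by rewrite mulr_ge0 ?divr_ge0 // ltW.
exists (delta x / (2 * Cg)); first by rewrite divr_gt0 ?mulr_gt0.
move=> y y' hy _.
have a1 := le_trans (delta_lip hphi y x A0) (h2 _).
have a2 : Cg * enorm (y - x) < delta x / 2.
  by move: hy; rewrite ltr_pdivlMr ?mulr_gt0 //; lra.
have a3 : delta x / 2 < delta y by move: a1; rewrite ler_norml => /andP[]; lra.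
have dy : 0 < delta y by lra.
have := nu_choiceP y A0; set w := nu_choice y => hw.
have [Ac gw Ncw] := nuphiP hphi dy hw.
pose c := y - delta y *: w.
have yc : y - c = delta y *: w by rewrite /c subKr.
have gyc : g (y - c) = delta y by rewrite yc (normZ gN) gw mulr1 gtr0_norm.
have yc0 : y - c != 0 by apply: (norm_neq0 gN); rewrite gyc.
have [p pw] := dualpair_exists hphi gw.
have nn : nor phi (y - c) = nor phi w.
  by rewrite yc (nor_eq hphi dy pw) -[w]scale1r (nor_eq hphi ltr01 pw).
have := hK (y - c) (y' - c) yc0; rewrite gyc nn.
have -> : y' - c - (y - c) = y' - y by apply/rowP => i; rewrite !mxE; ring.
have := delta_le hphi y' Ac; rewrite -/c => b1 b2.
have b3 : K * enorm (y' - y) ^+ 2 / delta y <= K * (2 / delta x) * enorm (y' - y) ^+ 2.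
  rewrite mulrAC; apply: ler_wpM2r; first exact: sqr_ge0.
  rewrite ler_pM2l // -[2 / _]invrK lef_pV2 ?posrE ?invr_gt0 ?divr_gt0 // invf_div; lra.
lra.
Qed.

Section AtPoint.
Context (a eta p0 : V) (r : R) (L Q : 'M[R]_n.+1).
Hypothesis Aa : A a.
Hypothesis r0 : 0 < r.
Hypothesis delta_r : delta (a + r *: eta) = r.
Hypothesis dp0 : dual p0 eta.
Hypothesis Qpos : forall x, x != 0 -> 0 < dot (x *m Q) x.
Hypothesis etaQ : eta *m Q = p0.
Hypothesis diffQ : forall e : R, 0 < e -> exists2 d : R, 0 < d & forall p w, dual p w ->
  enorm (w - eta) < d -> enorm (p - p0 - (w - eta) *m Q) <= e * enorm (w - eta).
Hypothesis hL : Dnu_is phi A (a + r *: eta) L.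

Notation x := (a + r *: eta).
Let A0 : A !=set0. Proof. by exists a. Qed.
Let ge : g eta = 1. Proof. by case: dp0. Qed.
Let pe : dot p0 eta = 1. Proof. by case: dp0. Qed.

Lemma nu_at : nuphi phi A x = [set eta].
Proof.
have [_ [v0 [e _]]] := hL; rewrite e.
have : nuphi phi A x eta by apply: (nuphi_mem hphi).
by rewrite e => ->.
Qed.

Lemma delta_near_gt0 : exists2 d : R, 0 < d & forall y, enorm (y - x) < d -> 0 < delta y.
Proof.
have [cg [Cg hb]] := phistar_between hphi; have [cg0 Cg0 h1 h2 _] := hb.
exists (r / Cg) => [|y]; first by rewrite divr_gt0.
rewrite ltr_pdivlMr // => hy.
have := le_trans (delta_lip hphi y x A0) (h2 _).
by rewrite delta_r ler_norml => /andP[]; lra.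
Qed.

Lemma nu_diff (e : R) : 0 < e -> exists2 d : R, 0 < d & forall y w, enorm (y - x) < d ->
  nuphi phi A y w -> [/\ 0 < delta y, g w = 1, Nphi phi A (y - delta y *: w) w &
     enorm (w - eta - (y - x) *m L) <= e * enorm (y - x)].
Proof.
move=> e0; have [_ [v0 [ev H]]] := hL.
have v0e : v0 = eta.
  have : [set v0] eta by rewrite -ev; apply: (nuphi_mem hphi).
  by move=> /= ->.
have [d [d0 hd]] := H e e0; have [d1 d10 hd1] := delta_near_gt0.
exists (Num.min d d1); first by rewrite lt_min d0.
move=> y w; rewrite lt_min => /andP[y1 y2] hw.
have dy := hd1 y y2; have [_ gw Nw] := nuphiP hphi dy hw.
rewrite v0e in hd; split=> //; apply: hd hw => //.
exact (delta_gt0_notin hphi dy).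
Qed.

Lemma nu_lin_bound : exists2 M : R, 0 < M & exists2 d : R, 0 < d & forall y w,
  enorm (y - x) < d -> nuphi phi A y w -> enorm (w - eta) <= M * enorm (y - x).
Proof.
have [M M0 hM] := mulmx_bound L; have [d d0 hd] := nu_diff (@ltr01 R).
exists (M + 1); first by rewrite addr_gt0.
exists d => // y w hy hw; have [_ _ _ h] := hd y w hy hw.
rewrite -[w - eta](subrK ((y - x) *m L)); apply: le_trans (enormD _ _) _.
rewrite mulrDl addrC; apply: lerD => //; exact: hM.
Qed.

Lemma nor_nu_diff (e : R) : 0 < e -> exists2 d : R, 0 < d & forall y, enorm (y - x) < d ->
  enorm (nor phi (nu_choice y) - p0 - (y - x) *m (L *m Q)) <= e * enorm (y - x).
Proof.
move=> e0; have [M M0 [d d0 hd]] := nu_lin_bound.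
have [MQ MQ0 hMQ] := mulmx_bound Q.
have [d1 d10 hd1] := @nu_diff (e / (2 * MQ)) ltac:(by rewrite divr_gt0 ?mulr_gt0).
have [d2 d20 hd2] := @diffQ (e / (2 * M)) ltac:(by rewrite divr_gt0 ?mulr_gt0).
exists (Num.min (Num.min d d1) (d2 / M)); first by rewrite !lt_min d0 d10 divr_gt0.
move=> y; rewrite !lt_min => /andP[/andP[y1 y2] y3].
have hw := nu_choiceP y A0; set w := nu_choice y in hw *.
have [_ gw _ h1] := hd1 y w y2 hw.
have h2 := hd y w y1 hw.
have [p pw] := dualpair_exists hphi gw.
have -> : nor phi w = p by rewrite -[w]scale1r (nor_eq hphi ltr01 pw).
have h3 := hd2 p w pw (le_lt_trans h2 _).
have {}h3 : enorm (p - p0 - (w - eta) *m Q) <= e / (2 * M) * enorm (w - eta).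
  by apply: h3; rewrite mulrC -ltr_pdivlMr.
move: h1 h2 h3; move: (y - x) (w - eta) => k W h1 h2 h3.
have -> : p - p0 - k *m (L *m Q) = (p - p0 - W *m Q) + (W - k *m L) *m Q.
  by rewrite (mulmxBl W) mulmxA [RHS]addrA subrK.
apply: le_trans (enormD _ _) _.
have q1 : e / (2 * M) * enorm W <= e / 2 * enorm k.
  apply: le_trans (ler_wpM2l _ h2) _; first by rewrite divr_ge0 ?mulr_ge0 ?(ltW e0) ?(ltW M0).
  by rewrite le_eqVlt; apply/orP; left; apply/eqP; field; rewrite gt_eqF.
have q2 : enorm ((W - k *m L) *m Q) <= e / 2 * enorm k.
  apply: le_trans (hMQ _) _; apply: le_trans (ler_wpM2l (ltW MQ0) h1) _.
  by rewrite le_eqVlt; apply/orP; left; apply/eqP; field; rewrite gt_eqF.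
lra.
Qed.

Lemma delta_expansion (e : R) : 0 < e -> exists2 d : R, 0 < d & forall v, enorm v < d ->
  `|delta (x + v) - r - dot v p0 - dot (v *m (L *m Q)) v / 2| <= e * enorm v ^+ 2.
Proof.
move=> e0; have dx : 0 < delta x by rewrite delta_r.
have [C C0 [rho rho0 hsc]] := delta_semiconcave A0 dx.
have [d d0 hd] := second_order_expansion rho0 hsc nor_nu_diff e0.
exists d => // v hv; have := hd 0 v; rewrite enorm0 => /(_ d0 hv).
by rewrite addr0 add0r mul0mx dot0l addr0 delta_r (dotC p0) opprD addrA.
Qed.

Lemma LQ_sym u v : dot (u *m (L *m Q)) v = dot (v *m (L *m Q)) u.
Proof.
have dx : 0 < delta x by rewrite delta_r.
have [C C0 [rho rho0 hsc]] := delta_semiconcave A0 dx.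
exact: (second_order_sym rho0 hsc nor_nu_diff).
Qed.

(** Directions stay on the boundary of the Wulff shape, where [(w - eta) . p0] is of second order:
    [w . p0] and [p . eta] are both at most 1, so it is controlled by [(p - p0) . (w - eta)]. *)
Lemma derivative_tangent v : dot (v *m L) p0 = 0.
Proof.
have [K K0 hK] := dual_lipschitz hphi.
have [M M0 [d d0 hd]] := nu_lin_bound.
have ep : 0 < enorm p0 by apply: enorm_gt0; have [] := dualpair_neq0 hphi dp0.
suff h u : dot (u *m L) p0 <= 0.
  by apply/eqP; rewrite eq_le h /=; have := h (- v); rewrite mulNmx dotNl oppr_le0.
apply: (@le0_eps _ _ (enorm u)) => e e0.
have [d1 d10 hd1] := @nu_diff (e / (2 * enorm p0)) ltac:(by rewrite divr_gt0 ?mulr_gt0).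
have k0 : 0 < enorm u + 1 by rewrite ltr_wpDl ?enorm_ge0.
pose d' := Num.min (Num.min d d1) (e / (2 * K * M ^+ 2)).
have d'0 : 0 < d' by rewrite !lt_min d0 d10 divr_gt0 ?mulr_gt0 ?exprn_gt0.
pose t := d' / (2 * (enorm u + 1)).
have t0 : 0 < t by rewrite divr_gt0 ?mulr_gt0.
have tu : enorm (t *: u) < d'.
  rewrite enormZ (gtr0_norm t0) /t mulrAC ltr_pdivrMr ?mulr_gt0 // ltr_pM2l //.
  by have := enorm_ge0 u; lra.
have := tu; rewrite !lt_min => /andP[/andP[u1 u2] u3].
pose y := x + t *: u.
have yx : y - x = t *: u by rewrite /y addrAKl.
have [w hw] := nuphi_exists hphi cA y A0.
have [_ gw _ h1] := hd1 y w ltac:(by rewrite yx) hw.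
have h2 := hd y w ltac:(by rewrite yx) hw.
rewrite yx in h1 h2.
have [p pw] := dualpair_exists hphi gw.
have h3 := hK _ _ _ _ pw dp0.
have b1 : dot w p0 <= 1 by rewrite dotC -gw; exact: (dualpair_lestar hphi w dp0).
have h4 : `|dot (w - eta) p0| <= K * enorm (w - eta) ^+ 2.
  have b2 : dot p eta <= 1 by rewrite -ge; exact: (dualpair_lestar hphi eta pw).
  have := le_trans (dot_le (p - p0) (w - eta)) (ler_wpM2r (enorm_ge0 _) h3).
  have [_ _ pw1] := pw.
  rewrite !(dotBl, dotBr) pw1 (dotC eta) pe (dotC p0 w) -mulrA -expr2 => b3.
  have : 0 <= K * enorm (w - eta) ^+ 2 by rewrite mulr_ge0 ?sqr_ge0 // ltW.
  by rewrite ler_norml => ?; apply/andP; split; lra.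
have h5 : dot ((t *: u) *m L) p0 <= K * enorm (w - eta) ^+ 2
     + e / (2 * enorm p0) * enorm (t *: u) * enorm p0.
  have -> : (t *: u) *m L = (w - eta) - (w - eta - (t *: u) *m L) by rewrite subKr.
  rewrite dotBl; move: h4; rewrite ler_norml => /andP[_ h4].
  apply: lerD => //; rewrite -dotNl; apply: le_trans (dot_le _ _) _.
  by rewrite enormN ler_wpM2r ?enorm_ge0.
have h6 : K * enorm (w - eta) ^+ 2 <= e / 2 * enorm (t *: u).
  have : enorm (w - eta) ^+ 2 <= (M * enorm (t *: u)) ^+ 2.
    by rewrite ler_pXn2r ?nnegrE ?mulr_ge0 ?enorm_ge0 // ltW.
  move=> /(ler_wpM2l (ltW K0)) h6; apply: le_trans h6 _.
  move: u3 => /ltW; rewrite ler_pdivlMr ?mulr_gt0 ?exprn_gt0 // => u3.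
  have := ler_wpM2r (enorm_ge0 (t *: u)) u3.
  rewrite exprMn; lra.
have h7 : e / (2 * enorm p0) * enorm (t *: u) * enorm p0 = e / 2 * enorm (t *: u).
  by field; rewrite gt_eqF.
rewrite -(ler_pM2l t0) -dotZl scalemxAl; apply: le_trans h5 _; rewrite h7.
by move: h6; rewrite enormZ (gtr0_norm t0); lra.
Qed.

(** [delta (x + t v) <= g (x + t v - a)] with equality at [t = 0] and no linear term on either side;
    the inequality passes to the second-order terms. *)
Lemma derivative_pos v : dot v p0 = 0 -> dot (v *m (L *m Q)) v <= dot (v *m Q) v / r.
Proof.
move=> vp; rewrite -subr_le0; apply: (@le0_eps _ _ (4 * enorm v ^+ 2)) => e e0.
have [d d0 hd] := delta_expansion e0.
have [d1 d10 hd1] := star_expansion hphi dp0 etaQ diffQ r0 e0.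
have k0 : 0 < enorm v + 1 by rewrite ltr_wpDl ?enorm_ge0.
pose d' := Num.min d d1; have d'0 : 0 < d' by rewrite lt_min d0.
pose t := d' / (2 * (enorm v + 1)).
have t0 : 0 < t by rewrite divr_gt0 ?mulr_gt0.
have tu : enorm (t *: v) < d'.
  rewrite enormZ (gtr0_norm t0) /t mulrAC ltr_pdivrMr ?mulr_gt0 // ltr_pM2l //.
  by have := enorm_ge0 v; lra.
have := tu; rewrite lt_min => /andP[u1 u2].
have := hd _ u1; have := hd1 _ u2.
have := delta_le hphi (x + t *: v) Aa.
have -> : x + t *: v - a = r *: eta + t *: v by rewrite -(addrA a) addrAKl.
rewrite -!scalemxAl !(dotZl, dotZr) vp enormZ (gtr0_norm t0) !ler_norml => b1 /andP[b2 b2'] /andP[b3 b3'].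
have tt : 0 < t ^+ 2 by rewrite exprn_gt0.
rewrite -(ler_pM2l tt).
have E : (t * (t * dot (v *m Q) v) - (t * 0) ^+ 2) / (2 * r) = t ^+ 2 * (dot (v *m Q) v / r) / 2.
  by field; rewrite gt_eqF.
rewrite E in b2 b2'; lra.
Qed.

Lemma eigenvalue_le v (chi : R) : v != 0 -> v *m L = chi *: v -> chi <= r^-1.
Proof.
move=> v0 hv; have [h|h] := leP chi 0; first by apply: le_trans h _; rewrite invr_ge0 ltW.
have vp : dot v p0 = 0.
  have := derivative_tangent v; rewrite hv dotZl => /eqP.
  by rewrite mulf_eq0 gt_eqF //= => /eqP.
have := derivative_pos vp; rewrite mulmxA hv -scalemxAl dotZl mulrC.
by rewrite ler_pM2l ?Qpos.
Qed.

(** For [t < r] a kernel vector would be an eigenvector of [L] for [1 / (r - t)], which exceeds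
    [1 / r]. *)
Lemma unit_below (t : R) : 0 < t -> t <= r -> 1%:M - (r - t) *: L \in unitmx.
Proof.
move=> t0 tr; apply: inj_unitmx => v.
rewrite mulmxBr mulmx1 -scalemxAr => /eqP; rewrite subr_eq0 => /eqP hv.
apply: contrapT => /eqP v0.
have [e|ne] := eqVneq (r - t) 0; first by move: v0; rewrite hv e scale0r eqxx.
have hv2 : v *m L = (r - t)^-1 *: v by rewrite {2}hv scalerA mulVf // scale1r.
have := eigenvalue_le v0 hv2; rewrite lef_pV2 ?posrE //; lra.
Qed.

End AtPoint.
End NormalDerivative.

(** * Moving the derivative along a normal *)

Section Transport.
Context {R : realType} {n : nat}.
Notation V := 'rV[R]_(n.+1).
Implicit Types (u v w x y z b c p q k : V).
Context (phi : V -> R) (hphi : admissible_norm phi).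
Context (A : set V) (cA : closed A).
Notation g := (phistar phi).
Notation dual := (dualpair phi).
Notation delta := (dphi phi A).
Let gN : is_norm g := phistar_norm hphi.

Lemma mulmx_all0 (M : 'M[R]_n.+1) : (forall v, v *m M = 0) -> M = 0.
Proof. by move=> h; apply/row_matrixP => i; rewrite rowE h row0. Qed.

Lemma Dnu_unique x (L L' : 'M[R]_n.+1) : A !=set0 -> 0 < delta x ->
  Dnu_is phi A x L -> Dnu_is phi A x L' -> L = L'.
Proof.
move=> A0 dx [_ [v0 [e0 H]]] [_ [v1 [e1 H']]].
have v01 : v1 = v0.
  by have : [set v0] v1 by rewrite -e0 e1.
rewrite v01 in H'.
have [cg [Cg hb]] := phistar_between hphi; have [cg0 Cg0 h1 h2 _] := hb.
apply/eqP; rewrite -subr_eq0; apply/eqP; apply: mulmx_all0 => v.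
apply: linear_small => e ep; have e2 : 0 < e / 2 by rewrite divr_gt0.
have [d [d0 hd]] := H _ e2; have [d' [d'0 hd']] := H' _ e2.
pose m := Num.min (Num.min d d') (delta x / Cg).
have m0 : 0 < m by rewrite !lt_min d0 d'0 divr_gt0.
have k0 : 0 < enorm v + 1 by rewrite ltr_wpDl ?enorm_ge0.
pose t := m / (2 * (enorm v + 1)).
have t0 : 0 < t by rewrite divr_gt0 ?mulr_gt0.
exists t => //.
have tu : enorm (t *: v) < m.
  rewrite enormZ (gtr0_norm t0) /t mulrAC ltr_pdivrMr ?mulr_gt0 // ltr_pM2l //.
  by have := enorm_ge0 v; lra.
move: tu; rewrite !lt_min => /andP[/andP[u1 u2] u3].
pose y := x + t *: v; have yx : y - x = t *: v by rewrite /y addrAKl.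
have dy : 0 < delta y.
  have := le_trans (delta_lip hphi y x A0) (h2 _); rewrite yx ler_norml => /andP[].
  by move: u3; rewrite ltr_pdivlMr //; lra.
have nAy := delta_gt0_notin hphi dy.
have [w hw] := nuphi_exists hphi cA y A0.
have := hd y w nAy; have := hd' y w nAy; rewrite yx => /(_ u2 hw) b1 /(_ u1 hw) b2.
rewrite mulmxBr.
have -> : (t *: v) *m L - (t *: v) *m L' =
   (w - v0 - (t *: v) *m L') - (w - v0 - (t *: v) *m L).
  move: (w - v0) ((t *: v) *m L) ((t *: v) *m L') => p q q'.
  by apply/rowP => i; rewrite !mxE; ring.
by apply: le_trans (enormB _ _) _; lra.
Qed.

Context (reachA : (0 < reach A)%E).

(* Near x_t = a + t eta the nearest-point direction is read off at the corresponding
   point y = x_r + (z - x_t) (1 - (r-t) L)^-1 higher up the normal: descending from y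
   along its own direction leads back to z up to an error o(|z - x_t|). *)
Lemma Dnu_transport : exists2 t0 : R, 0 < t0 & forall a eta p0 (r t : R) (L : 'M[R]_n.+1),
  A a -> dual p0 eta -> delta (a + r *: eta) = r -> Dnu_is phi A (a + r *: eta) L ->
  0 < t -> t < r -> t <= t0 ->
  (1%:M - (r - t) *: L \in unitmx) /\
  Dnu_is phi A (a + t *: eta) (invmx (1%:M - (r - t) *: L) *m L).
Proof.
have [t0 t00 ht0] := nu_lipschitz hphi cA reachA.
have [cg [Cg hb]] := phistar_between hphi; have [cg0 Cg0 h1 h2 _] := hb.
exists t0 => // a eta p0 r t L Aa dp0 dr hL tp tr tt0.
have r0 : 0 < r by lra.
have A0 : A !=set0 by exists a.
have [pp0 ge _] := dp0.
have [_ eta0] := dualpair_neq0 hphi dp0.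
have [Q [Qpos etaQ diffQ]] := dual_diff hphi dp0.
have uM := unit_below hphi cA Aa r0 dr dp0 Qpos etaQ diffQ hL tp (ltW tr).
split=> //.
set U := 1%:M - _ in uM *.
have dt : delta (a + t *: eta) = t by exact: (dist_ray hb Aa ge dr (ltW tp) (ltW tr)).
split; first by apply: (delta_gt0_notin hphi); rewrite dt.
exists eta; split.
  apply/seteqP; split=> w /=; first exact: (ray_nu_unique hphi Aa ge dr tp tr).
  by move=> ->; exact: (nuphi_mem hphi tp Aa ge dt).
move=> e e0.
have [K K0 hK] := ht0 t tp tt0.
have [MM MM0 hMM] := mulmx_bound (invmx U).
(* The direction at [z] differs from that at [y] by at most [K (r - t) |err|], and that at [y] from
   its linear part by [err]; [MM] converts [k U^-1] back to [k]. *)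
pose E := (K * (r - t) + 1) * MM.
have E0 : 0 < E.
  by rewrite mulr_gt0 // addr_gt0 // mulr_gt0 // subr_gt0.
have eE : 0 < e / E by rewrite divr_gt0.
have [d d0 hd] := nu_diff hphi Aa r0 dr dp0 hL eE.
pose m := Num.min (d / MM) (Num.min (t / (2 * Cg)) (t / (2 * Cg * MM))).
exists m; split; first by rewrite !lt_min !divr_gt0 ?mulr_gt0.
move=> z wz nAz; rewrite !lt_min => /andP[z1 /andP[z2 z3]] hwz.
pose k := z - (a + t *: eta); rewrite -/k in z1 z2 z3 *.
have ek := enorm_ge0 k.
have dz1 : `|delta z - t| <= Cg * enorm k.
  by rewrite -dt; apply: le_trans (delta_lip _ _ _ _) (h2 _).
have z2' : Cg * enorm k < t / 2 by move: z2; rewrite ltr_pdivlMr ?mulr_gt0 //; clear; lra.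
have dz : 0 < delta z.
  by move: dz1; rewrite ler_norml => /andP[]; move: tp z2'; clear; lra.
have [_ gwz Nwz] := nuphiP hphi dz hwz.
pose y := a + r *: eta + k *m invmx U.
have yx : y - (a + r *: eta) = k *m invmx U by rewrite /y addrAKl.
have ekM := hMM k.
have [w hw] := nuphi_exists hphi cA y A0.
have [|dy gw Nw hwL] := hd y w _ hw.
  by rewrite yx; apply: le_lt_trans ekM _; rewrite mulrC -ltr_pdivlMr.
rewrite yx in hwL.
have dy1 : `|delta y - r| <= Cg * (MM * enorm k).
  rewrite -dr; apply: le_trans (delta_lip _ _ _ _) _ => //; apply: le_trans (h2 _) _.
  by rewrite yx ler_pM2l.
have z3' : Cg * (MM * enorm k) < t / 2.
  by move: z3; rewrite ltr_pdivlMr ?mulr_gt0 //; clear; lra.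
(* The points compared are [z] and [y] lowered by [r - t] along [w]; both have height close to [t],
   and by the choice of [y] they differ by exactly [(r - t) err]. *)
have := hK _ _ _ _ (delta z) (delta y - (r - t)) Nwz Nw.
move: dz1 dy1; rewrite !ler_norml => /andP[dz1 dz1'] /andP[dy1 dy1'].
move=> /(_ ltac:(clear -dz1 z2'; lra) ltac:(clear -tp dz1' z2'; lra)
  ltac:(clear -dy1 z3'; lra) ltac:(clear -tp dy1' z3'; lra)).
rewrite subrK.
pose err := w - eta - (k *m invmx U) *m L.
have -> : z - (y - delta y *: w + (delta y - (r - t)) *: w) = (r - t) *: err.
  have kU : k = k *m invmx U - (r - t) *: ((k *m invmx U) *m L).
    rewrite -{1}(mulmxKV uM k) /U mulmxBr mulmx1 -scalemxAr.
    by [].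
  have zE : z = a + t *: eta + k by rewrite /k addrC subrK.
  rewrite zE {1}kU /y /err; move: (k *m invmx U) (k *m invmx U *m L) => k1 k2.
  by apply/rowP => i; rewrite !mxE; ring.
rewrite enormZ gtr0_norm ?subr_gt0 // => hdist.
rewrite mulmxA.
have hwL2 : enorm err <= e / E * (MM * enorm k).
  by apply: le_trans hwL _; rewrite ler_pM2l.
have -> : wz - eta - k *m invmx U *m L = (wz - w) + err.
  by rewrite /err; move: (k *m invmx U *m L) => k2; apply/rowP => i; rewrite !mxE; ring.
apply: le_trans (enormD _ _) _.
apply: (@le_trans _ _ ((K * (r - t) + 1) * enorm err)).
  by move: hdist; clear; lra.
have K1 : 0 < K * (r - t) + 1 by rewrite addr_gt0 // mulr_gt0 // subr_gt0.
apply: le_trans (ler_wpM2l (ltW K1) hwL2) _.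
rewrite le_eqVlt; apply/orP; left; apply/eqP; rewrite /E.
by move: (K * (r - t) + 1) K1 => k1 K1; field; rewrite !gt_eqF.
Qed.

Lemma invmx_comm (U L : 'M[R]_n.+1) : U \in unitmx -> U *m L = L *m U ->
  invmx U *m L = L *m invmx U.
Proof.
by move=> uU c; rewrite -{1}(mulmxK uU L) -c !mulmxA mulVmx // mul1mx.
Qed.

Lemma comm_resolvent (s : R) (L : 'M[R]_n.+1) :
  (1%:M - s *: L) *m L = L *m (1%:M - s *: L).
Proof. by rewrite mulmxBl mulmxBr mul1mx mulmx1 -scalemxAl -scalemxAr. Qed.

(** Both claims follow from [1 - t Lt = U^-1 (1 - r L)] with [U = 1 - (r - t) L]. The invariant
    matrix has the [kappa_i] among its eigenvalues: it is the curvature at height 0. *)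
Lemma transport_resolvent (r t : R) (L : 'M[R]_n.+1) : 1%:M - (r - t) *: L \in unitmx ->
  let Lt := invmx (1%:M - (r - t) *: L) *m L in
  (1%:M - t *: Lt \in unitmx) = (1%:M - r *: L \in unitmx) /\
  (1%:M - r *: L \in unitmx ->
   invmx (1%:M - t *: Lt) *m Lt = invmx (1%:M - r *: L) *m L).
Proof.
set U := 1%:M - (r - t) *: L => uU Lt.
have e : 1%:M - t *: Lt = invmx U *m (1%:M - r *: L).
  have -> : 1%:M - r *: L = U - t *: L.
    by rewrite /U scalerBl opprB addrA addrAC addrK.
  by rewrite mulmxBr mulVmx // -scalemxAr.
have uU' : invmx U \in unitmx by rewrite unitmx_inv.
rewrite e; split; first by rewrite unitmx_mul uU'.
set W := 1%:M - r *: L => uW.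
have -> : Lt = invmx U *m W *m (invmx W *m L) by rewrite mulmxA mulmxK.
by rewrite mulKmx // unitmx_mul uU' uW.
Qed.

End Transport.

(** * The distance along a normal below the lower radius *)

Section ReachAlongNormal.
Context {R : realType} {n : nat}.
Notation V := 'rV[R]_(n.+1).
Implicit Types (u v w x y z b c p q k : V).

Lemma leb_outer0 : leb_outer (set0 : set V) = 0%E.
Proof.
apply/eqP; rewrite eq_le; apply/andP; split.
  apply: ereal_inf_lbound; exists (fun _ => (0, 0)); first by [].
  rewrite eseries0 // => i _ _; rewrite /boxvol big_ord_recl /= !mxE subrr maxxx mul0r //.
apply/ereal_infP => _ [B _ <-].
apply: nneseries_ge0 => k _ _; rewrite lee_fin; apply: prodr_ge0 => i _.
by rewrite le_max lexx.
Qed.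

(** If [E] missed a small ball, the density quotient there would be 0, at distance 1 from the
    limit. *)
Lemma density_one_adherent (E : set V) x (d : R) : density_one E x -> 0 < d ->
  exists2 y, E y & enorm (y - x) < d.
Proof.
move=> hE d0; have [|del [del0 hdel]] := hE 2^-1; first by rewrite invr_gt0.
pose r := Num.min d del / 2.
have m0 : 0 < Num.min d del by rewrite lt_min d0.
have md : Num.min d del <= d by rewrite ge_min lexx.
have mdel : Num.min d del <= del by rewrite ge_min lexx orbT.
have rd : r < d by rewrite /r; lra.
have rdel : r < del by rewrite /r; lra.
have := hdel r; rewrite {1}/r divr_gt0 // rdel => /(_ isT).
have [e|ne] := eqVneq (E `&` eball x r) set0.
  by rewrite e leb_outer0 /= mul0r sub0r normrN1; lra.
move=> _; have /set0P[y [Ey hy]] := ne.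
by exists y => //; apply: lt_trans rd.
Qed.

Context (phi : V -> R) (hphi : admissible_norm phi).
Context (A : set V) (cA : closed A).
Notation g := (phistar phi).
Notation delta := (dphi phi A).
Let gN : is_norm g := phistar_norm hphi.

(** Here [r < sg r'], and near [a + r' eta] there are points [y] whose segment from their foot [b]
    can be stretched by the factor [r / r' < sg] while realizing the distance. Uniqueness of the
    foot inside a ray makes [b] tend to [a], so the stretched points tend to [a + r eta]. *)
Lemma urphi_delta a eta (r : R) : A a -> g eta = 1 -> 0 < r ->
  (r%:E < urphi phi A a eta)%E -> delta (a + r *: eta) = r.
Proof.
move=> Aa ge r0 /ereal_sup_gt[z []]; first by move=> -> /=; rewrite lte_fin; lra.
move=> [sg [r' [-> [sg1 [r'0 [/ereal_sup_gt[_ [s [s0 hs] <-] r's] hd]]]]]].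
rewrite lte_fin in r's; rewrite lte_fin => rsr.
have [cg [Cg hb]] := phistar_between hphi; have [cg0 Cg0 h1 h2 _] := hb.
have A0 : A !=set0 by exists a.
pose x := a + r' *: eta.
have dx : delta x = r' by exact: (dist_ray hb Aa ge hs (ltW r'0) (ltW r's)).
have xa : xi_g g A x a.
  by split=> //; rewrite -/(dphi phi A x) dx /x addrAKl (normZ gN) ge mulr1 gtr0_norm.
have cont := proj_continuous hb cA xa (fun b => ray_proj_unique hphi Aa ge hs r'0 r's).
pose kp := r / r'; have kp0 : 0 < kp by rewrite divr_gt0.
have kpsg : kp < sg by rewrite ltr_pdivrMr.
suff : `|delta (a + r *: eta) - r| <= 0 by rewrite normr_le0 subr_eq0 => /eqP.
apply: (@le0_eps _ _ (Cg * (`|1 - kp| + 2 * kp))) => e e0.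
have [d d0 hcont] := cont _ e0.
have [y hy yx] := @density_one_adherent _ x (Num.min d e) hd ltac:(by rewrite lt_min d0).
move: yx; rewrite lt_min => /andP[yx1 yx2].
have [nAy [b [yb /(lt_le_trans _)]]] := hy.
move=> /(_ kp%:E); rewrite lte_fin => /(_ kpsg) /ereal_sup_gt[_ [s' [s'0 hs'] <-]].
rewrite lte_fin => kps'.
have hab := hcont y b yx1 yb.
have dy : 0 < delta y := delta_gt0 hphi cA A0 nAy.
have [Ab hyb] := yb; rewrite -/(dphi phi A y) in hyb.
pose w := (delta y)^-1 *: (y - b).
have gw : g w = 1 by rewrite (normZ gN) gtr0_norm ?invr_gt0 // hyb mulVf // gt_eqF.
have sw (m : R) : m *: (y - b) = (m * delta y) *: w.
  by rewrite scalerA mulfK // gt_eqF.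
have hk : delta (b + kp *: (y - b)) = kp * delta y.
  rewrite sw; apply: (dist_ray hb Ab gw (r := s' * delta y)).
  - by rewrite -sw.
  - by rewrite mulr_ge0 // ltW.
  - by rewrite ler_pM2r // ltW.
have rk : r = kp * delta x by rewrite dx /kp divfK // gt_eqF.
have -> : delta (a + r *: eta) - r =
   (delta (a + r *: eta) - delta (b + kp *: (y - b))) + kp * (delta y - delta x).
  rewrite hk mulrBr -rk; ring.
apply: le_trans (ler_normD _ _) _.
have q1 : `|delta (a + r *: eta) - delta (b + kp *: (y - b))| <= Cg * (`|1 - kp| + kp) * e.
  apply: le_trans (delta_lip _ _ _ _) _ => //; apply: le_trans (h2 _) _.
  rewrite -mulrA ler_pM2l //.
  have -> : a + r *: eta - (b + kp *: (y - b)) = - (1 - kp) *: (b - a) - kp *: (y - x).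
    have -> : r = kp * r' by rewrite -dx.
    by rewrite /x; apply/rowP => i; rewrite !mxE; ring.
  apply: le_trans (enormB _ _) _; rewrite !enormZ normrN (gtr0_norm kp0).
  have := ler_wpM2l (normr_ge0 (1 - kp)) (ltW hab).
  have := ler_wpM2l (ltW kp0) (ltW yx2); lra.
have q2 : `|kp * (delta y - delta x)| <= Cg * kp * e.
  have -> : Cg * kp * e = kp * (Cg * e) by ring.
  rewrite normrM (gtr0_norm kp0) ler_pM2l //.
  apply: le_trans (delta_lip _ _ _ _) _ => //; apply: le_trans (h2 _) _.
  by rewrite ler_pM2l // ltW.
by move: q1 q2; clear; lra.
Qed.

End ReachAlongNormal.

(** * The boundary near a point with finite curvatures *)

Section FlatPoint.
Context {R : realType} {n : nat}.
Notation V := 'rV[R]_(n.+1).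
Implicit Types (u v w x y z b c p q k : V).
Context (phi : V -> R) (hphi : admissible_norm phi).
Context (A : set V) (cA : closed A).
Notation g := (phistar phi).
Notation dual := (dualpair phi).
Notation delta := (dphi phi A).
Let pN : is_norm phi := phi_norm hphi.

(* The tangent cone of A at a contains the hyperplane orthogonal to p0. *)
Definition flat_at (a p0 : V) : Prop := forall e : R, 0 < e -> exists2 d : R, 0 < d &
  forall v, dot v p0 = 0 -> enorm v < d -> exists2 q, A q & enorm (q - a - v) <= e * enorm v.

(** The preimage [k] of [v] is orthogonal to [p0] as well, because [L] maps into that hyperplane. So
    [delta] changes only to second order, and the foot moves by [k - r k L = v] up to a small
    error. *)
Lemma flat_of_unit a eta p0 (r : R) (L : 'M[R]_n.+1) :
  A a -> 0 < r -> dual p0 eta -> delta (a + r *: eta) = r ->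
  Dnu_is phi A (a + r *: eta) L -> 1%:M - r *: L \in unitmx -> flat_at a p0.
Proof.
move=> Aa r0 dp0 dr hL uU e e0.
have A0 : A !=set0 by exists a.
have [Q [Qpos etaQ diffQ]] := dual_diff hphi dp0.
have [cg [Cg hb]] := phistar_between hphi; have [cg0 Cg0 h1 h2 _] := hb.
set U := 1%:M - r *: L in uU.
have [MI MI0 hMI] := mulmx_bound (invmx U).
have [MQ MQ0 hMQ] := mulmx_bound (L *m Q).
have [d1 d10 hd1] := nu_diff hphi Aa r0 dr dp0 hL (e := e / (2 * r * MI))
   ltac:(by rewrite divr_gt0 ?mulr_gt0).
have [d2 d20 hd2] := delta_expansion hphi cA Aa r0 dr dp0 diffQ hL (@ltr01 R).
pose B := (1 + MQ) * MI ^+ 2 / cg.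
have B0 : 0 < B by rewrite divr_gt0 // mulr_gt0 ?exprn_gt0 // addr_gt0.
pose m := Num.min (Num.min d1 d2 / MI) (e / (2 * B)).
have m12 : 0 < Num.min d1 d2 by rewrite lt_min d10.
exists m; first by rewrite lt_min; apply/andP; split; apply: divr_gt0 => //; exact: mulr_gt0.
move=> v vp; rewrite lt_min => /andP[v1 v2].
pose k := v *m invmx U.
have ekv : enorm k <= MI * enorm v := hMI v.
have ekd : enorm k < Num.min d1 d2.
  by apply: le_lt_trans ekv _; rewrite mulrC -ltr_pdivlMr.
move: ekd; rewrite lt_min => /andP[k1 k2].
have kU : k - r *: (k *m L) = v.
  by rewrite -[RHS](mulmxKV uU) -/k /U mulmxBr mulmx1 -scalemxAr.
have kp : dot k p0 = 0.
  have := derivative_tangent hphi cA Aa r0 dr dp0 hL k => t.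
  by move: vp; rewrite -kU dotBl dotZl t mulr0 subr0.
pose y := a + r *: eta + k.
have yx : y - (a + r *: eta) = k by rewrite /y addrAKl.
have [w hw] := nuphi_exists hphi cA y A0.
have [|dy gw Nw hwL] := hd1 y w _ hw; first by rewrite yx.
rewrite yx in hwL.
have hdel := hd2 k k2; rewrite -/y kp subr0 in hdel.
have [Aq _ _] := nuphiP hphi dy hw.
exists (y - delta y *: w) => //.
have wM : enorm w <= cg^-1.
  by rewrite -[leRHS]mulr1 mulrC ler_pdivlMr // mulrC -gw.
have dd : `|delta y - r| <= (1 + MQ) * enorm k ^+ 2.
  have q1 : `|dot (k *m (L *m Q)) k| <= MQ * enorm k ^+ 2.
    apply: le_trans (cauchy_schwarz _ _) _.
    by rewrite expr2 mulrA ler_wpM2r ?enorm_ge0.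
  have q2 : 0 <= MQ * enorm k ^+ 2 by rewrite mulr_ge0 ?sqr_ge0 // ltW.
  move: hdel q1 q2; rewrite !ler_norml => /andP[a1 a2] /andP[a3 a4] a5.
  by apply/andP; split; move: a1 a2 a3 a4 a5; clear; lra.
have -> : y - delta y *: w - a - v = - r *: (w - eta - k *m L) - (delta y - r) *: w.
  rewrite -kU /y; move: (k *m L) => k'.
  by apply/rowP => i; rewrite !mxE; ring.
apply: le_trans (enormB _ _) _; rewrite !enormZ normrN (gtr0_norm r0).
have s1 : r * enorm (w - eta - k *m L) <= e / 2 * enorm v.
  apply: le_trans (ler_wpM2l (ltW r0) hwL) _.
  apply: (@le_trans _ _ (r * (e / (2 * r * MI) * (MI * enorm v)))).
    by rewrite ler_pM2l // ler_pM2l // divr_gt0 ?mulr_gt0.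
  by rewrite le_eqVlt; apply/orP; left; apply/eqP; field; rewrite !gt_eqF.
have s2 : `|delta y - r| * enorm w <= e / 2 * enorm v.
  apply: le_trans (ler_pM (normr_ge0 _) (enorm_ge0 _) dd wM) _.
  apply: (@le_trans _ _ ((1 + MQ) * (MI * enorm v) ^+ 2 * cg^-1)).
    apply: ler_wpM2r; first by rewrite invr_ge0 ltW.
    apply: ler_wpM2l; first by apply: ltW; rewrite addr_gt0.
    by rewrite ler_pXn2r ?nnegrE ?enorm_ge0 // mulr_ge0 ?enorm_ge0 // ltW.
  have -> : (1 + MQ) * (MI * enorm v) ^+ 2 * cg^-1 = B * enorm v * enorm v.
    by rewrite /B; ring.
  rewrite ler_wpM2r ?enorm_ge0 //.
  have B2 : 0 < 2 * B by exact: mulr_gt0.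
  by move: v2; rewrite ltr_pdivlMr // => /ltW; clear; lra.
by move: s1 s2; clear; lra.
Qed.

Context (C1 : R) (C10 : 0 < C1) (prox : forall c w p q, Nphi phi A c w -> dual p w ->
  A q -> dot (q - c) p <= C1 * enorm (q - c) ^+ 2).
Context (a p0 : V) (Aa : A a) (pp0 : phi p0 = 1) (flat : flat_at a p0).

Let p0n : p0 != 0. Proof. by apply: (norm_neq0 pN); rewrite pp0. Qed.

(* A proximal normal at c near a almost annihilates the directions orthogonal to p0. *)
Lemma normals_near (e : R) : 0 < e -> exists2 d : R, 0 < d & forall c w p,
  Nphi phi A c w -> dual p w -> enorm (c - a) < d ->
  enorm (p - p0) <= e \/ enorm (p + p0) <= e.
Proof.
move=> e0; have [cp [Cp hb]] := phi_between hphi; have [cp0 Cp0 h1 h2 _] := hb.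
have ep0 := enorm_gt0 p0n.
pose M := 1 + enorm p0 * Cp; have M0 : 0 < M by rewrite addr_gt0 // mulr_gt0.
pose eT := e / M; have eT0 : 0 < eT by rewrite divr_gt0.
pose P := cp^-1; have P0 : 0 < P by rewrite invr_gt0.
(* [kp] is the flatness error and [s] below the test length; they are chosen so that [2 kp P] and
   [9 C1 s] are each at most [eT / 2]. *)
pose kp := Num.min 1 (eT / (4 * P)).
have kp0 : 0 < kp by rewrite lt_min ltr01 divr_gt0 // mulr_gt0.
have [d d0 hd] := flat kp0.
pose s := Num.min (d / 2) (eT / (18 * C1)).
have s0 : 0 < s by rewrite lt_min !divr_gt0 // mulr_gt0.
exists (kp * s) => [|c w p Nc pw hc]; first by rewrite mulr_gt0.
have [pp gw pw1] := pw.
have epP : enorm p <= P.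
  by rewrite /P -[leRHS]mulr1 mulrC ler_pdivlMr // mulrC -pp.
have [u0 u0d] : exists u0, u0 = (enorm p0)^-1 *: p0 by exists ((enorm p0)^-1 *: p0).
have uu : dot u0 u0 = 1.
  rewrite u0d dotZl dotZr -enorm_sqr expr2 mulKf ?gt_eqF // mulVf ?gt_eqF //.
have [pT pTd] : exists pT, pT = p - dot p u0 *: u0 by exists (p - dot p u0 *: u0).
have pTu : dot pT u0 = 0 by rewrite pTd dotBl dotZl uu mulr1 subrr.
have pTp : dot pT p = enorm pT ^+ 2.
  by rewrite enorm_sqr {3}pTd dotBr dotZr pTu mulr0 subr0.
(* The proximal inequality at [c] is tested with a point of [A] near [a + v], where [v] has length
   [s] along [pT]: its left side is nearly [s |pT|], its right side of order [s^2]. *)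
have T_small : enorm pT <= eT.
  have [->|T0] := eqVneq pT 0; first by rewrite enorm0 ltW.
  have eT' := enorm_gt0 T0.
  pose v := (s / enorm pT) *: pT.
  have ev : enorm v = s.
    by rewrite enormZ gtr0_norm ?divr_gt0 // divfK // gt_eqF.
  have vp : dot v p0 = 0.
    have : enorm p0 * dot pT u0 = dot pT p0 by rewrite u0d dotZr mulVKf // gt_eqF.
    by rewrite pTu mulr0 /v dotZl => <-; rewrite mulr0.
  have [|q Aq hq] := hd v vp; first by rewrite ev gt_min; apply/orP; left; move: d0; lra.
  rewrite ev in hq.
  have hpr := prox Nc pw Aq.
  have k1 : kp <= 1 by rewrite ge_min lexx.
  have qc : q - c = v + (q - a - v) - (c - a).
    by apply/rowP => i; rewrite !mxE; ring.
  have kps : kp * s <= s by rewrite ger_pMl.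
  have nqc : enorm (q - c) <= 3 * s.
    rewrite qc; apply: le_trans (enormB _ _) _.
    apply: le_trans (lerD (enormD _ _) (lexx _)) _; rewrite ev.
    by move: hq hc kps; lra.
  have vpd : dot v p = s * enorm pT.
    by rewrite /v dotZl pTp expr2 mulrA divfK // gt_eqF.
  have t1 := le_trans (dot_le (v - (q - a)) p) (ler_pM (enorm_ge0 _) (enorm_ge0 _)
    (_ : enorm (v - (q - a)) <= kp * s) epP).
  rewrite enormBC in t1; move: (t1 hq) => {}t1.
  have t2 := le_trans (dot_le (c - a) p) (ler_pM (enorm_ge0 _) (enorm_ge0 _) (ltW hc) epP).
  have t3 : C1 * enorm (q - c) ^+ 2 <= C1 * (3 * s) ^+ 2.
    rewrite ler_pM2l // ler_pXn2r ?nnegrE ?enorm_ge0 // mulr_ge0 //; exact: ltW.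
  have t4 : dot (q - c) p = s * enorm pT - dot (v - (q - a)) p - dot (c - a) p.
    by rewrite -vpd -!dotBl; congr dot; apply/rowP => i; rewrite !mxE; ring.
  have t5 : s * enorm pT <= s * (2 * kp * P + 9 * C1 * s).
    by move: t1 t2 t3 hpr; rewrite t4; lra.
  rewrite ler_pM2l // in t5; apply: le_trans t5 _.
  have k2 : kp <= eT / (4 * P) by rewrite ge_min lexx orbT.
  have s2 : s <= eT / (18 * C1) by rewrite ge_min lexx orbT.
  rewrite ler_pdivlMr ?mulr_gt0 // in k2; rewrite ler_pdivlMr ?mulr_gt0 // in s2.
  by move: k2 s2; lra.
pose be := dot p u0.
have pE : p = pT + be *: u0 by rewrite pTd subrK.
have p0E : p0 = enorm p0 *: u0 by rewrite u0d scalerA mulfV ?scale1r // gt_eqF.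
have phu : phi u0 = (enorm p0)^-1.
  by rewrite u0d (normZ pN) pp0 mulr1 gtr0_norm // invr_gt0.
(* [phi p = 1] fixes the length of the remaining component up to sign; the sign is what separates
   the two alternatives. *)
have hbe : `| `|be| - enorm p0 | <= enorm p0 * Cp * enorm pT.
  have : `| phi (be *: u0) - phi p | <= Cp * enorm pT.
    apply: le_trans (norm_between_dist _ _ hb) _.
    have -> : be *: u0 - p = - pT by rewrite {1}pE opprD addrCA subrr addr0.
    by rewrite enormN.
  rewrite (normZ pN) pp phu -(ler_pM2l ep0) => h.
  apply: le_trans _ (le_trans h _); last by rewrite mulrA.
  rewrite -{2}(gtr0_norm ep0) -normrM mulrBr mulr1 mulrCA mulfV ?gt_eqF // mulr1 //.
have fin (si : R) : `|si| = 1 -> `|be| = si * be -> enorm (p - si *: p0) <= e.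
  move=> s1 sb.
  have -> : p - si *: p0 = pT + (si * (`|be| - enorm p0)) *: u0.
    have ss : si * si = 1 by rewrite -expr2 -(real_normK (num_real si)) s1 expr1n.
    rewrite sb {1}pE p0E mulrBr mulrA ss mul1r scalerBl addrA scalerA.
    by rewrite -p0E.
  apply: le_trans (enormD _ _) _; rewrite enormZ normrM s1 mul1r.
  have -> : enorm u0 = 1 by rewrite /enorm uu sqrtr1.
  rewrite mulr1; apply: le_trans (lerD (lexx _) hbe) _.
  have -> : enorm pT + enorm p0 * Cp * enorm pT = M * enorm pT by rewrite /M; ring.
  by rewrite mulrC -ler_pdivlMr.
have [be0|be0] := leP 0 be.
  left; have := fin 1; rewrite normr1 scale1r mul1r => /(_ erefl); apply.
  by rewrite ger0_norm.
right; have := fin (-1); rewrite normrN1 scaleN1r opprK mulN1r => /(_ erefl); apply.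
by rewrite ltr0_norm.
Qed.

End FlatPoint.

Ltac clra := clear; lra.

Lemma lipschitz_EVT_min (R : realType) (f : R -> R) (K lo hi : R) : lo <= hi -> 0 < K ->
  (forall x y, `|f x - f y| <= K * `|x - y|) ->
  exists2 c, lo <= c <= hi & forall t, lo <= t <= hi -> f c <= f t.
Proof.
move=> lohi K0 lip.
have cf : continuous f.
  move=> x; apply/cvgrPdist_lt => e e0; near=> y.
  apply: le_lt_trans (lip x y) _; rewrite mulrC -ltr_pdivlMr //.
  by near: y; apply: cvgr_dist_lt; rewrite ?divr_gt0.
have cf' : {within `[lo, hi], continuous f} by apply: continuous_subspaceT.
have [c hc hmin] := EVT_min lohi cf'.
exists c; first by move: hc; rewrite in_itv.
by move=> t ht; apply: hmin; rewrite in_itv.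
Unshelve. all: by end_near.
Qed.

(** * The boundary as a graph *)

Section BoundaryGraph.
Context {R : realType} {n : nat}.
Notation V := 'rV[R]_(n.+1).
Implicit Types (u v w x y z b c p q k : V).
Context (phi : V -> R) (hphi : admissible_norm phi).
Context (A : set V) (cA : closed A).
Notation g := (phistar phi).
Notation dual := (dualpair phi).
Notation delta := (dphi phi A).
Let gN : is_norm g := phistar_norm hphi.

Definition proximal_bound (C1 : R) : Prop := forall c w p q, Nphi phi A c w -> dual p w ->
  A q -> dot (q - c) p <= C1 * enorm (q - c) ^+ 2.

(* A minimal point of the distance to A on the short segment through a + v would,
   if outside A, have a nearest point with normal close to +p0 or -p0; minimality makes it an
   end point, and both ends are excluded by flatness and by [below]. *)
Lemma line_meets (C1 : R) a p0 nu (e : R) : 0 < C1 -> proximal_bound C1 -> A a ->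
  phi p0 = 1 -> flat_at A a p0 ->
  (forall q, A q -> dot (q - a) p0 <= C1 * enorm (q - a) ^+ 2) ->
  enorm nu = 1 -> 0 < dot nu p0 -> 0 < e -> e <= 1 -> exists2 d : R, 0 < d &
  forall v, dot v p0 = 0 -> enorm v < d ->
    exists2 tau : R, `|tau| <= e * enorm v & A (a + v + tau *: nu).
Proof.
move=> C10 prox Aa pp0 flat below nu1 nup e0 e1.
have A0 : A !=set0 by exists a.
have [cp [Cp hbp]] := phi_between hphi; have [cp0 Cp0 hp1 hp2 _] := hbp.
have [cg [Cg hb]] := phistar_between hphi; have [cg0 Cg0 h1 h2 _] := hb.
have [K K0 hK] := star_semiconcave hphi.
pose mu := dot nu p0; pose P := cp^-1; pose M := cg^-1.
have P0 : 0 < P by rewrite invr_gt0.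
have M0 : 0 < M by rewrite invr_gt0.
have em : 0 < e * mu by rewrite mulr_gt0.
pose kp := Num.min 1 (Num.min (e * mu / (8 * P)) (e * mu / (8 * Cg))).
have kp0 : 0 < kp by rewrite !lt_min ltr01 !divr_gt0 ?mulr_gt0.
have kp1 : kp <= 1 by rewrite ge_min lexx.
have kp2 : kp * P <= e * mu / 8.
  have : kp <= e * mu / (8 * P) by rewrite !ge_min lexx !orbT.
  by rewrite ler_pdivlMr ?mulr_gt0 //; lra.
have kp3 : kp * Cg <= e * mu / 8.
  have : kp <= e * mu / (8 * Cg) by rewrite !ge_min lexx !orbT.
  by rewrite ler_pdivlMr ?mulr_gt0 //; lra.
have [d1 d10 hd1] := flat _ kp0.
have mu2 : 0 < mu / 2 by rewrite divr_gt0.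
have [d2 d20 hd2] := normals_near hphi C10 prox pp0 flat mu2.
pose B1 := 2 + Cg * M.
have CgM : 0 < Cg * M by rewrite mulr_gt0.
have B10 : 0 < B1 by rewrite addr_gt0.
pose d3 := e * mu / (8 * (C1 * B1 ^+ 2)).
have d30 : 0 < d3 by rewrite divr_gt0 // mulr_gt0 // mulr_gt0 // exprn_gt0.
exists (Num.min d1 (Num.min (d2 / B1) d3)); first by rewrite !lt_min d10 d30 divr_gt0.
move=> v vp; rewrite !lt_min => /andP[v1 /andP[v2 v3]].
have [v0|v0] := eqVneq v 0.
  by exists 0; [rewrite normr0 mulr_ge0 ?enorm_ge0 // ltW|rewrite v0 scale0r !addr0].
pose s := enorm v; have s0 : 0 < s := enorm_gt0 v0.
rewrite -/s in v1 v2 v3 *.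
have s3 : C1 * B1 ^+ 2 * s <= e * mu / 8.
  move: v3; rewrite ltr_pdivlMr; last by rewrite mulr_gt0 // mulr_gt0 // exprn_gt0.
  by move/ltW; lra.
have s2 : B1 * s < d2 by rewrite mulrC -ltr_pdivlMr.
have es0 : 0 < e * s by rewrite mulr_gt0.
have es1 : e * s <= s by rewrite ger_pMl.
have [q Aq hq] := hd1 v vp v1; rewrite -/s in hq.
apply: contrapT => nA.
have out tau : - (e * s) <= tau <= e * s -> ~ A (a + v + tau *: nu).
  by move=> ht hA; apply: nA; exists tau => //; rewrite ler_norml.
have lip (x y : R) : `|delta (a + v + x *: nu) - delta (a + v + y *: nu)| <= Cg * `|x - y|.
  apply: le_trans (delta_lip hphi _ _ A0) _; apply: le_trans (h2 _) _.
  rewrite opprD addrACA subrr add0r -scalerBl enormZ nu1 mulr1 //.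
have [ts hts hmin] := @lipschitz_EVT_min _ (fun t => delta (a + v + t *: nu)) Cg (- (e * s)) (e * s)
   ltac:(lra) Cg0 lip.
have /andP[ts1 ts2] := hts.
pose ps := a + v + ts *: nu.
have D0 : 0 < delta ps by apply: (delta_gt0 hphi cA A0); exact: out.
have [D Dd] : exists D, D = delta ps by exists (delta ps).
have [w hw] := nuphi_exists hphi cA ps A0.
have [Ac gw Nc] := nuphiP hphi D0 hw.
rewrite -Dd in D0 Ac Nc.
have [c cd] : exists c, c = ps - D *: w by exists (ps - D *: w).
rewrite -cd in Ac Nc.
have [p pw] := dualpair_exists hphi gw.
have [pp _ pw1] := pw.
have pP : enorm p <= P by rewrite /P -[leRHS]mulr1 mulrC ler_pdivlMr // mulrC -pp.
have wM : enorm w <= M by rewrite /M -[leRHS]mulr1 mulrC ler_pdivlMr // mulrC -gw.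
have Dle : D <= Cg * kp * s.
  rewrite Dd; apply: (@le_trans _ _ (delta (a + v))).
    have := hmin 0; rewrite scale0r addr0; apply.
    by rewrite oppr_le0 ltW.
  apply: le_trans (delta_le hphi _ Aq) _; apply: le_trans (h2 _) _.
  by rewrite -mulrA ler_pM2l // enormBC opprD addrA.
have Dle2 : D <= Cg * s.
  by apply: le_trans Dle _; rewrite -mulrA ler_pM2l // ger_pMl.
have DM : D * enorm w <= Cg * M * s.
  by have := ler_pM (ltW D0) (enorm_ge0 w) Dle2 wM; clra.
have tsn : enorm (ts *: nu) <= e * s by rewrite enormZ nu1 mulr1 ler_norml.
have ca : enorm (c - a) <= B1 * s.
  have -> : c - a = v + ts *: nu - D *: w by rewrite cd /ps; apply/rowP => i; rewrite !mxE; ring.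
  apply: le_trans (enormB _ _) _; apply: le_trans (lerD (enormD _ _) (lexx _)) _.
  rewrite (enormZ D) (gtr0_norm D0) /B1 -/s; move: DM tsn es1; clra.
have near := hd2 c w p Nc pw (le_lt_trans ca s2).
have psc : ps - c = D *: w by rewrite cd subKr.
(* The old foot [c] bounds the distance after a move by [h]; semiconcavity of [g] and minimality at
   [ts] give a one-sided condition on [nu . p]. *)
have key (h : R) : - (e * s) <= ts + h <= e * s -> 0 <= h * dot nu p + K * h ^+ 2 / D.
  move=> hh; have := hmin _ hh; rewrite -/ps -Dd => m1.
  have z0 : D *: w != 0.
    by rewrite scaler_eq0 negb_or gt_eqF //=; have [] := dualpair_neq0 hphi pw.
  have := hK (D *: w) (D *: w + h *: nu) z0.
  rewrite (nor_eq hphi D0 pw) (normZ gN) gw mulr1 (gtr0_norm D0) addrAKl dotZr (dotC p) enormZ nu1 mulr1.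
  rewrite real_normK ?num_real // => m2.
  have := delta_le hphi (a + v + (ts + h) *: nu) Ac.
  have -> : a + v + (ts + h) *: nu - c = D *: w + h *: nu.
    by rewrite -psc /ps; apply/rowP => i; rewrite !mxE; ring.
  by move: m1 m2; clra.
have nup' (si : R) : `|si| = 1 -> enorm (p - si *: p0) <= mu / 2 -> `|dot nu p - si * mu| <= mu / 2.
  move=> _ hp; rewrite /mu -dotZr -dotBr; apply: le_trans (cauchy_schwarz _ _) _.
  by rewrite nu1 mul1r.
(* With [p] near [p0] the distance grows along [nu], so the minimum sits at the lower end. There the
   point [q] of [A] near [a + v] is too far above [c] for the proximal inequality. *)
case: near => near.
  have np : mu / 2 <= dot nu p.
    have := nup' 1; rewrite normr1 scale1r mul1r => /(_ erefl near).
    by rewrite ler_norml => /andP[]; lra.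
  have tsE : ts = - (e * s).
    apply/eqP; rewrite eq_le ts1 andbT leNgt; apply/negP => lt.
    pose h := Num.min (ts + e * s) (D * mu / (4 * K)).
    have hp : 0 < h.
      by rewrite lt_min divr_gt0 ?mulr_gt0 // andbT; move: lt; lra.
    have ht : h <= ts + e * s by rewrite ge_min lexx.
    have ht2 : h <= D * mu / (4 * K) by rewrite ge_min lexx orbT.
    have hI : - (e * s) <= ts - h <= e * s.
      by apply/andP; split; move: ht hp ts2; clra.
    have := key (- h) hI.
    rewrite sqrrN.
    have : K * h ^+ 2 / D <= h * (mu / 4).
      rewrite ler_pdivrMr // expr2 mulrCA -mulrA ler_pM2l //.
      by move: ht2; rewrite ler_pdivlMr ?mulr_gt0 //; clra.
    by have := ler_wpM2l (ltW hp) np; have := mulr_gt0 hp mu2; clra.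
  have hpr := prox _ _ _ _ Nc pw Aq.
  have qcE : q - c = (q - a - v) + (e * s) *: nu + D *: w.
    by rewrite cd /ps tsE; apply/rowP => i; rewrite !mxE; ring.
  have qcn : enorm (q - c) <= B1 * s.
    rewrite qcE; apply: le_trans (enormD _ _) _; apply: le_trans (lerD (enormD _ _) (lexx _)) _.
    rewrite (enormZ D) (gtr0_norm D0) enormZ nu1 mulr1 (gtr0_norm es0) /B1.
    have : kp * s <= s by rewrite ger_pMl.
    by move: hq DM es1; clra.
  have qc2 : C1 * enorm (q - c) ^+ 2 <= C1 * (B1 * s) ^+ 2.
    by rewrite ler_pM2l // ler_pXn2r ?nnegrE ?enorm_ge0 // mulr_ge0 // ltW.
  have qcp : dot (q - c) p = e * s * dot nu p + D + dot (q - a - v) p.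
    by rewrite qcE !dotDl !dotZl (dotC w) pw1; ring.
  have qv : - (kp * s * P) <= dot (q - a - v) p.
    have := le_trans (cauchy_schwarz (q - a - v) p) (ler_pM (enorm_ge0 _) (enorm_ge0 _) hq pP).
    by rewrite ler_norml => /andP[].
  have f1 : e * s * (mu / 2) <= e * s * dot nu p by rewrite ler_pM2l.
  have f2 : s * (e * mu / 2) <= s * (kp * P + C1 * B1 ^+ 2 * s).
    by move: hpr f1 qv D0 qc2; rewrite qcp; clra.
  by rewrite ler_pM2l // in f2; move: f2 kp2 s3 em; clra.
(* With [p] near [- p0] the minimum sits at the upper end, and [c] itself rises above [a] by about
   [e s mu], against [below]. *)
have np : dot nu p <= - (mu / 2).
  have := nup' (-1); rewrite normrN1 scaleN1r opprK mulN1r opprK => /(_ erefl near).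
  by rewrite ler_norml => /andP[]; lra.
have tsE : ts = e * s.
  apply/eqP; rewrite eq_le ts2 /= leNgt; apply/negP => lt.
  pose h := Num.min (e * s - ts) (D * mu / (4 * K)).
  have hp : 0 < h.
    by rewrite lt_min divr_gt0 ?mulr_gt0 // andbT; move: lt; lra.
  have ht : h <= e * s - ts by rewrite ge_min lexx.
  have ht2 : h <= D * mu / (4 * K) by rewrite ge_min lexx orbT.
  have hI : - (e * s) <= ts + h <= e * s.
    by apply/andP; split; move: ht hp ts1; clra.
  have := key h hI.
  have : K * h ^+ 2 / D <= h * (mu / 4).
    rewrite ler_pdivrMr // expr2 mulrCA -mulrA ler_pM2l //.
    by move: ht2; rewrite ler_pdivlMr ?mulr_gt0 //; clra.
  by have := ler_wpM2l (ltW hp) np; have := mulr_gt0 hp mu2; clra.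
have hbel := below _ Ac.
have ca2 : C1 * enorm (c - a) ^+ 2 <= C1 * (B1 * s) ^+ 2.
  by rewrite ler_pM2l // ler_pXn2r ?nnegrE ?enorm_ge0 // mulr_ge0 // ltW.
have cap : dot (c - a) p0 = e * s * mu - D * dot w p0.
  have -> : c - a = v + (e * s) *: nu - D *: w.
    by rewrite cd /ps tsE; apply/rowP => i; rewrite !mxE; ring.
  by rewrite dotBl dotDl !dotZl vp add0r.
have wp0 : dot w p0 <= 1 by have := dual_le hphi w p0; rewrite pp0 mul1r gw dotC.
have Dw : D * dot w p0 <= D by rewrite ger_pMr.
have f2 : s * (e * mu) <= s * (kp * Cg + C1 * B1 ^+ 2 * s).
  by move: hbel ca2 Dw Dle; rewrite cap; clra.
by rewrite ler_pM2l // in f2; move: f2 kp3 s3 em; clra.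
Qed.

(** The topmost point is sought in the window [|t| <= t0]. With [t0 = mu / (4 C1)] the inequality
    [below] leaves no point of [A] with [t] above [|v|^2 / t0] in this window, so for small [v] the
    supremum stays clear of its upper end and is truly topmost; from below it is bounded by the
    point of [line_meets]. *)
Lemma boundary_graph (C1 : R) a p0 nu : 0 < C1 -> proximal_bound C1 -> A a ->
  phi p0 = 1 -> flat_at A a p0 ->
  (forall q, A q -> dot (q - a) p0 <= C1 * enorm (q - a) ^+ 2) ->
  enorm nu = 1 -> 0 < dot nu p0 -> exists (d : R) (T : V -> R), [/\ 0 < d,
   forall v, dot v p0 = 0 -> enorm v < d -> A (a + v + T v *: nu) /\
     exists2 t1 : R, 0 < t1 & forall t, 0 < t -> t < t1 -> ~ A (a + v + (T v + t) *: nu),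
   T 0 = 0 &
   forall e : R, 0 < e -> exists2 d' : R, 0 < d' & forall v, dot v p0 = 0 -> enorm v < d' ->
     `|T v| <= e * enorm v].
Proof.
move=> C10 prox Aa pp0 flat below nu1 nup.
pose mu := dot nu p0.
pose t0 := mu / (4 * C1); have t00 : 0 < t0 by rewrite divr_gt0 ?mulr_gt0.
have upper v (t : R) : dot v p0 = 0 -> 0 <= t -> t <= t0 -> A (a + v + t *: nu) ->
    t <= enorm v ^+ 2 / t0.
  move=> vp tp tt0 /below.
  have -> : a + v + t *: nu - a = v + t *: nu by rewrite -(addrA a) addrAKl.
  rewrite dotDl vp add0r dotZl -/mu => h.
  have : enorm (v + t *: nu) ^+ 2 <= 2 * enorm v ^+ 2 + 2 * t ^+ 2.
    have e1 : enorm (v + t *: nu) <= enorm v + t.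
      by apply: le_trans (enormD _ _) _; rewrite enormZ nu1 mulr1 ger0_norm.
    have e2 : enorm (v + t *: nu) ^+ 2 <= (enorm v + t) ^+ 2.
      by rewrite ler_pXn2r ?nnegrE ?addr_ge0 ?enorm_ge0.
    by have := sqr_ge0 (enorm v - t); rewrite sqrrB; move: e2; rewrite sqrrD; lra.
  rewrite -(ler_pM2l C10) => h2.
  have mt : mu = 4 * C1 * t0 by rewrite /t0; field; rewrite gt_eqF.
  have h3 : t * t <= t0 * t by rewrite ler_wpM2r.
  have h3' := ler_wpM2l (ltW C10) h3.
  rewrite ler_pdivlMr // -(ler_pM2l C10).
  by move: h h2 h3'; rewrite mt expr2; lra.
pose S v := [set t : R | - t0 <= t <= t0 /\ A (a + v + t *: nu)].
pose T v := sup (S v).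
have Sub v : has_ubound (S v) by exists t0 => t [/andP[]].
have TS v : S v !=set0 -> S v (T v).
  move=> S0; have hs : has_sup (S v) by split.
  have [t1 St1] := S0.
  have lo : - t0 <= T v.
    by apply: le_trans (ub_le_sup (Sub v) St1); have [/andP[]] := St1.
  have hi : T v <= t0 by apply: ge_sup => // t [/andP[]].
  split; first by rewrite lo.
  apply: contrapT => /(closed_enorm cA)[e e0 he].
  have [t St] := sup_adherent e0 hs; rewrite -/(T v) => ht.
  have [_ At] := St; apply: he At.
  rewrite opprD addrACA subrr add0r -scalerBl enormZ nu1 mulr1.
  have := ub_le_sup (Sub v) St; rewrite -/(T v) => tT.
  by rewrite ler0_norm ?subr_le0 //; lra.
have lm := line_meets C10 prox Aa pp0 flat below nu1 nup.
have [d1 d10 hd1] := lm _ ltr01 (lexx _).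
pose d := Num.min d1 t0.
have Sne v : dot v p0 = 0 -> enorm v < d -> S v !=set0.
  move=> vp; rewrite lt_min => /andP[v1 v2].
  have [t ht At] := hd1 v vp v1; exists t; split=> //.
  by rewrite -ler_norml; apply: le_trans ht _; rewrite mul1r ltW.
have Tup v : dot v p0 = 0 -> enorm v < d -> T v <= enorm v ^+ 2 / t0.
  move=> vp vd; have [/andP[_ h1] h2] := TS v (Sne v vp vd).
  have [h|/ltW h] := leP 0 (T v); first exact: upper.
  by apply: le_trans h _; rewrite divr_ge0 ?sqr_ge0 // ltW.
have d0 : 0 < d by rewrite lt_min d10.
have small (e : R) : 0 < e -> exists2 d' : R, 0 < d' & forall v, dot v p0 = 0 ->
    enorm v < d' -> `|T v| <= e * enorm v.
  move=> e0; pose e' := Num.min e 1.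
  have e'0 : 0 < e' by rewrite lt_min e0 ltr01.
  have [d2 d20 hd2] := lm e' e'0 ltac:(by rewrite ge_min lexx orbT).
  exists (Num.min (Num.min d d2) (Num.min t0 (e * t0))); first by rewrite !lt_min d10 d20 t00 mulr_gt0.
  move=> v vp; rewrite lt_min => /andP[]; rewrite lt_min => /andP[v1 v2].
  rewrite lt_min => /andP[v3 v4].
  have [t ht At] := hd2 v vp v2.
  have e'e : e' * enorm v <= e * enorm v by rewrite ler_wpM2r ?enorm_ge0 // ge_min lexx.
  have e'1 : e' * enorm v <= enorm v.
    by rewrite -[leRHS]mul1r ler_wpM2r ?enorm_ge0 // ge_min lexx orbT.
  have St : S v t.
    by split=> //; rewrite -ler_norml; apply: le_trans ht _; apply: le_trans e'1 (ltW v3).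
  have tT := ub_le_sup (Sub v) St; rewrite -/(T v) in tT.
  have := Tup v vp v1.
  have : enorm v ^+ 2 / t0 <= e * enorm v.
    by rewrite ler_pdivrMr // expr2 mulrAC ler_wpM2r ?enorm_ge0 // ltW.
  move: ht; rewrite !ler_norml => /andP[a1 a2] a3 a4.
  by apply/andP; split; lra.
exists d, T; split=> //.
- move=> v vp vd; have [hT AT] := TS v (Sne v vp vd); split=> //.
  have Tt0 : T v < t0.
    apply: le_lt_trans (Tup v vp vd) _; rewrite ltr_pdivrMr //.
    have : enorm v < t0 by move: vd; rewrite lt_min => /andP[].
    by move=> h; rewrite expr2 ltr_pM ?enorm_ge0.
  exists (t0 - T v); first by rewrite subr_gt0.
  move=> t tp tt hA.
  have St : S v (T v + t).
    by split=> //; move: hT => /andP[x1 x2]; apply/andP; split; lra.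
  by have := ub_le_sup (Sub v) St; rewrite -/(T v); lra.
- have [d' d'0 hd'] := small 1 ltr01.
  have := hd' 0; rewrite dot0l enorm0 mulr0 => /(_ erefl d'0).
  by rewrite normr_le0 => /eqP.
Qed.

End BoundaryGraph.

(** * The normal field along the graph *)

Section NormalField.
Context {R : realType} {n : nat}.
Notation V := 'rV[R]_(n.+1).
Implicit Types (u v w x y z b c p q k : V).
Context (phi : V -> R) (hphi : admissible_norm phi).
Context (A : set V) (cA : closed A).
Notation g := (phistar phi).
Notation dual := (dualpair phi).
Notation delta := (dphi phi A).
Let gN : is_norm g := phistar_norm hphi.

(** For [q] in [A] this does two things: it puts [q] on the boundary, and it supplies exterior
    points from which a normal on the side of [u] is obtained. *)
Definition top_of q u : Prop :=
  exists2 t1 : R, 0 < t1 & forall t, 0 < t -> t < t1 -> ~ A (q + t *: u).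

Lemma top_bdry q u : enorm u = 1 -> A q -> top_of q u -> bdry A q.
Proof.
move=> u1 Aq [t1 t10 ht]; split; first exact: subset_closure.
move=> /nbhs_enormP[e e0 he].
pose t := Num.min t1 e / 2.
have m0 : 0 < Num.min t1 e by rewrite lt_min t10.
have mt : Num.min t1 e <= t1 by rewrite ge_min lexx.
have me : Num.min t1 e <= e by rewrite ge_min lexx orbT.
apply: (ht t); rewrite /t; [lra|lra|].
by apply: he; rewrite addrAKl enormZ u1 mulr1 gtr0_norm; lra.
Qed.

Lemma dual_inverse_lipschitz : exists K d : R, [/\ 0 < K, 0 < d & forall p w p' w',
  dual p w -> dual p' w' -> enorm (p' - p) <= d -> enorm (w' - w) <= K * enorm (p' - p)].
Proof.
have [K [d [K0 d0 h]]] := grad_lipschitz hphi.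
exists K, d; split=> // p w p' w' pw pw' hd.
have [pp _ _] := pw.
have := h p (p' - p) pp hd.
by rewrite (addrC p) subrK -(dualpair_grad hphi pw) -(dualpair_grad hphi pw').
Qed.

Context (C1 : R) (C10 : 0 < C1) (prox : proximal_bound phi A C1).
Context (rho : R) (rho0 : 0 < rho) (ext : forall c w (t : R), Nphi phi A c w -> 0 <= t ->
  t <= rho -> delta (c + t *: w) = t).
Context (a p0 eta u : V) (dp0 : dual p0 eta) (u1 : enorm u = 1) (p0u : p0 = enorm p0 *: u).
Context (flat : flat_at A a p0).

Let ep0 : 0 < enorm p0. Proof. by apply: enorm_gt0; have [] := dualpair_neq0 hphi dp0. Qed.
Let uu : dot u u = 1. Proof. by rewrite -enorm_sqr u1 expr1n. Qed.

Let dotu k : dot k p0 = enorm p0 * dot k u.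
Proof. by rewrite {1}p0u dotZr. Qed.

Lemma dual_near_sign : exists2 e0 : R, 0 < e0 & forall p w, dual p w ->
  (enorm (p - p0) <= e0 -> 0 < dot w u) /\ (enorm (p + p0) <= e0 -> dot w u < 0).
Proof.
have [K [d [K0 d0 h]]] := dual_inverse_lipschitz.
(* [eta . u = 1 / |p0|], and this bound on [p - p0] keeps [w - eta] within half of that. *)
pose m := (2 * K * enorm p0)^-1; have m0 : 0 < m by rewrite invr_gt0 !mulr_gt0.
have key p w : dual p w -> enorm (p - p0) <= Num.min d m -> 0 < dot w u.
  move=> pw; rewrite le_min => /andP[hd hm].
  have h1 := h _ _ _ _ dp0 pw hd.
  have h2 : enorm (w - eta) <= (2 * enorm p0)^-1.
    apply: le_trans h1 _; apply: le_trans (ler_wpM2l (ltW K0) hm) _.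
    by rewrite le_eqVlt; apply/orP; left; apply/eqP; rewrite /m; field; rewrite !gt_eqF.
  have eu : dot eta u = (enorm p0)^-1.
    have [_ _] := dp0; rewrite dotC dotu => e1.
    by rewrite -[LHS](mulKf (lt0r_neq0 ep0)) e1 mulr1.
  have h3 := cauchy_schwarz (w - eta) u.
  rewrite u1 mulr1 dotBl eu in h3.
  have := le_trans h3 h2; rewrite invfM ler_norml => /andP[].
  have : 0 < (enorm p0)^-1 by rewrite invr_gt0.
  by lra.
exists (Num.min d m) => [|p w pw]; first by rewrite lt_min d0.
split; first exact: key.
move=> hp; have := key _ _ (dualpairN hphi pw).
rewrite -opprD enormN => /(_ hp); rewrite dotNl; lra.
Qed.

(* Projecting q + t u back to A and letting t -> 0+ produces a normal at q on the side of u. *)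
Lemma top_normal : exists2 d : R, 0 < d & forall q, A q -> enorm (q - a) < d -> top_of q u ->
  exists w, Nphi phi A q w /\ 0 <= dot w u.
Proof.
have [cg [Cg hb]] := phistar_between hphi; have [cg0 Cg0 h1 h2 _] := hb.
have [pp0 ge pe] := dp0.
pose M := cg^-1; have M0 : 0 < M by rewrite invr_gt0.
have wM w : g w = 1 -> enorm w <= M.
  by move=> gw; rewrite /M -[leRHS]mulr1 mulrC ler_pdivlMr // mulrC -gw.
have [e0 e00 sgn] := dual_near_sign.
pose e := Num.min e0 (enorm p0 / 2).
have e_0 : 0 < e by rewrite lt_min e00 divr_gt0.
have [d d0 hd] := normals_near hphi C10 prox pp0 flat e_0.
have d2 : 0 < d / 2 by rewrite divr_gt0.
exists (d / 2) => // q Aq qa [t1 t10 ht].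
have A0 : A !=set0 by exists q.
pose B := Cg * M + 1; have B0 : 0 < B by rewrite addr_gt0 // mulr_gt0.
have BB : 0 < C1 * B ^+ 2 by rewrite mulr_gt0 // exprn_gt0.
pose K := [set w | g w = 1 /\ 0 <= dot w u].
pose t2 := Num.min t1 (Num.min (d / (2 * B)) (enorm p0 / (2 * (C1 * B ^+ 2)))).
have t20 : 0 < t2 by rewrite !lt_min t10 !divr_gt0 // mulr_gt0.
have step t : 0 < t -> t < t2 -> exists2 w, K w & rho - delta (q + rho *: w) <= Cg * B * t.
  move=> tp; rewrite !lt_min => /andP[tt1 /andP[tt2 tt3]].
  have nA := ht t tp tt1.
  have D0 := delta_gt0 hphi cA A0 nA.
  have [w hw] := nuphi_exists hphi cA (q + t *: u) A0.
  have [Ac gw Nc] := nuphiP hphi D0 hw.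
  have [D Dd] : exists D, D = delta (q + t *: u) by exists (delta (q + t *: u)).
  rewrite -Dd in D0 Ac Nc.
  have [c cd] : exists c, c = q + t *: u - D *: w by exists (q + t *: u - D *: w).
  rewrite -cd in Ac Nc.
  have [p pw] := dualpair_exists hphi gw; have [_ _ pw1] := pw.
  have Dt : D <= Cg * t.
    rewrite Dd; apply: le_trans (delta_le hphi _ Aq) _; rewrite addrAKl.
    by apply: le_trans (h2 _) _; rewrite enormZ u1 mulr1 gtr0_norm.
  have qc : q - c = D *: w - t *: u.
    by rewrite cd; apply/rowP => i; rewrite !mxE; ring.
  have qcn : enorm (q - c) <= B * t.
    rewrite qc; apply: le_trans (enormB _ _) _.
    rewrite !enormZ u1 mulr1 (gtr0_norm D0) (gtr0_norm tp).
    by have := ler_pM (ltW D0) (enorm_ge0 w) Dt (wM w gw); rewrite /B; lra.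
  have ca : enorm (c - a) < d.
    apply: le_lt_trans (enorm_dist c q a) _; rewrite (enormBC c q).
    have : B * t < d / 2 by move: tt2; rewrite ltr_pdivlMr ?mulr_gt0 //; lra.
    by lra.
  have hpr := prox Nc pw Aq.
  (* [D > 0] and the proximal inequality between [c] and [q] prevent [u . p] from being markedly
     negative, which rules out conormals near [- p0]. *)
  have pos : 0 < dot u p + C1 * B ^+ 2 * t.
    have e1 : D = t * dot u p + dot (q - c) p.
      by rewrite qc dotBl !dotZl (dotC w) pw1; ring.
    have e2 : C1 * enorm (q - c) ^+ 2 <= t * (C1 * B ^+ 2 * t).
      have -> : t * (C1 * B ^+ 2 * t) = C1 * (B * t) ^+ 2 by ring.
      by rewrite ler_pM2l // ler_pXn2r ?nnegrE ?enorm_ge0 // mulr_ge0 // ltW.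
    by rewrite -(pmulr_rgt0 _ tp) mulrDr; lra.
  have small : C1 * B ^+ 2 * t < enorm p0 / 2.
    by move: tt3; rewrite ltr_pdivlMr ?mulr_gt0 //; lra.
  have Kw : K w.
    split=> //; case: (hd c w p Nc pw ca) => near.
      apply: ltW; have [s1 _] := sgn _ _ pw; apply: s1.
      by apply: le_trans near _; rewrite ge_min lexx.
    exfalso; have := dot_le u (p + p0); rewrite u1 mul1r dotDr dotu uu mulr1.
    have : enorm (p + p0) <= enorm p0 / 2.
      by apply: le_trans near _; rewrite ge_min lexx orbT.
    by lra.
  exists w => //.
  have eq1 : delta (c + rho *: w) = rho by apply: ext => //; exact: ltW.
  rewrite -{1}eq1; apply: le_trans (ler_norm _) _.
  apply: le_trans (delta_lip hphi _ _ A0) _; apply: le_trans (h2 _) _.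
  rewrite -mulrA ler_pM2l //.
  by rewrite opprD addrACA subrr addr0 enormBC.
have [w0 Kw0 _] := step (t2 / 2) ltac:(by rewrite divr_gt0) ltac:(lra).
(* In place of a convergent sequence of directions, the defect is minimized over the compact set
   [K]: it is at most [Cg B t] for every small [t], so its minimum is not positive. *)
have [||||w [gw wu] hmin] := @EVT_enorm R n K (fun w => rho - delta (q + rho *: w)) M.
- apply: closedI; apply: enorm_closed => x /=.
    move=> hx; have d0' : 0 < `|g x - 1| by rewrite normr_gt0 subr_eq0; apply/eqP.
    exists (`|g x - 1| / Cg); first by rewrite divr_gt0.
    move=> y hy hy1; have := norm_between_dist y x hb.
    by rewrite hy1 distrC; move: hy; rewrite ltr_pdivlMr //; lra.
  move=> /negP; rewrite -ltNge => hx.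
  exists (- dot x u); first by rewrite oppr_gt0.
  move=> y hy; apply/negP; rewrite -ltNge.
  by have := dot_le (y - x) u; rewrite u1 mulr1 dotBl; lra.
- by exists w0.
- by move=> x [gx _]; exact: wM.
- move=> x e' _ e'0; exists (e' / (Cg * rho)); first by rewrite divr_gt0 // mulr_gt0.
  move=> y _; rewrite ltr_pdivlMr ?mulr_gt0 // => hy.
  have -> : rho - delta (q + rho *: y) - (rho - delta (q + rho *: x)) =
     delta (q + rho *: x) - delta (q + rho *: y) by ring.
  apply: le_lt_trans (delta_lip hphi _ _ A0) _; apply: le_lt_trans (h2 _) _.
  by rewrite opprD addrACA subrr add0r -scalerBr enormZ (gtr0_norm rho0) enormBC; lra.
exists w; split=> //; split=> //; split; first exact/(bdWphiP hphi).
exists rho; split=> //; apply/eqP; rewrite eq_le; apply/andP; split.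
  by have := delta_le hphi (q + rho *: w) Aq; rewrite addrAKl (normZ gN) gw mulr1 gtr0_norm.
rewrite -subr_le0; apply: (@le0_eps _ _ (Cg * B)) => e' e'0.
pose t := Num.min e' t2 / 2.
have m0 : 0 < Num.min e' t2 by rewrite lt_min e'0.
have m1 : Num.min e' t2 <= e' by rewrite ge_min lexx.
have m2 : Num.min e' t2 <= t2 by rewrite ge_min lexx orbT.
have [w' Kw' hw'] := step t ltac:(rewrite /t; lra) ltac:(rewrite /t; lra).
apply: le_trans (hmin w' Kw') _; apply: le_trans hw' _.
rewrite mulrC ler_wpM2r ?mulr_ge0 ?(ltW Cg0) ?(ltW B0) // /t; lra.
Qed.

(* The fixed-point relation Delta = ((q - a) + t Delta) L + o(...) for the increment Delta of
   the normal, solved for Delta. *)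
Lemma normal_field_diff (t : R) (L : 'M[R]_n.+1) (eps : R) (f : V -> R) (etat : V -> V) :
  A a -> 0 < t -> t <= rho -> Dnu_is phi A (a + t *: eta) L -> 1%:M - t *: L \in unitmx ->
  f a = 0 -> etat a = eta -> 0 < eps ->
  (forall e : R, 0 < e -> exists2 d : R, 0 < d & forall b, Uball eps a u b ->
     enorm (b - a) < d -> `|f b| <= e * enorm (b - a)) ->
  (forall b, Uball eps a u b -> Nphi phi A (b + f b *: u) (etat b) /\ 0 <= dot (etat b) u) ->
  rderiv_is (Uball eps a u) etat a (invmx (1%:M - t *: L) *m L).
Proof.
move=> Aa tp trho hL uU fa ea eps0 hf hN e e0.
have [pp0 ge pe] := dp0.
have dt : delta (a + t *: eta) = t.
  have Naeta : Nphi phi A a eta.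
    have Ua : Uball eps a u a by split; rewrite subrr ?dot0l ?enorm0.
    by have [h _] := hN a Ua; move: h; rewrite fa scale0r addr0 ea.
  by apply: ext => //; exact: ltW.
set U := 1%:M - t *: L in uU *.
have UL : U *m L = L *m U by exact: comm_resolvent.
rewrite (invmx_comm uU UL).
have [MI MI0 hMI] := mulmx_bound (invmx U).
have [ML ML0 hML] := mulmx_bound L.
have [e1 e10 sgn] := dual_near_sign.
have [K [dK [K0 dK0 hK]]] := dual_inverse_lipschitz.
pose B := 2 * MI * (ML + 1) * 2.
have B0 : 0 < B by rewrite !mulr_gt0 // addr_gt0.
(* The bound [1 / (2 MI t)] lets the occurrence of [De] on the right be absorbed; the last one
   leaves [e / 2] for the error, the other half going to [f b]. *)
pose ee := Num.min (Num.min 1 (2 * MI * t)^-1) (e / (2 * MI * (2 + t * B))).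
have tB : 0 < 2 + t * B by rewrite addr_gt0 // mulr_gt0.
have ee0 : 0 < ee by rewrite !lt_min ltr01 invr_gt0 divr_gt0 ?mulr_gt0.
have ee1 : ee <= 1 by rewrite !ge_min lexx.
have ee2 : MI * ee * t <= 2^-1.
  have : ee <= (2 * MI * t)^-1 by rewrite !ge_min lexx orbT.
  move=> /(ler_wpM2r (ltW (mulr_gt0 MI0 tp))) h; rewrite -mulrA mulrCA; apply: le_trans h _.
  by rewrite le_eqVlt; apply/orP; left; apply/eqP; field; rewrite !gt_eqF.
have ee3 : ee * (2 * MI * (2 + t * B)) <= e.
  have : ee <= e / (2 * MI * (2 + t * B)) by rewrite !ge_min lexx !orbT.
  by rewrite ler_pdivlMr // !mulr_gt0.
have [d1 d10 hd1] := nu_diff hphi Aa tp dt dp0 hL ee0.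
pose en := Num.min (Num.min e1 dK) (d1 / (4 * t * K)).
have en0 : 0 < en by rewrite !lt_min e10 dK0 divr_gt0 ?mulr_gt0.
have [d2 d20 hd2] := normals_near hphi C10 prox pp0 flat en0.
have [d3 d30 hd3] := hf 1 ltr01.
have [d4 d40 hd4] := hf (e / (2 * MI * ML)) ltac:(by rewrite divr_gt0 ?mulr_gt0).
exists (Num.min (Num.min d3 d4) (Num.min (d1 / 8) (d2 / 2))); split.
  by rewrite !lt_min d30 d40 !divr_gt0.
move=> b Ub; rewrite !lt_min => /andP[/andP[b3 b4] /andP[b1 b2]].
have [Nq wu] := hN b Ub; set q := b + f b *: u in Nq *; set w := etat b in Nq wu *.
have f3 := hd3 b Ub b3; rewrite mul1r in f3.
have f4 := hd4 b Ub b4.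
have [Aq [/(bdWphiP hphi) gw _]] := Nq.
have [p pw] := dualpair_exists hphi gw.
have qa : q - a = (b - a) + f b *: u by rewrite /q; apply/rowP => i; rewrite !mxE; ring.
have qan : enorm (q - a) <= 2 * enorm (b - a).
  by rewrite qa; apply: le_trans (enormD _ _) _; rewrite enormZ u1 mulr1; lra.
have near : enorm (p - p0) <= en.
  case: (hd2 q w p Nq pw ltac:(lra)) => // near.
  have [_ s2] := sgn _ _ pw; have := s2 (le_trans near _).
  by rewrite !ge_min lexx => /(_ isT); lra.
have wn : enorm (w - eta) <= d1 / (4 * t).
  have near2 : enorm (p - p0) <= dK by apply: le_trans near _; rewrite !ge_min lexx orbT.
  have near3 : enorm (p - p0) <= d1 / (4 * t * K) by apply: le_trans near _; rewrite !ge_min lexx orbT.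
  apply: le_trans (hK _ _ _ _ dp0 pw near2) _; apply: le_trans (ler_wpM2l (ltW K0) near3) _.
  by rewrite le_eqVlt; apply/orP; left; apply/eqP; field; rewrite !gt_eqF.
have dz : delta (q + t *: w) = t by apply: ext => //; exact: ltW.
have hnu := nuphi_mem hphi tp Aq gw dz.
have [k kd] : exists k, k = q - a by exists (q - a).
have [De Ded] : exists De, De = w - eta by exists (w - eta).
have zx : q + t *: w - (a + t *: eta) = k + t *: De.
  by rewrite kd Ded; apply/rowP => i; rewrite !mxE; ring.
have [|_ _ _ H] := hd1 _ _ _ hnu.
  rewrite zx; apply: le_lt_trans (enormD _ _) _; rewrite enormZ (gtr0_norm tp) Ded kd.
  have : t * enorm (w - eta) <= d1 / 4.
    apply: le_trans (ler_wpM2l (ltW tp) wn) _.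
    by rewrite le_eqVlt; apply/orP; left; apply/eqP; field; rewrite gt_eqF.
  by move: qan b1 d10; lra.
rewrite zx -Ded in H.
have [err errd] : exists err, err = De - (k + t *: De) *m L by exists (De - (k + t *: De) *m L).
rewrite -errd in H.
(* Moving [t De L] to the left turns the relation [De = (k + t De) L + err] into
   [De U = k L + err]. *)
have DU : De = (k *m L + err) *m invmx U.
  rewrite -[LHS](mulmxK uU); congr (_ *m _).
  rewrite errd /U mulmxBr mulmx1 -scalemxAr mulmxDl -scalemxAl.
  by move: (k *m L) (De *m L) => k1 k2; apply/rowP => i; rewrite !mxE; ring.
have Hn : enorm err <= ee * (enorm k + t * enorm De).
  apply: le_trans H _; rewrite ler_wpM2l ?(ltW ee0) //.
  by apply: le_trans (enormD _ _) _; rewrite enormZ (gtr0_norm tp).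
have ek := enorm_ge0 k; have eD := enorm_ge0 De.
have Dn : enorm De <= B / 2 * enorm k.
  have c1 : enorm De <= MI * (ML * enorm k + ee * (enorm k + t * enorm De)).
    rewrite {1}DU; apply: le_trans (hMI _) _; rewrite ler_pM2l //.
    by apply: le_trans (enormD _ _) _; apply: lerD; [exact: hML|exact: Hn].
  have c2 : MI * ee * t * enorm De <= 2^-1 * enorm De by rewrite ler_wpM2r.
  have c3 : MI * (ee * enorm k) <= MI * enorm k by rewrite ler_pM2l // -[leRHS]mul1r ler_wpM2r.
  by rewrite /B; move: c1 c2 c3; lra.
have ekb : enorm k <= 2 * enorm (b - a) by rewrite kd.
rewrite ea -Ded mulmxA.
have -> : De - (b - a) *m L *m invmx U = (err + f b *: (u *m L)) *m invmx U.
  rewrite {1}DU -mulmxBl; congr (_ *m _).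
  have -> : k *m L = (b - a) *m L + f b *: (u *m L).
    by rewrite kd qa mulmxDl -scalemxAl.
  by move: ((b - a) *m L) (u *m L) => k1 k2; apply/rowP => i; rewrite !mxE; ring.
apply: le_trans (hMI _) _; apply: le_trans (ler_wpM2l (ltW MI0) (enormD _ _)) _.
have s1 : MI * enorm err <= e / 2 * enorm (b - a).
  have q1 : enorm err <= ee * (2 + t * B) * enorm (b - a).
    apply: le_trans Hn _; rewrite -mulrA ler_pM2l //.
    have := ler_wpM2l (ltW tp) Dn.
    have : t * (B / 2 * enorm k) <= t * (B / 2 * (2 * enorm (b - a))).
      by rewrite ler_pM2l // ler_pM2l // divr_gt0.
    by move: ekb; lra.
  apply: le_trans (ler_wpM2l (ltW MI0) q1) _.
  by have := ler_wpM2r (enorm_ge0 (b - a)) ee3; lra.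
have s2 : MI * enorm (f b *: (u *m L)) <= e / 2 * enorm (b - a).
  rewrite enormZ; have uL : enorm (u *m L) <= ML by have := hML u; rewrite u1 mulr1.
  apply: le_trans (ler_wpM2l (ltW MI0) (ler_pM (normr_ge0 _) (enorm_ge0 _) f4 uL)) _.
  by rewrite le_eqVlt; apply/orP; left; apply/eqP; field; rewrite !gt_eqF.
by rewrite mulrDr; move: s1 s2; lra.
Qed.

End NormalField.

(** * Principal curvatures *)

Section CharPoly.
Context {R : realType} {n : nat}.
Notation V := 'rV[R]_(n.+1).
Implicit Types (u v w : V) (L B M : 'M[R]_n.+1) (s : seq R).

Lemma horner_char_poly M (x : R) : (char_poly M).[x] = \det (x%:M - M).
Proof.
rewrite -horner_evalE -det_map_mx; congr (\det _); apply/matrixP => i j.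
by rewrite !mxE /= horner_evalE !(hornerE, hornerMn).
Qed.

(** Two triangularizations of the block matrix [D]; the second brings a factor [\det 'X%:M], which
    is cancelled in the domain of polynomials. *)
Lemma char_poly_mulC M B : char_poly (M *m B) = char_poly (B *m M).
Proof.
rewrite /char_poly /char_poly_mx !map_mxM.
set A := map_mx _ M; set C := map_mx _ B.
have X0 : \det ('X%:M : 'M[{poly R}]_n.+1) != 0.
  by rewrite det_scalar expf_neq0 // polyX_eq0.
pose D := block_mx 'X%:M A C 1%:M.
have e1 : D *m block_mx 1%:M 0 (- C) 1%:M = block_mx ('X%:M - A *m C) A 0 1%:M.
  rewrite mulmx_block !mulmx1 !mul1mx !mulmx0 !add0r mulmxN.
  by rewrite addrC [C + _]subrr addrC.
have e2 : block_mx 1%:M 0 (- C) 'X%:M *m D = block_mx 'X%:M A 0 ('X%:M - C *m A).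
  rewrite mulmx_block !mul1mx !mul0mx !addr0 !mulmx1 mulNmx.
  rewrite mul_mx_scalar mul_scalar_mx addNr.
  by rewrite mulNmx addrC.
have := congr1 determinant e1; rewrite det_mulmx det_lblock det_ublock !det1 !mulr1 => d1.
have := congr1 determinant e2; rewrite det_mulmx det_lblock det_ublock !det1 mul1r => d2.
by apply: (mulfI X0); rewrite -d1.
Qed.

(** [L] maps into the orthogonal complement of [w], so projecting after [L] changes nothing; the
    characteristic polynomial does not see the order of the factors. *)
Lemma char_poly_projperp L w : enorm w = 1 -> (forall v, dot (v *m L) w = 0) ->
  char_poly (projperp w *m L) = char_poly L.
Proof.
move=> w1 hL; rewrite char_poly_mulC; congr char_poly.
rewrite /projperp mulmxBr mulmx1 mulmxA.
suff -> : L *m w^T = 0 by rewrite mul0mx subr0.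
apply/matrixP => i j; rewrite ord1 [RHS]mxE -(hL (delta_mx 0 i)) dotE -rowE.
by rewrite -row_mul !mxE.
Qed.

Lemma poly_eq_off_point (p q : {poly R}) (c : R) :
  (forall x, x != c -> p.[x] = q.[x]) -> p = q.
Proof.
move=> h; apply/eqP; rewrite -subr_eq0; apply/negPn/negP => pq.
pose f := (p - q) * ('X - c%:P).
have f0 : f != 0 by rewrite mulf_neq0 // polyXsubC_eq0.
have fx x : f.[x] = 0.
  rewrite /f !hornerE; have [->|xc] := eqVneq x c; first by rewrite subrr mulr0.
  by rewrite h // subrr mul0r.
have := max_poly_roots (rs := [seq i%:R : R | i <- iota 0 (size f)]) f0.
rewrite size_map size_iota ltnn => H.
suff : false by []; apply: H.
  by apply/allP => x _; rewrite rootE fx.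
by rewrite map_inj_uniq ?iota_uniq // => i j /eqP; rewrite eqr_nat => /eqP.
Qed.

Lemma det_resolvent L s (r : R) : r != 0 -> size s = n ->
  char_poly L = 'X * \prod_(t <- s) ('X - t%:P) ->
  \det (1%:M - r *: L) = \prod_(t <- s) (1 - r * t).
Proof.
move=> r0 ss hL.
have -> : 1%:M - r *: L = r *: ((r^-1)%:M - L).
  by rewrite scalerBr scale_scalar_mx mulfV.
rewrite detZ -horner_char_poly hL hornerM hornerX horner_prod exprS.
rewrite mulrACA mulfV // mul1r -ss.
elim: s {ss hL} => [|t s IH]; first by rewrite !big_nil mulr1.
rewrite !big_cons /= exprS mulrACA IH; congr (_ * _).
by rewrite !hornerE mulrBr mulfV.
Qed.

(** Determinants of [U (x - U^-1 L) = (1 + r x) (x / (1 + r x) - L)], where [U = 1 - r L]. The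
    excluded value [x = - 1 / r] is recovered by polynomial identity. *)
Lemma char_poly_resolvent L s (r : R) : r != 0 -> size s = n ->
  char_poly L = 'X * \prod_(t <- s) ('X - t%:P) -> 1%:M - r *: L \in unitmx ->
  char_poly (invmx (1%:M - r *: L) *m L) = 'X * \prod_(t <- kappa_of r s) ('X - t%:P).
Proof.
move=> r0 ss hL uU; have dU := det_resolvent r0 ss hL.
set U := 1%:M - r *: L in uU dU *.
have dU0 : \det U != 0 by rewrite unitmxE unitfE in uU.
have rt t : t \in s -> 1 - r * t != 0.
  move=> ts; apply: contra_neq dU0 => e; rewrite dU.
  by rewrite (perm_big _ (perm_to_rem ts)) big_cons /= e mul0r.
apply: (@poly_eq_off_point _ _ (- r^-1)) => x xr.
have rx : 1 + r * x != 0.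
  apply: contra_neq xr => /eqP; rewrite addrC addr_eq0 => /eqP e.
  by rewrite -[x](mulKf r0) e mulrN1.
rewrite horner_char_poly hornerM hornerX horner_prod.
apply: (mulfI dU0); rewrite -det_mulmx.
have -> : U *m (x%:M - invmx U *m L) = (1 + r * x) *: ((x / (1 + r * x))%:M - L).
  rewrite mulmxBr mulmxA mulmxV // mul1mx /U mul_mx_scalar.
  by apply/matrixP => i j; rewrite !mxE; case: (i == j); rewrite ?mulr1n ?mulr0n; field.
rewrite detZ -horner_char_poly hL hornerM hornerX horner_prod exprS mulrACA.
rewrite [X in X * _ = _]mulrC divfK // dU [RHS]mulrCA; congr (_ * _).
rewrite -ss /kappa_of big_map.
elim: s {ss hL dU} rt => [|t s IH] rt; first by rewrite !big_nil mulr1.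
rewrite !big_cons /= exprS mulrACA IH => [|t' ts]; last by apply: rt; rewrite inE ts orbT.
rewrite [RHS]mulrACA; congr (_ * _); rewrite !hornerE.
have := rt t; rewrite inE eqxx => /(_ isT) h.
by field; rewrite rx h.
Qed.

Lemma eigs_perp_charE L w s : enorm w = 1 -> (forall v, dot (v *m L) w = 0) ->
  eigs_perp L w s -> char_poly L = 'X * \prod_(t <- s) ('X - t%:P).
Proof. by move=> w1 hL [_ [_]]; rewrite char_poly_projperp. Qed.

Lemma eigs_perp_eigenvector L s t : char_poly L = 'X * \prod_(t <- s) ('X - t%:P) ->
  t \in s -> exists2 v : V, v != 0 & v *m L = t *: v.
Proof.
move=> hL ts; have : eigenvalue L t.
  by rewrite eigenvalue_root_char hL rootM root_prod_XsubC ts orbT.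
by move=> /eigenvalueP[v hv v0]; exists v.
Qed.

Lemma kappa_sorted (r : R) s : 0 < r -> sorted <=%R s -> all (fun t => r * t < 1) s ->
  sorted <=%R (kappa_of r s).
Proof.
move=> r0 ss hs; apply: (@homo_sorted_in _ _ [pred t | r * t < 1] _ <=%R) => //.
move=> x y; rewrite !inE => hx hy xy.
have x1 : 0 < 1 - r * x by rewrite subr_gt0.
rewrite ler_pdivrMr // mulrAC ler_pdivlMr //; lra.
Qed.

(* L is self-adjoint for the inner product given by B. *)
Lemma self_adjoint_real_eigs L B w : enorm w = 1 -> (forall v, dot (v *m L) w = 0) ->
  (forall u v, dot (u *m (L *m B)) v = dot (v *m (L *m B)) u) ->
  (forall u v, dot (u *m B) v = dot (v *m B) u) ->
  (forall v, v != 0 -> 0 < dot (v *m B) v) ->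
  exists s, eigs_perp L w s.
Proof.
move=> w1 hL symLB symB posB.
pose toC := real_complex R.
have [zs hzs] := closed_field_poly_normal (map_poly toC (char_poly L)).
have mon : lead_coef (map_poly toC (char_poly L)) = 1.
  by rewrite lead_coef_map (monicP (char_poly_monic L)) rmorph1.
rewrite mon scale1r in hzs.
have real z : z \in zs -> complex.Im z = 0.
  move=> zin.
  have : eigenvalue (map_mx toC L) z.
    by rewrite eigenvalue_root_char -map_char_poly hzs root_prod_XsubC.
  move=> /eigenvalueP[v hv v0].
  pose al : V := map_mx (@complex.Re R) v; pose be : V := map_mx (@complex.Im R) v.
  have ReD (x y : R[i]) : complex.Re (x + y) = complex.Re x + complex.Re y by case: x y => ? ? [].
  have ImD (x y : R[i]) : complex.Im (x + y) = complex.Im x + complex.Im y by case: x y => ? ? [].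
  have eRe : al *m L = complex.Re z *: al - complex.Im z *: be.
    apply/rowP => j; have := congr1 (fun m : 'rV[R[i]]_n.+1 => complex.Re (m 0 j)) hv.
    rewrite !mxE => E; transitivity (complex.Re (\sum_k v 0 k * map_mx toC L k j)).
      rewrite (big_morph _ ReD (erefl _)); apply: eq_bigr => k _; rewrite !mxE.
      by case: (v 0 k) => x y /=; rewrite mulr0 subr0.
    by rewrite E; case: z {zin hv E} => x y; case: (v 0 j).
  have eIm : be *m L = complex.Re z *: be + complex.Im z *: al.
    apply/rowP => j; have := congr1 (fun m : 'rV[R[i]]_n.+1 => complex.Im (m 0 j)) hv.
    rewrite !mxE => E; transitivity (complex.Im (\sum_k v 0 k * map_mx toC L k j)).
      rewrite (big_morph _ ImD (erefl _)); apply: eq_bigr => k _; rewrite !mxE.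
      by case: (v 0 k) => x y /=; rewrite mulr0 add0r.
    by rewrite E; case: z {zin hv E eRe} => x y; case: (v 0 j).
  (* Self-adjointness on the real and imaginary parts of an eigenvector says that [Im z] times a
     positive number vanishes. *)
  have s1 := symLB al be; rewrite !mulmxA eRe eIm in s1.
  rewrite mulmxBl mulmxDl -!scalemxAl !(dotDl, dotNl, dotZl) (symB be al) in s1.
  have s2 : complex.Im z * (dot (al *m B) al + dot (be *m B) be) = 0 by lra.
  have pos0 y : 0 <= dot (y *m B) y.
    by have [->|y0] := eqVneq y 0; [rewrite mul0mx dot0l|rewrite ltW // posB].
  apply/eqP; move/eqP: s2; rewrite mulf_eq0 => /orP[//|]; rewrite paddr_eq0 // => /andP[h1 h2].
  case/negP: v0; apply/eqP/rowP => j; rewrite mxE.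
  have a0 : al = 0.
    by apply: contrapT => /eqP /posB; rewrite (eqP h1) ltxx.
  have b0 : be = 0.
    by apply: contrapT => /eqP /posB; rewrite (eqP h2) ltxx.
  have := congr1 (fun m : V => m 0 j) a0; have := congr1 (fun m : V => m 0 j) b0.
  by rewrite !mxE; case: (v 0 j) => x y /= -> ->.
pose rs := [seq complex.Re z | z <- zs].
have hrs : char_poly L = \prod_(t <- rs) ('X - t%:P).
  apply: (map_poly_inj toC); rewrite hzs rmorph_prod big_map.
  apply: eq_big_seq => z zin; rewrite rmorphB /= map_polyX map_polyC /=; congr (_ - _%:P).
  by have := real z zin; case: z {zin} => x y /= ->.
(* The transpose of [L] annihilates [w]; this root is the factor ['X] that has to be split off. *)
have r0 : 0 \in rs.
  rewrite -root_prod_XsubC -hrs rootE horner_char_poly.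
  have -> : \det (0%:M - L) = \det (0%:M - L)^T by rewrite det_tr.
  apply/det0P; exists w.
    by apply/eqP => e; move: w1; rewrite e enorm0 => /eqP; rewrite eq_sym oner_eq0.
  rewrite raddf0 sub0r linearN mulmxN; apply/eqP; rewrite oppr_eq0; apply/eqP.
  by apply: dot_eq0; rewrite dot_mulmx trmxK dotC hL.
pose s := sort <=%R (rem 0 rs).
have prs : perm_eq rs (0 :: s).
  apply: perm_trans (perm_to_rem r0) _; rewrite perm_cons perm_sym.
  by rewrite perm_sort.
have srs : size rs = n.+1.
  by apply/eqP; rewrite -eqSS -(size_prod_XsubC rs id) -hrs size_char_poly.
exists s; split; first by have := perm_size prs; rewrite srs => -[].
split; first by apply: sort_sorted; exact: le_total.
by rewrite char_poly_projperp // hrs (perm_big _ prs) big_cons /= subr0.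
Qed.

End CharPoly.

(** * Curvature data and construction of the graphs *)

Section Assembly.
Context {R : realType} {n : nat}.
Notation V := 'rV[R]_(n.+1).
Implicit Types (a u v w x y z b c p q k eta : V).
Context (phi : V -> R) (hphi : admissible_norm phi).
Context (A : set V) (cA : closed A) (reachA : (0 < reach A)%E).
Notation g := (phistar phi).
Notation dual := (dualpair phi).
Notation delta := (dphi phi A).
Let pN : is_norm phi := phi_norm hphi.

Lemma unit_normal_gt0 p eta : dual p eta -> 0 < enorm p.
Proof. by move=> h; apply: enorm_gt0; have [] := dualpair_neq0 hphi h. Qed.

(** The point [grad phi w] of the Wulff shape gives [phi w <= w . eta]; duality gives the
    converse. *)
Lemma ext_normal_dual eta w : ext_normal phi eta w -> dual ((phi w)^-1 *: w) eta.
Proof.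
move=> [/(bdWphiP hphi) ge [w1 hw]].
have w0 : w != 0 by apply: (norm_neq0 (@enorm_is_norm R n)); rewrite w1.
have pw := norm_gt0 pN w0.
have gs := gradient_scale hphi w0; have [_ gG _] := gs.
have h1 := hw (grad phi w); rewrite /Wphi /= gG lexx in h1.
have h2 := h1 isT; rewrite dotBr (grad_eq hphi w0) in h2.
have h3 := dual_le hphi eta w; rewrite ge mulr1 in h3.
split=> //; first by rewrite (normZ pN) gtr0_norm ?invr_gt0 // mulVf // gt_eqF.
by rewrite dotZl; have -> : dot w eta = phi w by [lra|]; rewrite mulVf // gt_eqF.
Qed.

Lemma dual_ext_normal p eta : dual p eta -> ext_normal phi eta ((enorm p)^-1 *: p).
Proof.
move=> h; have ep := unit_normal_gt0 h; have [pp ge pe] := h.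
split; first exact/(bdWphiP hphi).
split; first by rewrite enormZ gtr0_norm ?invr_gt0 // mulVf // gt_eqF.
move=> z; rewrite /Wphi /= => gz; rewrite dotZl pmulr_rle0 ?invr_gt0 // dotBr pe.
by have := dualpair_lestar hphi z h; lra.
Qed.

Lemma is_grad_dual u eta : enorm u = 1 -> is_grad phi u eta -> dual ((phi u)^-1 *: u) eta.
Proof.
move=> u1 hg.
have u0 : u != 0 by apply: (norm_neq0 (@enorm_is_norm R n)); rewrite u1.
have -> : eta = grad phi u.
  apply/rowP => i; rewrite mxE; have [_ ->] := hg (ebasis i).
  rewrite /dot (bigD1 i) //= big1 ?addr0 => [|j ji].
    by rewrite !mxE !eqxx mulr1.
  by rewrite !mxE eqxx /= (negbTE ji) mulr0.
exact: gradient_scale.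
Qed.

Lemma chi_list_data a eta p0 (r : R) s : A a -> dual p0 eta -> 0 < r ->
  delta (a + r *: eta) = r -> chi_list phi A (a + r *: eta) s ->
  exists L, [/\ Dnu_is phi A (a + r *: eta) L, forall v, dot (v *m L) p0 = 0, size s = n,
    sorted <=%R s & char_poly L = 'X * \prod_(t <- s) ('X - t%:P)].
Proof.
move=> Aa dp0 r0 dr [L [v0 [w [hL [ev [ew he]]]]]].
have := nu_at hphi Aa r0 dr dp0 hL; rewrite ev => e.
have v0E : v0 = eta by have : [set v0] eta by rewrite e.
rewrite v0E in ew.
have tg := derivative_tangent hphi cA Aa r0 dr dp0 hL.
have [_ [w1 _]] := ew.
have pw : 0 < phi w by apply: (norm_gt0 pN); apply: (norm_neq0 (@enorm_is_norm R n)); rewrite w1.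
have p0w := dual_uniq hphi dp0 (ext_normal_dual ew).
have tw v : dot (v *m L) w = 0.
  have := tg v; rewrite p0w dotZr => /eqP; rewrite mulf_eq0 invr_eq0 gt_eqF //= => /eqP //.
have [ss [so _]] := he.
by exists L; split=> //; exact: eigs_perp_charE he.
Qed.

Lemma tNphin_data a eta : tNphin phi A a eta -> exists p0 (r : R) (L : 'M[R]_n.+1),
  [/\ Nphi phi A a eta, dual p0 eta,
      [/\ 0 < r, delta (a + r *: eta) = r & Dnu_is phi A (a + r *: eta) L] &
      1%:M - r *: L \in unitmx].
Proof.
move=> [[Na _] [r [s [r0 [hr [hc /allP hs]]]]]].
have [Aa [/(bdWphiP hphi) ge _]] := Na.
have [p0 dp0] := dualpair_exists hphi ge.
have dr := urphi_delta hphi cA Aa ge r0 hr.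
have [L [hL _ ss _ hch]] := chi_list_data Aa dp0 r0 dr hc.
exists p0, r, L; split=> //.
rewrite unitmxE unitfE (det_resolvent (lt0r_neq0 r0) ss hch) prodf_seq_neq0.
by apply/allP => t /hs /=; rewrite subr_eq0 eq_sym.
Qed.

(** Both derivatives are transported to a common height below [r] and [r'], where the derivative is
    unique; the resolvent identity leads back up. *)
Lemma resolvent_invariant a eta p0 (r r' : R) (L L' : 'M[R]_n.+1) : A a -> dual p0 eta ->
  0 < r -> delta (a + r *: eta) = r -> Dnu_is phi A (a + r *: eta) L ->
  0 < r' -> delta (a + r' *: eta) = r' -> Dnu_is phi A (a + r' *: eta) L' ->
  1%:M - r *: L \in unitmx -> 1%:M - r' *: L' \in unitmx /\
    invmx (1%:M - r' *: L') *m L' = invmx (1%:M - r *: L) *m L.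
Proof.
move=> Aa dp0 r0 dr hL r'0 dr' hL' uL.
have [t0 t00 tr] := Dnu_transport hphi cA reachA.
pose m := Num.min (Num.min r r') t0; have m0 : 0 < m by rewrite !lt_min r0 r'0.
pose t := m / 2; have tp : 0 < t by rewrite divr_gt0.
have tm : t < m by rewrite /t; lra.
move: (tm); rewrite !lt_min => /andP[/andP[tr1 tr2] tt0].
have [u1 h1] := tr _ _ _ _ _ _ Aa dp0 dr hL tp tr1 (ltW tt0).
have [u2 h2] := tr _ _ _ _ _ _ Aa dp0 dr' hL' tp tr2 (ltW tt0).
have [ge0 ge _] := dp0.
have dt : delta (a + t *: eta) = t.
  have [cg [Cg hb]] := phistar_between hphi.
  exact: (dist_ray hb Aa ge dr (ltW tp) (ltW tr1)).
have e := Dnu_unique hphi cA (ex_intro _ a Aa) (_ : 0 < delta (a + t *: eta)) h1 h2.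
have [v1 w1] := transport_resolvent u1; have [v2 w2] := transport_resolvent u2.
have {}e : invmx (1%:M - (r - t) *: L) *m L = invmx (1%:M - (r' - t) *: L') *m L'.
  by apply: e; rewrite dt.
have uL' : 1%:M - r' *: L' \in unitmx by rewrite -v2 -e v1.
by split=> //; rewrite -w1 // -w2 // e.
Qed.

Lemma prox_below C1 a eta p0 : proximal_bound phi A C1 -> Nphi phi A a eta -> dual p0 eta ->
  forall q, A q -> dot (q - a) p0 <= C1 * enorm (q - a) ^+ 2.
Proof. by move=> prox Na dp0 q Aq; exact: prox Na dp0 Aq. Qed.

(** [boundary_graph] lives over the hyperplane orthogonal to [p0], the wanted function over the one
    orthogonal to [nu]. Sliding [b - a] along [nu] by [h b] reaches the former at [vv b]; the linear
    [h] carries the whole derivative, as [T] is of smaller order. *)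
Lemma graph_function C1 a eta p0 nu : 0 < C1 -> proximal_bound phi A C1 ->
  Nphi phi A a eta -> dual p0 eta -> flat_at A a p0 -> enorm nu = 1 -> 0 < dot nu p0 ->
  exists (eps : R) (f : V -> R), 0 < eps /\ rdiff_scalar (Uball eps a nu) f a /\
    (forall b, Uball eps a nu b -> bdry A (b + f b *: nu)).
Proof.
move=> C10 prox Na dp0 flat nu1 nup; have [Aa _] := Na; have [pp0 _ _] := dp0.
have [d [T [d0 hT T0 oT]]] := boundary_graph hphi cA C10 prox Aa pp0 flat
  (prox_below prox Na dp0) nu1 nup.
pose mu := dot nu p0; pose h b := - dot (b - a) p0 / mu.
pose vv b := b - a + h b *: nu.
pose M := 1 + enorm p0 / mu.
have M0 : 0 < M by rewrite ltr_pwDl // divr_ge0 ?enorm_ge0 // ltW.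
have vp b : dot (vv b) p0 = 0.
  by rewrite dotDl dotZl -/mu /h divfK ?gt_eqF // subrr.
have vn b : enorm (vv b) <= M * enorm (b - a).
  apply: le_trans (enormD _ _) _; rewrite enormZ nu1 mulr1 /M mulrDl mul1r lerD2l /h.
  have mi : 0 < mu^-1 by rewrite invr_gt0.
  rewrite normrM normrN (gtr0_norm mi) mulrAC ler_wpM2r ?(ltW mi) //.
  by rewrite mulrC cauchy_schwarz.
have f0 : h a + T (vv a) = 0.
  have ha : h a = 0 by rewrite /h subrr dot0l oppr0 mul0r.
  by rewrite /vv ha subrr scale0r addr0 T0 addr0.
exists (d / M), (fun b => h b + T (vv b)); split; first by rewrite divr_gt0.
split; last first.
  move=> b [_ hb].
  have vd : enorm (vv b) < d.
    by apply: le_lt_trans (vn b) _; rewrite mulrC -ltr_pdivlMr.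
  have [Aq [t1 t10 ht1]] := hT _ (vp b) vd.
  have E (t : R) : b + (h b + T (vv b) + t) *: nu = a + vv b + (T (vv b) + t) *: nu.
    by rewrite /vv; move: (T _) => tt; apply/rowP => i; rewrite !mxE; ring.
  have E0 : b + (h b + T (vv b)) *: nu = a + vv b + T (vv b) *: nu.
    by have := E 0; rewrite !addr0.
  apply: (top_bdry nu1); first by rewrite E0.
  exists t1 => // t tp tt; rewrite E0 -addrA -scalerDl; exact: ht1.
exists (- mu^-1 *: p0) => e e0.
have [d' d'0 hd'] := oT (e / M) ltac:(by rewrite divr_gt0).
exists (d' / M); split; first by rewrite divr_gt0.
move=> b _ hb.
have vd : enorm (vv b) < d' by apply: le_lt_trans (vn b) _; rewrite mulrC -ltr_pdivlMr.
have -> : h b + T (vv b) - (h a + T (vv a)) - dot (- mu^-1 *: p0) (b - a) = T (vv b).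
  by rewrite f0 dotZl (dotC p0) /h; ring.
apply: le_trans (hd' _ (vp b) vd) _.
apply: le_trans (ler_wpM2l _ (vn b)) _; first by rewrite divr_ge0 ?(ltW e0) ?(ltW M0).
by rewrite mulrA divfK // gt_eqF.
Qed.

Lemma graph_function_any C1 a eta p0 nu : 0 < C1 -> proximal_bound phi A C1 ->
  Nphi phi A a eta -> dual p0 eta -> flat_at A a p0 -> enorm nu = 1 -> dot nu p0 != 0 ->
  exists (eps : R) (f : V -> R), 0 < eps /\ rdiff_scalar (Uball eps a nu) f a /\
    (forall b, Uball eps a nu b -> bdry A (b + f b *: nu)).
Proof.
move=> C10 prox Na dp0 flat nu1; rewrite neq_lt => /orP[neg|pos]; last exact: (graph_function C10 prox Na dp0 flat nu1 pos).
have [||eps [f [eps0 [[G hG] hb]]]] := graph_function C10 prox Na dp0 flat (nu := - nu).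
- by rewrite enormN.
- by rewrite dotNl oppr_gt0.
have UN b : Uball eps a nu b -> Uball eps a (- nu) b.
  by move=> [h1 h2]; split=> //; rewrite dotNr h1 oppr0.
exists eps, (fun b => - f b); split=> //; split.
  exists (- G) => e e0; have [d [d0 hd]] := hG e e0; exists d; split=> // b Ub hbd.
  have := hd b (UN b Ub) hbd; rewrite dotNl -normrN.
  by congr (is_true (`|_| <= _)); ring.
by move=> b /UN /hb; rewrite scalerN scaleNr.
Qed.

Lemma normal_graph C1 rho a eta p0 u (r : R) (L : 'M[R]_n.+1) : 0 < C1 ->
  proximal_bound phi A C1 -> 0 < rho ->
  (forall c w (t : R), Nphi phi A c w -> 0 <= t -> t <= rho -> delta (c + t *: w) = t) ->
  Nphi phi A a eta -> dual p0 eta -> flat_at A a p0 -> enorm u = 1 -> p0 = enorm p0 *: u ->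
  0 < r -> delta (a + r *: eta) = r -> Dnu_is phi A (a + r *: eta) L ->
  1%:M - r *: L \in unitmx ->
  exists (eps : R) (f : V -> R), 0 < eps /\ rdiff_scalar (Uball eps a u) f a /\
    (forall b, Uball eps a u b -> bdry A (b + f b *: u)) /\
    exists etat : V -> V, (forall b, Uball eps a u b ->
        bdWphi phi (etat b) /\ Nphi phi A (b + f b *: u) (etat b)) /\
      etat a = eta /\ rderiv_is (Uball eps a u) etat a (invmx (1%:M - r *: L) *m L).
Proof.
move=> C10 prox rho0 ext Na dp0 flat u1 p0u r0 dr hL uL.
have [Aa _] := Na; have [pp0 ge pe] := dp0; have ep := unit_normal_gt0 dp0.
have uu : dot u u = 1 by rewrite -enorm_sqr u1 expr1n.
have up : 0 < dot u p0 by rewrite p0u dotZr uu mulr1.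
have perp b (eps : R) : Uball eps a u b -> dot (b - a) p0 = 0.
  by move=> [h _]; rewrite p0u dotZr h mulr0.
have [d [T [d0 hT T0 oT]]] := boundary_graph hphi cA C10 prox Aa pp0 flat
  (prox_below prox Na dp0) u1 up.
have [d1 d10 hd1] := top_normal hphi cA C10 prox rho0 ext dp0 u1 p0u flat.
have [d2 d20 hd2] := oT 1 ltr01.
pose f b := T (b - a).
pose eps := Num.min (Num.min d d2) (d1 / 2).
have eps0 : 0 < eps by rewrite !lt_min d0 d20 divr_gt0.
have fa : f a = 0 by rewrite /f subrr.
have qE b : b + f b *: u = a + (b - a) + T (b - a) *: u by rewrite (addrC a) subrK.
have main b : Uball eps a u b -> A (b + f b *: u) /\ top_of A (b + f b *: u) u.
  move=> Ub; have [_] := Ub; rewrite !lt_min => /andP[/andP[b1 b2] b3].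
  have [Aq [t1 t10 ht1]] := hT _ (perp _ _ Ub) b1.
  rewrite qE; split=> //; exists t1 => // t tp tt.
  by rewrite -addrA -scalerDl; exact: ht1.
pose P b w := Nphi phi A (b + f b *: u) w /\ 0 <= dot w u.
have Pex b : Uball eps a u b -> exists w, P b w.
  move=> Ub; have [Aq tq] := main b Ub; apply: hd1 => //.
  have [_] := Ub; rewrite !lt_min => /andP[/andP[b1 b2] b3].
  have -> : b + f b *: u - a = (b - a) + f b *: u by rewrite addrAC.
  apply: le_lt_trans (enormD _ _) _; rewrite enormZ u1 mulr1.
  by have := hd2 _ (perp _ _ Ub) b2; rewrite -/(f b); lra.
have Pa : P a eta.
  split; first by rewrite fa scale0r addr0.
  by move: pe; rewrite p0u dotZl dotC => e; rewrite -(pmulr_rge0 _ ep) e ler01.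
(* The value at [a] is prescribed; elsewhere any normal on the side of [u] serves, the expansion at
   [a] being uniform over all of them. *)
pose etat b := if b == a then eta else xget 0 (P b).
have etaP b : Uball eps a u b -> P b (etat b).
  move=> Ub; rewrite /etat; have [->|_] := eqVneq b a; first exact: Pa.
  by have [w hw] := Pex b Ub; case: xgetP => [y _ //|/(_ w)/(_ hw)].
have oU (e : R) : 0 < e -> exists2 d' : R, 0 < d' & forall b, Uball eps a u b ->
    enorm (b - a) < d' -> `|f b| <= e * enorm (b - a).
  move=> e0; have [d' d'0 hd'] := oT e e0; exists d' => // b Ub; exact: hd' (perp _ _ Ub).
exists eps, f; split=> //; split.
  exists 0 => e e0; have [d' d'0 hd'] := oU e e0; exists d'; split=> // b Ub hb.
  by rewrite fa dot0l !subr0; exact: hd'.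
split.
  by move=> b Ub; have [Aq tq] := main b Ub; exact: top_bdry u1 Aq tq.
exists etat; split.
  by move=> b Ub; have [Nq _] := etaP b Ub; have [_ []] := Nq.
split; first by rewrite /etat eqxx.
have [t0 t00 tr] := Dnu_transport hphi cA reachA.
(* The height must lie below [r] and [t0] for the transport, and below [rho] so that all normals
   along the graph reach it. *)
pose m := Num.min (Num.min r rho) t0; have m0 : 0 < m by rewrite !lt_min r0 rho0.
pose t := m / 2; have tp : 0 < t by rewrite divr_gt0.
have tm : t < m by rewrite /t; lra.
move: (tm); rewrite !lt_min => /andP[/andP[tr1 tr2] tt0].
have [v1 h1] := tr _ _ _ _ _ _ Aa dp0 dr hL tp tr1 (ltW tt0).
have [v2 w2] := transport_resolvent v1.
rewrite -w2 //.
apply: (normal_field_diff hphi C10 prox ext dp0 u1 p0u flat Aa tp (ltW tr2) h1 _ fa _ eps0 oU) => //.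
- by rewrite v2.
- by rewrite /etat eqxx.
Qed.

(* With normals on both sides of the hyperplane, A contains points a + k + O(|k|^2), which
   bounds delta at x_r + e v by its value for the point with k = theta e v, beating an
   infinite curvature in the direction v. *)
Lemma finite_curvature C1 a eta p0 (r : R) (L : 'M[R]_n.+1) v : 0 < C1 ->
  proximal_bound phi A C1 -> A a -> dual p0 eta ->
  (forall q, A q -> dot (q - a) p0 <= C1 * enorm (q - a) ^+ 2) ->
  (forall q, A q -> dot (q - a) (- p0) <= C1 * enorm (q - a) ^+ 2) ->
  flat_at A a (- p0) -> 0 < r -> delta (a + r *: eta) = r ->
  Dnu_is phi A (a + r *: eta) L -> v != 0 -> v *m L <> r^-1 *: v.
Proof.
move=> C10 prox Aa dp0 bel1 bel2 flat r0 dr hL v0 hv.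
have [pp0 ge pe] := dp0; have ep := unit_normal_gt0 dp0.
have [Q [Qpos etaQ diffQ]] := dual_diff hphi dp0.
have symQ := hess_sym hphi dp0 etaQ diffQ.
have vp : dot v p0 = 0.
  have := derivative_tangent hphi cA Aa r0 dr dp0 hL v.
  by rewrite hv dotZl => /eqP; rewrite mulf_eq0 invr_eq0 gt_eqF //= => /eqP.
have [u ud] : exists u, u = - (enorm p0)^-1 *: p0 by exists (- (enorm p0)^-1 *: p0).
have u1 : enorm u = 1.
  by rewrite ud enormZ normrN gtr0_norm ?invr_gt0 // mulVf // gt_eqF.
have up : dot u p0 = - enorm p0.
  by rewrite ud dotZl -enorm_sqr expr2 mulNr mulKf // gt_eqF.
have up' : 0 < dot u (- p0) by rewrite dotNr up opprK.
have ppN : phi (- p0) = 1 by rewrite (norm_opp pN).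
have [d1 d10 hd1] := line_meets hphi cA C10 prox Aa ppN flat bel2 u1 up' ltr01 (lexx _).
pose m := dot (v *m Q) v; have m0 : 0 < m := Qpos _ v0.
have ev := enorm_gt0 v0.
(* The proximal inequalities for [p0] and [- p0] give [|tau| |p0| <= C1 (2 s |v|)^2], that is
   [|tau| <= Ct s^2]. *)
pose Ct := 4 * C1 * enorm v ^+ 2 / enorm p0.
have Ct0 : 0 < Ct by rewrite divr_gt0 // !mulr_gt0 // exprn_gt0.
pose C3 := 4 * C1 * enorm v ^+ 2; have C30 : 0 < C3 by rewrite !mulr_gt0 // exprn_gt0.
have CtE : enorm p0 * Ct = C3 by rewrite /Ct mulrC divfK // gt_eqF.
pose Cq := 2 * Ct * `|dot (v *m Q) u| + Ct ^+ 2 * `|dot (u *m Q) u|.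
have Cq0 : 0 <= Cq.
  apply: addr_ge0; apply: mulr_ge0 => //; last exact: sqr_ge0.
  by apply: mulr_ge0 => //; exact: ltW.
(* The competing point of [A] is near [a + s v] with [s = th t]. Passing from [t] to [t - s] gains
   about [2 th m] in the second-order term, while the offset [tau] costs [2 r C3 th^2]; for small
   [th] the gain prevails. *)
pose th := Num.min 2^-1 (m / (4 * r * C3)).
have th0 : 0 < th.
  by rewrite lt_min invr_gt0 ltr0n /=; apply: divr_gt0 => //; rewrite !mulr_gt0.
have th1 : th <= 2^-1 by rewrite ge_min lexx.
have th2 : r * C3 * th <= m / 4.
  have : th <= m / (4 * r * C3) by rewrite ge_min lexx orbT.
  by rewrite ler_pdivlMr ?mulr_gt0 //; lra.
pose W := enorm v ^+ 2 + (enorm v + Ct) ^+ 2.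
have W0 : 0 < W by rewrite addr_gt0 // exprn_gt0 // addr_gt0.
pose e := th * m / (8 * r * W).
have e0 : 0 < e by rewrite divr_gt0 ?mulr_gt0.
have eE : r * (e * W) = th * m / 8 by rewrite /e; field; rewrite !gt_eqF.
have [d2 d20 hd2] := delta_expansion hphi cA Aa r0 dr dp0 diffQ hL e0.
have [d3 d30 hd3] := star_expansion hphi dp0 etaQ diffQ r0 e0.
have Cq1 : 0 < Cq + 1 by rewrite ltr_wpDl.
have vC : 0 < enorm v + Ct by rewrite addr_gt0.
pose M := Num.min (Num.min 1 (th * m / (4 * (Cq + 1))))
   (Num.min (d1 / enorm v) (Num.min (d2 / enorm v) (d3 / (enorm v + Ct)))).
have M0 : 0 < M by rewrite !lt_min ltr01 !divr_gt0 ?mulr_gt0.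
pose ep' := M / 2; have tp : 0 < ep' by rewrite divr_gt0.
have : ep' < M by rewrite /ep'; lra.
move: tp; move: ep' => t tp; rewrite !lt_min => /andP[/andP[t1 t2] /andP[t3 /andP[t4 t5]]].
rewrite ltr_pdivlMr // in t3; rewrite ltr_pdivlMr // in t4; rewrite ltr_pdivlMr // in t5.
rewrite ltr_pdivlMr ?mulr_gt0 // in t2.
pose s := th * t; have s0 : 0 < s by rewrite mulr_gt0.
have st : s <= t by rewrite ger_pMl //; lra.
have sv : enorm (s *: v) < d1.
  rewrite enormZ (gtr0_norm s0); apply: le_lt_trans t3; rewrite ler_wpM2r ?enorm_ge0 //.
have [tau htau Aq] := hd1 (s *: v) ltac:(by rewrite dotNr dotZl vp mulr0 oppr0) sv.
rewrite mul1r in htau.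
have tau2 : `|tau| <= Ct * s ^+ 2.
  have qa : a + s *: v + tau *: u - a = s *: v + tau *: u by rewrite -(addrA a) addrAKl.
  have b1 := bel1 _ Aq; have b2 := bel2 _ Aq; rewrite qa in b1 b2.
  rewrite dotNr in b2; rewrite dotDl !dotZl vp mulr0 add0r up in b1 b2.
  have n1 : enorm (s *: v + tau *: u) ^+ 2 <= (2 * (s * enorm v)) ^+ 2.
    have nn : 0 <= 2 * (s * enorm v) by rewrite !mulr_ge0 ?enorm_ge0 // ltW.
    rewrite ler_pXn2r ?nnegrE ?enorm_ge0 //.
    apply: le_trans (enormD _ _) _; rewrite (enormZ tau) u1 mulr1.
    by move: htau; rewrite enormZ (gtr0_norm s0); lra.
  have n2 := ler_wpM2l (ltW C10) n1.
  rewrite -(ler_pM2l ep) mulrA CtE -{1}(gtr0_norm ep) -normrM ler_norml /C3.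
  by apply/andP; split; move: b1 b2 n2; clear; lra.
have up2 := delta_le hphi (a + r *: eta + t *: v) Aq.
pose k := (t - s) *: v - tau *: u.
have kE : a + r *: eta + t *: v - (a + s *: v + tau *: u) = r *: eta + k.
  by rewrite /k; apply/rowP => i; rewrite !mxE; ring.
rewrite kE in up2.
have tauE : `|tau| <= Ct * t.
  apply: le_trans tau2 _; rewrite ler_pM2l //.
  have s1 : s <= 1 by lra.
  by apply: le_trans st; rewrite expr2 ger_pMl.
have kn : enorm k <= t * (enorm v + Ct).
  apply: le_trans (enormB _ _) _; rewrite !enormZ u1 mulr1 ger0_norm ?subr_ge0 //.
  have : (t - s) * enorm v <= t * enorm v by rewrite ler_wpM2r ?enorm_ge0 //; lra.
  by move: tauE; clear; lra.
have := hd3 k (le_lt_trans kn t5).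
have := hd2 (t *: v) ltac:(by rewrite enormZ (gtr0_norm tp)).
rewrite !ler_norml => /andP[g1 _] /andP[_ g2].
have kp : dot k p0 = tau * enorm p0.
  by rewrite /k dotBl !dotZl vp up; ring.
have kQ : dot (k *m Q) k <= (t - s) ^+ 2 * m + Cq * t ^+ 3.
  have -> : dot (k *m Q) k = (t - s) ^+ 2 * m - 2 * ((t - s) * tau) * dot (v *m Q) u
     + tau ^+ 2 * dot (u *m Q) u.
    rewrite /k mulmxBl -!scalemxAl !(dotBl, dotBr, dotZl, dotZr) (symQ u v) /m; ring.
  have tt : `|tau| <= Ct * t ^+ 2.
    by apply: le_trans tau2 _; rewrite ler_pM2l // ler_pXn2r ?nnegrE // ltW.
  have q1 : - (2 * ((t - s) * tau) * dot (v *m Q) u) <= 2 * (t * (Ct * t ^+ 2)) * `|dot (v *m Q) u|.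
    apply: le_trans (ler_norm _) _; rewrite normrN !normrM (ger0_norm (_ : 0 <= 2)) //.
    rewrite ler_wpM2r // ler_pM2l // ler_pM // ger0_norm ?subr_ge0 //; lra.
  have q2 : tau ^+ 2 * dot (u *m Q) u <= t ^+ 3 * (Ct ^+ 2 * `|dot (u *m Q) u|).
    apply: le_trans (ler_norm _) _; rewrite normrM mulrA ler_wpM2r // normrX.
    have : `|tau| ^+ 2 <= (Ct * t ^+ 2) ^+ 2.
      by rewrite ler_pXn2r ?nnegrE // mulr_ge0 ?sqr_ge0 // ltW.
    move=> h; apply: le_trans h _.
    have -> : (Ct * t ^+ 2) ^+ 2 = Ct ^+ 2 * t ^+ 3 * t by ring.
    rewrite mulrC [leRHS]mulrC ger_pMl; last by rewrite mulr_gt0 ?exprn_gt0.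
    exact: ltW.
  by move: q1 q2; rewrite /Cq; clear; lra.
have vL : dot (t *: v *m (L *m Q)) (t *: v) = t ^+ 2 * (m / r).
  by rewrite mulmxA -scalemxAl hv -!scalemxAl !(dotZl, dotZr) /m; field; rewrite gt_eqF.
rewrite vL dotZl vp mulr0 enormZ (gtr0_norm tp) in g1.
rewrite kp in g2.
have kp2 : tau * enorm p0 <= C3 * s ^+ 2.
  rewrite -CtE -mulrA mulrC ler_pM2l //; exact: le_trans (ler_norm _) tau2.
have kn2 : e * enorm k ^+ 2 <= e * (t ^+ 2 * (enorm v + Ct) ^+ 2).
  rewrite ler_pM2l // -exprMn ler_pXn2r ?nnegrE ?enorm_ge0 // mulr_ge0 ?(ltW tp) ?(ltW vC) //.
have g3 : (dot (k *m Q) k - (tau * enorm p0) ^+ 2) / (2 * r) <=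
    ((t - s) ^+ 2 * m + Cq * t ^+ 3) / (2 * r).
  rewrite ler_pM2r ?invr_gt0 ?mulr_gt0 //.
  by have := sqr_ge0 (tau * enorm p0); move: kQ; clear; lra.
have tot : t ^+ 2 * (m / r) / 2 - e * t ^+ 2 * W <= C3 * s ^+ 2
   + ((t - s) ^+ 2 * m + Cq * t ^+ 3) / (2 * r).
  by move: up2 g1 g2 g3 kp2 kn2; rewrite /W exprMn; clear; lra.
have t2p : 0 < t ^+ 2 by rewrite exprn_gt0.
have fin : m - 2 * (r * (e * W)) <= 2 * (r * C3 * th) * th + ((1 - th) ^+ 2 * m + Cq * t).
  have rr : 0 < 2 * r by rewrite mulr_gt0.
  rewrite -(ler_pM2l t2p).
  have := ler_wpM2l (ltW rr) tot.
  have -> : 2 * r * (t ^+ 2 * (m / r) / 2 - e * t ^+ 2 * W) = t ^+ 2 * (m - 2 * (r * (e * W))).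
    by field; rewrite gt_eqF.
  have -> // : 2 * r * (C3 * s ^+ 2 + ((t - s) ^+ 2 * m + Cq * t ^+ 3) / (2 * r)) =
    t ^+ 2 * (2 * (r * C3 * th) * th + ((1 - th) ^+ 2 * m + Cq * t)).
  by rewrite /s; field; rewrite gt_eqF.
rewrite eE in fin.
have f1 := ler_wpM2r (ltW th0) th2.
have f2 : Cq * t <= th * m / 4.
  have : Cq * t <= (Cq + 1) * t by rewrite ler_pM2r // lerDl.
  by move: t2; clear; lra.
have f3 : th * m * th <= th * m * 2^-1 by rewrite ler_pM2l // mulr_gt0.
have f4 : 0 < th * m by rewrite mulr_gt0.
by move: fin f1 f2 f3 f4; clear; rewrite sqrrB; lra.
Qed.

End Assembly.

(** * Eigenvalues of the normal field and opposite normals *)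

Section PrincipalCurvatures.
Context {R : realType} {n : nat}.
Notation V := 'rV[R]_(n.+1).
Implicit Types (a u v w q eta : V).
Context (phi : V -> R) (hphi : admissible_norm phi).
Context (A : set V) (cA : closed A) (reachA : (0 < reach A)%E).

(** The order of the list survives because [t / (1 - r t)] increases where [r t < 1]:
    [eigenvalue_le] gives [r t <= 1], and invertibility excludes equality. *)
Lemma eigs_perp_resolvent a eta p0 u (r : R) s (L : 'M[R]_n.+1) : A a -> dualpair phi p0 eta ->
  enorm u = 1 -> p0 = enorm p0 *: u -> 0 < r -> dphi phi A (a + r *: eta) = r ->
  Dnu_is phi A (a + r *: eta) L -> size s = n -> sorted <=%R s ->
  char_poly L = 'X * \prod_(t <- s) ('X - t%:P) -> 1%:M - r *: L \in unitmx ->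
  eigs_perp (invmx (1%:M - r *: L) *m L) u (kappa_of r s).
Proof.
move=> Aa dp0 u1 p0u r0 dr hL ss so hch uU.
have [Q [Qpos etaQ diffQ]] := dual_diff hphi dp0.
have ep := unit_normal_gt0 hphi dp0.
have tu v : dot (v *m L) u = 0.
  have := derivative_tangent hphi cA Aa r0 dr dp0 hL v; rewrite p0u dotZr => /eqP.
  by rewrite mulf_eq0 gt_eqF //= => /eqP.
split; first by rewrite size_map.
split; last first.
  rewrite char_poly_projperp // => [|v]; last by rewrite mulmxA.
  exact: char_poly_resolvent (lt0r_neq0 r0) ss hch uU.
apply: kappa_sorted => //; apply/allP => t ts.
have [v v0 hv] := eigs_perp_eigenvector hch ts.
have := eigenvalue_le hphi cA Aa r0 dr dp0 Qpos etaQ diffQ hL v0 hv.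
rewrite -[r^-1]mul1r ler_pdivlMr // mulrC le_eqVlt => /orP[/eqP e|//].
have : \det (1%:M - r *: L) != 0 by rewrite unitmxE unitfE in uU.
rewrite (det_resolvent (lt0r_neq0 r0) ss hch) (perm_big _ (perm_to_rem ts)) big_cons /=.
by rewrite e subrr mul0r eqxx.
Qed.

Lemma normals_at_flat (C1 : R) a p0 eta2 p2 : 0 < C1 -> proximal_bound phi A C1 ->
  phi p0 = 1 -> flat_at A a p0 -> Nphi phi A a eta2 -> dualpair phi p2 eta2 ->
  p2 = p0 \/ p2 = - p0.
Proof.
move=> C10 prox pp0 flat Na dp2.
have [e1|n1] := eqVneq p2 p0; first by left.
have [e2|n2] := eqVneq p2 (- p0); first by right.
have h1 : 0 < enorm (p2 - p0) by rewrite enorm_gt0 // subr_eq0.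
have h2 : 0 < enorm (p2 + p0) by rewrite enorm_gt0 // addr_eq0.
pose e := Num.min (enorm (p2 - p0)) (enorm (p2 + p0)) / 2.
have m0 : 0 < Num.min (enorm (p2 - p0)) (enorm (p2 + p0)) by rewrite lt_min h1.
have m1 : Num.min (enorm (p2 - p0)) (enorm (p2 + p0)) <= enorm (p2 - p0) by rewrite ge_min lexx.
have m2 : Num.min (enorm (p2 - p0)) (enorm (p2 + p0)) <= enorm (p2 + p0) by rewrite ge_min lexx orbT.
have e0 : 0 < e by rewrite divr_gt0.
have [d d0 hd] := normals_near hphi C10 prox pp0 flat e0.
have em : e < Num.min (enorm (p2 - p0)) (enorm (p2 + p0)).
  by rewrite ltr_pdivrMr // ltr_pMr // ltr1n.
have := hd a eta2 p2 Na dp2; rewrite subrr enorm0 => /(_ d0) [|] h.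
  by move: (lt_le_trans em m1); rewrite ltNge h.
by move: (lt_le_trans em m2); rewrite ltNge h.
Qed.

(** [tNphin] asks for an actual list of real eigenvalues, obtained here from the symmetry of
    [L *m Q]. An entry with [r t = 1] would contradict [finite_curvature], whose two one-sided
    inequalities come from the two opposite normals. *)
Lemma opposite_normal_finite (C1 : R) a eta1 p1 eta2 : 0 < C1 -> proximal_bound phi A C1 ->
  Nphi phi A a eta1 -> dualpair phi p1 eta1 -> flat_at A a p1 ->
  tNphi phi A a eta2 -> dualpair phi (- p1) eta2 -> tNphin phi A a eta2.
Proof.
move=> C10 prox Na1 dp1 flat tN dp2; split=> //.
have [Na2 [r [r0 [hr [L hL]]]]] := tN.
have [Aa _] := Na2; have [_ ge _] := dp2.
have dr := urphi_delta hphi cA Aa ge r0 hr.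
have [Q [Qpos etaQ diffQ]] := dual_diff hphi dp2.
have symQ := hess_sym hphi dp2 etaQ diffQ.
have symLQ := LQ_sym hphi cA Aa r0 dr dp2 diffQ hL.
have ep := unit_normal_gt0 hphi dp2.
have ext := dual_ext_normal hphi dp2.
set w := _ *: - p1 in ext.
have [_ [w1 _]] := ext.
have tw v : dot (v *m L) w = 0.
  by rewrite dotZr (derivative_tangent hphi cA Aa r0 dr dp2 hL) mulr0.
have [s hs] := self_adjoint_real_eigs w1 tw symLQ symQ Qpos.
exists r, s; split=> //; split=> //; split.
  by exists L, eta2, w; split=> //; split=> //; exact: (nu_at hphi Aa r0 dr dp2 hL).
apply/allP => t ts; apply/eqP => rt.
have [v v0 hv] := eigs_perp_eigenvector (eigs_perp_charE w1 tw hs) ts.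
have tE : t = r^-1 by rewrite -[t](mulKf (lt0r_neq0 r0)) rt mulr1.
have flat' : flat_at A a (- - p1) by rewrite opprK.
apply: (finite_curvature hphi cA C10 prox Aa dp2 (prox_below prox Na2 dp2) _ flat' r0 dr hL v0).
  by rewrite opprK; exact: (prox_below prox Na1 dp1).
by rewrite -tE.
Qed.

End PrincipalCurvatures.

Theorem theorem5p6 (R : realType) (n : nat) (phi : 'rV[R]_n.+1 -> R)
    (A : set 'rV[R]_n.+1) :
  admissible_norm phi -> closed A -> (0 < reach A)%E ->
  (forall a eta u : 'rV[R]_n.+1,
    tNphin phi A a eta -> Neucl A a u -> is_grad phi u eta ->
    (* (a) *)
    (forall nu : 'rV[R]_n.+1, sphere nu -> dot nu u != 0 ->
       exists (eps : R) (f : 'rV[R]_n.+1 -> R), 0 < eps /\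
         rdiff_scalar (Uball eps a nu) f a /\
         (forall b, Uball eps a nu b -> bdry A (b + f b *: nu))) /\
    (* (b) *)
    (exists (eps : R) (f : 'rV[R]_n.+1 -> R), 0 < eps /\
       rdiff_scalar (Uball eps a u) f a /\
       (forall b, Uball eps a u b -> bdry A (b + f b *: u)) /\
       exists etat : 'rV[R]_n.+1 -> 'rV[R]_n.+1,
         (forall b, Uball eps a u b ->
            bdWphi phi (etat b) /\ Nphi phi A (b + f b *: u) (etat b)) /\
         etat a = eta /\
         exists L : 'M[R]_n.+1, rderiv_is (Uball eps a u) etat a L /\
           forall (r : R) (s : seq R), 0 < r -> (r%:E < urphi phi A a eta)%E ->
             chi_list phi A (a + r *: eta) s ->
             eigs_perp L u (kappa_of r s))) /\
  (* moreover: p(tilde N_n) and p(tilde N \ tilde N_n) are disjoint *)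
  (forall a eta1 eta2 : 'rV[R]_n.+1,
     ~ (tNphin phi A a eta1 /\ tNphi phi A a eta2 /\ ~ tNphin phi A a eta2)).
Proof.
move=> hphi cA reachA.
have [C1 C10 prox] := Nphi_prox hphi cA reachA.
have [rho rho0 ext] := Nphi_extend hphi cA reachA.
split=> [a eta u tN [_ [u1 _]] hg|a eta1 eta2 [tN1 [tN2 ntN2]]].
  have [p0 [r [L [Na dp0 [r0 dr hL] uL]]]] := tNphin_data hphi cA tN.
  have [Aa [_ _]] := Na; have [_ ge _] := dp0.
  have flat := flat_of_unit hphi cA Aa r0 dp0 dr hL uL.
  have up : 0 < phi u.
    by apply: (norm_gt0 (phi_norm hphi)); apply: (norm_neq0 (@enorm_is_norm R n)); rewrite u1.
  have p0E := dual_uniq hphi dp0 (is_grad_dual hphi u1 hg).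
  have p0u : p0 = enorm p0 *: u.
    by rewrite {2}p0E enormZ u1 mulr1 gtr0_norm ?invr_gt0.
  split=> [nu nu1 nuu|].
    apply: (graph_function_any hphi cA C10 prox Na dp0 flat nu1).
    by rewrite p0E dotZr mulf_neq0 // invr_neq0 // gt_eqF.
  have [eps [f [eps0 [hf [hb [etat [hN [ea hd]]]]]]]] :=
    normal_graph hphi cA reachA C10 prox rho0 ext Na dp0 flat u1 p0u r0 dr hL uL.
  exists eps, f; split=> //; split=> //; split=> //; exists etat; split=> //; split=> //.
  (* The matrix is built at one height [r]; for every other admissible [r'] the invariance of the
     resolvent identifies it. *)
  exists (invmx (1%:M - r *: L) *m L); split=> // r' s r'0 hr' hc.
  have dr' := urphi_delta hphi cA Aa ge r'0 hr'.
  have [L' [hL' _ ss so hch]] := chi_list_data hphi cA Aa dp0 r'0 dr' hc.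
  have [uL' <-] := resolvent_invariant hphi cA reachA Aa dp0 r0 dr hL r'0 dr' hL' uL.
  exact: (eigs_perp_resolvent hphi cA Aa dp0 u1 p0u r'0 dr' hL' ss so hch uL').
apply: ntN2.
have [p1 [r [L [Na1 dp1 [r0 dr hL] uL]]]] := tNphin_data hphi cA tN1.
have [Aa _] := Na1.
have flat := flat_of_unit hphi cA Aa r0 dp1 dr hL uL.
have [Na2 _] := tN2; have [_ [/(bdWphiP hphi) ge2 _]] := Na2.
have [p2 dp2] := dualpair_exists hphi ge2.
have [pp1 _ _] := dp1.
(* Equal conormals give [eta2 = eta1], whose curvatures are finite by assumption; only the opposite
   normal needs an argument. *)
have [e|e] := normals_at_flat hphi C10 prox pp1 flat Na2 dp2; rewrite e in dp2.
  by rewrite -(dualpair_sym_uniq hphi dp1 dp2).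
exact: (opposite_normal_finite hphi cA C10 prox Na1 dp1 flat tN2 dp2).
Qed.
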